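(* Let $\mathcal{X},\mathcal{Y}$ be finite, $c:\mathcal{X}\times\mathcal{Y}\to\mathbb{R}_+$, and let $\mu\in\mathcal{M}_s(\mathcal{X}^{\mathbb{N}})$ and $\nu\in\mathcal{M}_s(\mathcal{Y}^{\mathbb{N}})$ be ergodic with $\phi$-mixing coefficients $\phi_\mu$ and $\phi_\nu$, respectively. Then there exists a constant $C<\infty$ such that for every $n\ge1$, $k\in\{1,\ldots,n\}$, $g\ge0$ and $t\in(0,\frac14\|c\|_\infty]$, $$\mathbb{E}\left|\hat S_{k,n}-S(\mu,\nu)\right|\le\|c\|_\infty\left(\frac{k(\phi_\mu(g+1)+\phi_\nu(g+1))}{k+g}+\frac{3g}{k}\right)+C\left(t+u_t(k,n)+v_t(k,n)\right),$$ where $$u_t(k,n)=\left(\frac1{n^2}\sum_{\ell=0}^n(n-\ell+1)\phi_\mu^{1/2}(\ell)\right)^{1/2}\int_t^{\frac14\|c\|_\infty}\mathcal{N}\left(\mathcal{X}^k,\tfrac1k c_{\mathcal{X},k},\varepsilon\right)^{1/2}d\varepsilon,$$ $$v_t(k,n)=\left(\frac1{n^2}\sum_{\ell=0}^n(n-\ell+1)\phi_\nu^{1/2}(\ell)\right)^{1/2}\int_t^{\frac14\|c\|_\infty}\mathcal{N}\left(\mathcal{Y}^k,\tfrac1k c_{\mathcal{Y},k},\varepsilon\right)^{1/2}d\varepsilon.$$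
   Context: Measures: $\mathcal{M}_s(\mathcal{U}^{\mathbb{N}})$ is the set of Borel probability measures on $\mathcal{U}^{\mathbb{N}}$ (product topology, $\mathcal{U}$ finite discrete) invariant under the left shift; $\mathcal{X}^{\mathbb{N}}\times\mathcal{Y}^{\mathbb{N}}$ is identified with $(\mathcal{X}\times\mathcal{Y})^{\mathbb{N}}$. Ergodic: shift-invariant measurable sets have measure 0 or 1. $\gamma_k$ is the law of the first $k$ coordinates under $\gamma$. Optimal joining: $\Pi(\alpha,\beta)$ is the set of couplings of $\alpha,\beta$; $T_d(\alpha,\beta)=\inf_{\pi\in\Pi(\alpha,\beta)}\int d\,d\pi$. $\mathcal{J}(\mu,\nu)$ is the set of stationary couplings (joinings) of $\mu$ and $\nu$; $S(\mu,\nu)=\inf_{\lambda\in\mathcal{J}(\mu,\nu)}\int c\,d\lambda_1$. $c_k(x_1^k,y_1^k)=\sum_{\ell=1}^kc(x_\ell,y_\ell)$ and $\|c\|_\infty=\max_{x,y}c(x,y)$. Estimator: $X=X_1,X_2,\ldots$ and $Y=Y_1,Y_2,\ldots$ have distributions $\mu$ and $\nu$ (nothing is assumed about their joint dependence). $\hat\mu_{k,n}(x_1^k)=\frac1{n-k+1}\sum_{\ell=0}^{n-k}\mathbb{1}(x_1^k=X_{\ell+1}^{\ell+k})$, $\hat\nu_{k,n}$ is defined in the same way from $Y_1^n$, and $\hat S_{k,n}=k^{-1}T_{c_k}(\hat\mu_{k,n},\hat\nu_{k,n})$. Mixing: for $\gamma\in\mathcal{M}_s(\mathcal{U}^{\mathbb{N}})$,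 the $\phi$-mixing coefficients $\phi_\gamma:\mathbb{N}_0\to\mathbb{R}_+$ are given by $\phi_\gamma(0)=1$ and, for integer $g\ge0$, $\phi_\gamma(g+1)=\sup\{|\gamma(\mathcal{U}^g\times B\mid A)-\gamma(B)|:A\subset\mathcal{U}^\ell,\ \ell\ge1,\ B\subset\mathcal{U}^{\mathbb{N}}\text{ measurable}\}$, where $\gamma(\mathcal{U}^g\times B\mid A)=\gamma(A\times\mathcal{U}^g\times B)/\gamma(A)$ with $A$ identified with the event that the first $\ell$ coordinates lie in $A$ (and $\gamma(A)>0$). Adapted costs: $c_{\mathcal{X}}(x,x')=\sup_{y\in\mathcal{Y}}|c(x,y)-c(x',y)|$, $c_{\mathcal{Y}}(y,y')=\sup_{x\in\mathcal{X}}|c(x,y)-c(x,y')|$, and $c_{\mathcal{X},k}(x_1^k,\tilde x_1^k)=\sum_{\ell=1}^kc_{\mathcal{X}}(x_\ell,\tilde x_\ell)$, $c_{\mathcal{Y},k}(y_1^k,\tilde y_1^k)=\sum_{\ell=1}^kc_{\mathcal{Y}}(y_\ell,\tilde y_\ell)$; these are pseudometrics. $\mathcal{N}(\mathcal{U},d,\varepsilon)$ is the $\varepsilon$-covering number of $\mathcal{U}$ with respect to the pseudometric $d$. *)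

(* Defs.v *)
From HB Require Import structures.
From mathcomp Require Import all_boot all_order all_algebra.
From mathcomp Require Import all_classical all_reals all_analysis.

Set Implicit Arguments.
Unset Strict Implicit.
Unset Printing Implicit Defensive.

Import Order.TTheory GRing.Theory Num.Theory.
Import numFieldNormedType.Exports.

Local Open Scope classical_set_scope.
Local Open Scope ring_scope.

(* Finite alphabets. The library's measurable types are pointed, hence so are
   our alphabets; there is no probability measure on the sequences over an
   empty alphabet. *)
#[short(type="pointedFinType")]
HB.structure Definition PointedFinite := {T of Finite T & Pointed T}.

HB.saturate prod.

(* The open sets of the product topology, for discrete U. *)
Definition seq_open (U : pointedFinType) : set (set (nat -> U)) :=
  @open {ptws nat -> discrete_topology U}.

(* Sequences with the Borel sigma-algebra. They are indexed from 0: the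
   coordinate u_(i+1) of the mathematical text is [u i]. *)
Definition seqspace (U : pointedFinType) : Type :=
  g_sigma_algebraType (@seq_open U).

Definition shiftn (U : Type) (m : nat) (u : nat -> U) : nat -> U :=
  fun i => u (m + i)%N.

Definition block (U : Type) (k : nat) (u : nat -> U) : k.-tuple U :=
  [tuple u i | i < k].

Section StationaryMeasures.
Context {R : realType} {U : pointedFinType}.
Implicit Type gam : probability (seqspace U) R.

Definition stationary gam : Prop :=
  forall A : set (seqspace U), measurable A ->
    gam (shiftn 1 @^-1` A) = gam A.

Definition ergodic gam : Prop :=
  forall A : set (seqspace U), measurable A ->
    shiftn 1 @^-1` A = A -> gam A = 0%E \/ gam A = 1%E.

Definition block_law gam (k : nat) (w : k.-tuple U) : R :=
  fine (gam [set u : seqspace U | block k u = w]).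

Definition cylinder (l : nat) (A : {set l.-tuple U}) : set (seqspace U) :=
  [set u | block l u \in A].

Definition phi_gap gam (g : nat) : R :=
  sup [set r : R | exists (l : nat) (A : {set l.-tuple U})
                          (B : set (seqspace U)),
        [/\ (1 <= l)%N, measurable B, (0 < gam (cylinder A))%E &
            r = `| fine (gam (cylinder A `&` shiftn (l + g) @^-1` B))
                     / fine (gam (cylinder A)) - fine (gam B) | ]].

Definition phi_mixing gam (j : nat) : R :=
  if j is g.+1 then phi_gap gam g else 1.

End StationaryMeasures.

Section FiniteTransport.
Context {R : realType} {A B : finType}.

(* Measures on finite sets are given by their mass functions. *)
Definition couplings (al : A -> R) (be : B -> R) : set (A * B -> R) :=
  [set q | [/\ forall p, 0 <= q p,
               forall a, \sum_b q (a, b) = al a &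
               forall b, \sum_a q (a, b) = be b ]].

Definition transport (d : A -> B -> R) (al : A -> R) (be : B -> R) : R :=
  inf [set \sum_p d p.1 p.2 * q p | q in couplings al be].

End FiniteTransport.

Section Costs.
Context {R : realType} {X Y : finType}.

(* [maxr] folded from 0 is the maximum, as only nonnegative functions occur. *)
Definition cost_norm (c : X -> Y -> R) : R :=
  \big[Num.max/0]_(p : X * Y) c p.1 p.2.

Definition cost_block (c : X -> Y -> R) (k : nat)
    (x : k.-tuple X) (y : k.-tuple Y) : R :=
  \sum_(i < k) c (tnth x i) (tnth y i).

Definition adapted_l (c : X -> Y -> R) (x x' : X) : R :=
  \big[Num.max/0]_(y : Y) `| c x y - c x' y |.

Definition adapted_r (c : X -> Y -> R) (y y' : Y) : R :=
  \big[Num.max/0]_(x : X) `| c x y - c x y' |.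

End Costs.

(* Closed balls centred in T. The default #|T| is attained by the full set as
   soon as d vanishes on the diagonal and eps >= 0. *)
Definition covering_number {R : realType} (T : finType) (d : T -> T -> R)
    (eps : R) : nat :=
  \big[minn/#|T|]_(A : {set T} | [forall u, exists a in A, d u a <= eps]) #|A|.

Section Joinings.
Context {R : realType} {X Y : pointedFinType}.
Implicit Types (mu : probability (seqspace X) R)
  (nu : probability (seqspace Y) R).

(* (X * Y)^nat plays the role of X^nat * Y^nat. *)
Definition joinings mu nu : set (probability (seqspace (X * Y)%type) R) :=
  [set lam | [/\ stationary lam,
      forall A : set (seqspace X), measurable A ->
        lam [set z | A (fun i => (z i).1)] = mu A &
      forall B : set (seqspace Y), measurable B ->
        lam [set z | B (fun i => (z i).2)] = nu B ]].

Definition joining_cost (c : X -> Y -> R) mu nu : R :=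
  inf [set \sum_(p : X * Y) c p.1 p.2 * block_law lam [tuple p]
      | lam in joinings mu nu].

End Joinings.

Definition empirical {R : realType} {U : finType} (k n : nat) (u : nat -> U)
    (w : k.-tuple U) : R :=
  (n - k + 1)%:R^-1 * \sum_(0 <= l < (n - k).+1) (w == block k (shiftn l u))%:R.

Arguments empirical {R U} k n u w.

Definition S_hat {R : realType} {X Y : finType} (c : X -> Y -> R) (k n : nat)
    (x : nat -> X) (y : nat -> Y) : R :=
  k%:R^-1 * transport (cost_block c (k := k)) (empirical k n x) (empirical k n y).

(* The common form of u_t(k,n) and v_t(k,n): phi is a sequence of mixing
   coefficients, d a single-letter pseudometric, and M stands for ||c||. *)
Definition entropy_term {R : realType} {U : finType} (phi : nat -> R)
    (d : U -> U -> R) (M t : R) (k n : nat) : R :=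
  Num.sqrt ((n ^ 2)%:R^-1 *
            \sum_(0 <= l < n.+1) (n - l + 1)%:R * Num.sqrt (phi l)) *
  (\int[lebesgue_measure]_(eps in `[t, M / 4])
     Num.sqrt (covering_number
       (fun x x' : k.-tuple U => k%:R^-1 * cost_block d x x') eps)%:R)%R.

(* Main.v *)
Require Import Defs.
From HB Require Import structures.
From mathcomp Require Import all_boot all_order all_algebra.
From mathcomp Require Import all_classical all_reals all_analysis.
From mathcomp Require Import measurable_realfun ring lra zify.

(** Write T_k for the normalized transport cost between the laws of the first
    k letters under [mu] and [nu], S for the optimal joining cost, and W for
    transport with respect to an adapted block metric. The error splits as
    |S_hat - S| <= W(emp_X, mu_k) + W(emp_Y, nu_k) + |T_k - S|, because moving
    either marginal of a coupling changes its cost by at most the adapted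
    distance moved ([transport_stable]).

    Bias ([joining_cost_bias]). T_k <= S since the block laws of a joining are
    coupled and have k times its cost. Conversely, a coupling of the k-block
    laws is repeated along the time axis, with gaps of length g between
    consecutive blocks. Across a gap the conditional law of the next block
    differs from the stationary one by at most phi(g+1) in total variation,
    so each repetition costs at most k T_k + k M phi + g M, where phi is the
    sum of the two coefficients and M the norm of the cost ([within_extend]).
    Averaging these long couplings over time shifts and passing to a
    generalized limit gives a shift-invariant finitely additive law with the
    right marginals; a Kolmogorov extension turns it into a joining
    ([joining_of_couplings]).

    Fluctuations ([expected_transport_bound]). For either source gam, with block
    law gam_k, the mean of W(emp, gam_k) is estimated by chaining along nets at
    dyadic scales e: the transport cost is at most the sum over scales of e
    times the l1 distance of the two laws projected to the net
    ([within_chain]), and the expected l1 distance is at most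
    sqrt(N(e) V), where V bounds the total variance of the cell frequencies.
    Everything rests on a bound of V by a multiple of the mixing sum
    n^-2 sum_l (n-l+1) sqrt(phi(l)) that is uniform in k. The covariance at
    lag l >= k is at most phi(l-k+1). The k lags at which blocks overlap would
    cost a factor k if bounded trivially. But as soon as the letters, up to
    adapted distance zero, are not almost surely constant and some phi(s) is
    small, two blocks at a lag between s and k are close to each other only
    with probability exponentially small in k: close blocks match at most
    sampled positions s apart, and given the past each match has probability
    bounded away from one ([small_ball]). For this the cells must be small, so
    the chaining starts at a fixed small scale e0 and pays the constant factor
    M / e0 there.

    The other regimes are trivial up to constants. If the letters are constant
    up to distance zero, the transport cost vanishes. If phi stays bounded
    below, or t is at least of the order of e0, the bound exceeds a multiple of
    M. If k > n/2, the same small-ball estimate shows that the covering number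
    at scale e0 is at least of the order of k, hence of n, which compensates
    the factor n^(-1/2). The constant depends on the sources through s, the
    letter frequencies and the smallest positive adapted distance. *)

Set Implicit Arguments.
Unset Strict Implicit.
Unset Printing Implicit Defensive.

Import Order.TTheory GRing.Theory Num.Theory.
Import numFieldNormedType.Exports.

Local Open Scope classical_set_scope.
Local Open Scope ring_scope.

(** * The Borel sets of a sequence space *)

(** Finite-dimensional sets, described by invariance instead of by a set of
    words, so that [n] can be enlarged at will. *)
Definition determined (U : Type) (n : nat) (A : set (nat -> U)) : Prop :=
  forall u v, (forall i, (i < n)%N -> u i = v i) -> A u -> A v.

Lemma near_prefix (U : pointedFinType) (u : {ptws nat -> discrete_topology U})
    (n : nat) :
  \forall v \near u, forall i, (i < n)%N -> v i = u i.
Proof.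
have FF : Filter (nbhs u) := nbhs_filter u.
elim: n => [|n IH]; first by apply: (@filterE _ _ FF) => v i; rewrite ltn0.
have h : \forall v \near u, v n = u n.
  have := @proj_continuous nat (fun=> discrete_topology U) n u.
  move=> /(_ [set x | x = u n]); apply; exact: (discrete_set1 (u n)).
apply: (@filterS2 _ _ FF) IH h => v hv e i; rewrite ltnS leq_eqVlt => /orP[/eqP->//|].
exact: hv.
Qed.

Lemma measurable_determined (U : pointedFinType) (n : nat)
    (A : set (seqspace U)) : determined n A -> measurable A.
Proof.
move=> dA; apply: sub_sigma_algebra; rewrite /seq_open openE => u Au.
have FF : Filter (nbhs (u : {ptws nat -> discrete_topology U})) := nbhs_filter _.
rewrite /interior; apply: (@filterS _ _ FF) (near_prefix u n) => v uv.
by apply: dA Au => i /uv.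
Qed.

(** Otherwise there are points outside [A] that agree with [u] on ever longer
    prefixes; they converge pointwise to [u], although the complement of [A]
    is closed. *)
Lemma open_prefix (U : pointedFinType) (A : set (nat -> U)) (u : nat -> U) :
  seq_open A -> A u ->
  exists n, forall v, (forall i, (i < n)%N -> u i = v i) -> A v.
Proof.
rewrite /seq_open => oA Au; apply: contrapT => /forallNP h.
have {}h n : exists v, (forall i, (i < n)%N -> u i = v i) /\ ~ A v.
  by have /existsNP[v /not_implyP[v1 v2]] := h n; exists v.
have [v hv] := choice h.
pose W : topologicalType := {ptws nat -> discrete_topology U}.
have : (v : nat -> W) @ \oo --> (u : W).
  apply/pointwise_cvgP => i.
  apply: (@cvg_near_cst _ (discrete_topology U)) => //.
  by exists i.+1 => // n /= iN; have [/(_ i iN)] := hv n.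
move=> /(_ A); rewrite /= => vA.
have /vA [N _ /(_ N (leqnn N))] : nbhs (u : {ptws nat -> discrete_topology U}) A.
  exact: open_nbhs_nbhs.
by have [] := hv N.
Qed.

Definition pr {R : realType} {d} {T : measurableType d} (P : probability T R)
  (A : set T) : R := fine (P A).

Section Probabilities.
Context {R : realType} {d : measure_display} {T : measurableType d}.
Variable P : probability T R.

Lemma prE (A : set T) : measurable A -> P A = (pr P A)%:E.
Proof. by move=> mA; rewrite /pr fineK// fin_num_measure. Qed.

Lemma pr_ge0 (A : set T) : 0 <= pr P A.
Proof. by rewrite /pr fine_ge0. Qed.

Lemma pr_le1 (A : set T) : measurable A -> pr P A <= 1.
Proof. by move=> mA; rewrite -lee_fin -prE// probability_le1. Qed.

Lemma pr_setT : pr P setT = 1.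
Proof. by rewrite /pr probability_setT. Qed.

Lemma pr_total (I : finType) (f : T -> I) (A : set T) :
  measurable A -> (forall i, measurable (f @^-1` [set i])) ->
  pr P A = \sum_i pr P (A `&` f @^-1` [set i]).
Proof.
move=> mA mf; apply: EFin_inj; rewrite -prE//.
have mAf i : measurable (A `&` f @^-1` [set i]) by exact: measurableI.
have AE : A = \bigcup_(i in [set` enum I]) (A `&` f @^-1` [set i]).
  apply/seteqP; split=> [x Ax|x [i _ []//]].
  by exists (f x) => //=; rewrite mem_enum.
rewrite [in LHS]AE measure_fin_bigcup //; last first.
  by move=> i j _ _ [x [[_ <-] [_ <-]]].
rewrite -fsbig_seq ?enum_uniq// big_enum /= -sumEFin.
by apply: eq_bigr => i _; rewrite -prE.
Qed.

End Probabilities.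

(** Words are continued by the default letter, so that functions of words can
    be obtained from functions of sequences. *)
Definition pad (U : pointedFinType) (n : nat) (w : n.-tuple U) : nat -> U :=
  fun i => nth point w i.

Section Cylinders.
Context {U : pointedFinType}.
Implicit Types (A : set (seqspace U)).

Lemma block_eqP n (u v : nat -> U) :
  block n u = block n v <-> (forall i, (i < n)%N -> u i = v i).
Proof.
split=> [h i ni|h]; last by apply: eq_from_tnth => i; rewrite !tnth_mktuple h.
by have := congr1 (fun w => tnth w (Ordinal ni)) h; rewrite !tnth_mktuple.
Qed.

Lemma block_pad n (w : n.-tuple U) : block n (pad w) = w.
Proof.
by apply: eq_from_tnth => i; rewrite tnth_mktuple /pad -tnth_nth.
Qed.

Lemma pad_block n (u : nat -> U) i : (i < n)%N -> pad (block n u) i = u i.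
Proof.
by move=> ni; rewrite -[i]/(val (Ordinal ni)) /pad -tnth_nth tnth_mktuple.
Qed.

Lemma determinedW m n (A : set (nat -> U)) :
  (m <= n)%N -> determined m A -> determined n A.
Proof. by move=> mn dA u v uv; apply: dA => i im; apply: uv (leq_trans im mn). Qed.

Lemma determinedI n (A B : set (nat -> U)) :
  determined n A -> determined n B -> determined n (A `&` B).
Proof. by move=> dA dB u v uv [Au Bu]; split; [apply: dA Au|apply: dB Bu]. Qed.

Lemma determined_block n (A : set (n.-tuple U)) :
  determined n [set u | A (block n u)].
Proof. by move=> u v /block_eqP /= ->. Qed.

(** An open set is the union over [n] of the set of its points whose prefix of
    length [n] already forces membership. *)
Lemma measurable_seqspaceE :
  @measurable _ (seqspace U) =
  <<s [set A : set (nat -> U) | exists n, determined n A] >>.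
Proof.
apply/seteqP; split.
  apply: smallest_sub; first exact: smallest_sigma_algebra.
  move=> A oA.
  have -> : A = \bigcup_n [set u | forall v,
      (forall i, (i < n)%N -> u i = v i) -> A v].
    apply/seteqP; split=> [u Au|u [n _ /(_ u)]]; last by apply.
    by have [n hn] := open_prefix oA Au; exists n.
  apply: sigma_algebra_bigcup.
  move=> n; apply: sub_sigma_algebra; exists n => u v uv hu w vw; apply: hu.
  by move=> i ni; rewrite uv// vw.
apply: smallest_sub; first exact: sigma_algebra_measurable.
by move=> A [n dA]; exact: measurable_determined dA.
Qed.

Lemma measurable_to_seqspace d (T : measurableType d) (f : T -> nat -> U) :
  (forall i a, measurable [set x | f x i = a]) ->
  measurable_fun setT (f : T -> seqspace U).
Proof.
move=> mf; apply: (measurability _ measurable_seqspaceE) => _ [A [n dA] <-].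
rewrite setTI.
have -> : f @^-1` A = \bigcup_(w in [set w : n.-tuple U | A (pad w)])
    \bigcap_(i in `I_n) [set x | f x i = pad w i].
  apply/seteqP; split=> [x Ax|x [w Aw xw]].
    exists (block n (f x)) => [|i /= ni]; last by rewrite pad_block.
    by apply: dA Ax => i ni; rewrite pad_block.
  by apply: dA Aw => i ni; rewrite -xw.
apply: fin_bigcup_measurable => // w _.
by apply: fin_bigcap_measurable => // i _; exact: mf.
Qed.

Lemma measurable_shiftn m (A : set (seqspace U)) :
  measurable A -> measurable (shiftn m @^-1` A : set (seqspace U)).
Proof.
move=> mA; rewrite -[X in measurable X]setTI.
apply: (@measurable_to_seqspace _ (seqspace U) (shiftn m)) => // i a.
by apply: (@measurable_determined _ (m + i).+1) => u v uv /= <-; rewrite /shiftn uv.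
Qed.

Lemma measurable_block n (B : set (n.-tuple U)) :
  measurable ([set u | B (block n u)] : set (seqspace U)).
Proof. exact: measurable_determined (@determined_block _ B). Qed.

Context {R : realType}.
Implicit Types (gam : probability (seqspace U) R).

Lemma pr_determined gam n A : determined n A ->
  pr gam A = \sum_(w : n.-tuple U | `[< A (pad w) >]) block_law gam w.
Proof.
move=> dA; rewrite (pr_total gam (f := block n)); last 2 first.
- exact: measurable_determined dA.
- by move=> w; exact: (@measurable_block n [set w]).
rewrite [RHS]big_mkcond; apply: eq_bigr => w _.
case: asboolP => Aw.
  rewrite /pr /block_law; congr (fine (gam _)).
  apply/seteqP; split=> [u []//|u /= wu]; split=> //.
  by apply: dA Aw => i ni; rewrite -wu pad_block.
rewrite /pr (_ : _ `&` _ = set0) ?measure0//; apply/seteqP; split=> // u [Au wu].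
by apply: Aw; apply: dA Au => i ni; rewrite -wu pad_block.
Qed.

(** The finite-dimensional sets are stable under intersection and generate the
    Borel sets. *)
Lemma eq_seq_measure gam1 gam2 :
  (forall n (w : n.-tuple U), block_law gam1 w = block_law gam2 w) ->
  forall A, measurable A -> gam1 A = gam2 A.
Proof.
move=> h A mA.
apply: (@measure_unique _ R (seqspace U) [set A | exists n, determined n A]
  (fun=> setT)) => //.
- exact: measurable_seqspaceE.
- move=> B C [m mB] [n nC]; exists (maxn m n).
  by apply: determinedI; [apply: determinedW mB|apply: determinedW nC];
     rewrite ?leq_maxl ?leq_maxr.
- by move=> i; exists 0%N.
- by apply/seteqP; split=> // x _; exists 0%N.
- move=> B [n dB]; have mB := measurable_determined dB.
  apply: etrans (prE gam1 mB) (etrans _ (esym (prE gam2 mB))).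
  congr EFin; rewrite !(pr_determined _ dB).
  exact: eq_bigr.
- by move=> _; apply: (@le_lt_trans _ _ (gam1 setT)) => //; rewrite probability_setT ltry.
Qed.

End Cylinders.

(** * Extension of consistent finite-dimensional distributions *)

(** The measure is the image of Lebesgue measure on the unit interval under a
    coding. Words of length [n] index consecutive intervals of lengths [p w],
    and appending letters to a word subdivides its interval. A point of the
    unit interval is sent to the sequence whose prefixes index the intervals
    that contain it. *)
Section Kolmogorov.
Context {R : realType} {Z : pointedFinType}.
Variable p : seq Z -> R.
Hypothesis p1 : p [::] = 1.
Hypothesis p_ge0 : forall s, 0 <= p s.
Hypothesis pE : forall s, p s = \sum_z p (rcons s z).

Definition before (s : seq Z) (m : nat) : R :=
  \sum_(z : Z | (enum_rank z < m)%N) p (rcons s z).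

Lemma before_le s m n : (m <= n)%N -> before s m <= before s n.
Proof.
move=> mn; rewrite /before [leRHS](bigID (fun z => enum_rank z < m)%N) /=.
rewrite [X in _ <= X + _](eq_bigl (fun z => enum_rank z < m)%N).
  by rewrite lerDl sumr_ge0.
by move=> z; case: (ltnP (enum_rank z) m) => zm; rewrite ?andbF// (leq_trans zm mn).
Qed.

Lemma beforeS s (z : Z) :
  before s (enum_rank z).+1 = before s (enum_rank z) + p (rcons s z).
Proof.
rewrite /before (bigD1 z) //= addrC; congr (_ + _); apply: eq_bigl => y.
rewrite ltnS leq_eqVlt val_eqE (inj_eq enum_rank_inj).
by have [->|] := eqVneq y z; rewrite ?ltnn ?andbT ?andbF.
Qed.

Lemma before_all s : before s #|Z| = p s.
Proof. by rewrite pE; apply: eq_bigl => z; rewrite ltn_ord. Qed.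

Fixpoint left_end_from (pre s : seq Z) : R :=
  if s is z :: s' then before pre (enum_rank z) + left_end_from (rcons pre z) s'
  else 0.

Definition left_end (s : seq Z) : R := left_end_from [::] s.

Lemma left_end_rcons s z :
  left_end (rcons s z) = left_end s + before s (enum_rank z).
Proof.
rewrite /left_end -[X in before X _]/([::] ++ s).
elim: s [::] => [|y s IH] pre /=; first by rewrite cats0 addr0 add0r.
by rewrite IH cat_rcons addrA.
Qed.

Definition code_itv (s : seq Z) : set R :=
  `[left_end s, left_end s + p s[%classic.

Lemma code_itv_nil : code_itv [::] = `[0, 1[%classic.
Proof. by rewrite /code_itv /left_end/= p1 add0r. Qed.

(** The next letter is the first one at which the cumulated masses exceed the
    offset of [x] in its interval. *)
Lemma code_itv_split s x : code_itv s x -> exists z, code_itv (rcons s z) x.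
Proof.
rewrite /code_itv/= in_itv /= => /andP[sx xs].
have ex : exists m, x < left_end s + before s m by exists #|Z|; rewrite before_all.
case: (ex_minnP ex) => -[|m] xm mmin.
  by move: xm; rewrite /before big_pred0// addr0 ltNge sx.
have mZ : (m < #|Z|)%N by apply: mmin; rewrite before_all.
pose z : Z := enum_val (Ordinal mZ).
have rz : enum_rank z = m :> nat by rewrite enum_valK.
exists z; rewrite in_itv /= left_end_rcons -addrA -beforeS rz xm andbT leNgt.
by apply/negP => /mmin; rewrite ltnn.
Qed.

Lemma code_itv_rcons s z : code_itv (rcons s z) `<=` code_itv s.
Proof.
move=> x; rewrite /code_itv /= !in_itv /= left_end_rcons -addrA -beforeS.
move=> /andP[xl xr]; apply/andP; split.
  by apply: le_trans xl; rewrite lerDl sumr_ge0.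
by apply: lt_le_trans xr _; rewrite lerD2l -(before_all s) before_le.
Qed.

Lemma code_itv_inj s y z x :
  code_itv (rcons s y) x -> code_itv (rcons s z) x -> y = z.
Proof.
wlog yz : y z / (enum_rank y <= enum_rank z)%N => [th|].
  by case/orP: (leq_total (enum_rank y) (enum_rank z)) => yz hy hz;
     [apply: th|apply/esym/th].
move: yz; rewrite leq_eqVlt => /orP[/eqP/val_inj/enum_rank_inj//|yz].
rewrite /code_itv /= !in_itv /= !left_end_rcons -!addrA -!beforeS.
move=> /andP[_ xy] /andP[zx _]; have := le_lt_trans zx xy.
by rewrite ltrD2l ltNge before_le.
Qed.

Definition next_letter (x : R) (s : seq Z) : Z :=
  odflt point [pick z | `[< code_itv (rcons s z) x >]].

Lemma next_letterP x s : code_itv s x -> code_itv (rcons s (next_letter x s)) x.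
Proof.
move=> /code_itv_split[z xz]; rewrite /next_letter; case: pickP => [y /asboolP//|].
by move=> /(_ z)/asboolP.
Qed.

Fixpoint prefix (x : R) (n : nat) : seq Z :=
  if n is m.+1 then rcons (prefix x m) (next_letter x (prefix x m)) else [::].

Lemma size_prefix x n : size (prefix x n) = n.
Proof. by elim: n => //= n IH; rewrite size_rcons IH. Qed.

Lemma prefix_itv x n : `[0, 1[%classic x -> code_itv (prefix x n) x.
Proof.
move=> x01; elim: n => [|n IH] /=; first by rewrite code_itv_nil.
exact: next_letterP.
Qed.

Lemma itv_prefix x s : code_itv s x -> prefix x (size s) = s.
Proof.
elim/last_ind: s => // s z IH sx; rewrite size_rcons /= IH; last first.
  exact: code_itv_rcons sx.
have sx' := code_itv_rcons sx.
congr rcons; apply: code_itv_inj sx; exact: next_letterP.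
Qed.

Lemma code_itv01 s : code_itv s `<=` `[0, 1[%classic.
Proof.
rewrite -code_itv_nil; elim/last_ind: s => // s z IH x.
by move=> /code_itv_rcons; exact: IH.
Qed.

(** Outside the unit interval a constant value makes measurability evident. *)
Definition code (x : R) : nat -> Z := fun n =>
  if x \in `[0, 1[ then next_letter x (prefix x n) else point.

Lemma block_code x n : x \in `[0, 1[ -> block n (code x) = prefix x n :> seq Z.
Proof.
move=> x01; apply: (@eq_from_nth _ point); first by rewrite size_tuple size_prefix.
rewrite size_tuple => i ni.
rewrite -[i]/(val (Ordinal ni)) -tnth_nth tnth_mktuple /code x01 /=.
elim: n ni => // n IH; rewrite ltnS leq_eqVlt => /orP[/eqP ->|ni] /=.
  by rewrite nth_rcons size_prefix ltnn eqxx.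
by rewrite nth_rcons size_prefix ni -IH.
Qed.

Lemma code_blockE n (w : n.-tuple Z) :
  [set x | block n (code x) = w] `&` `[0, 1[%classic = code_itv w.
Proof.
apply/seteqP; split=> [x [/= wx x01]|x wx].
  have := congr1 val wx; rewrite /= block_code//.
  by move=> <-; exact: prefix_itv.
have x01 := code_itv01 wx; split=> //=; apply/val_inj; rewrite /= block_code//.
by rewrite -{1}(size_tuple w) itv_prefix.
Qed.

Lemma measurable_code : measurable_fun setT (code : measurableTypeR R -> seqspace Z).
Proof.
apply: measurable_to_seqspace => i a.
have -> : [set x | code x i = a] =
    \bigcup_(w in [set w : i.+1.-tuple Z | tnth w ord_max = a]) code_itv w
    `|` ([set x | x \notin `[0, 1[] `&` [set x | a = point]).
  apply/seteqP; split=> x /=.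
    have [x01 xa|x01] := boolP (x \in `[0, 1[); last by rewrite /code (negbTE x01); right.
    left; exists (block i.+1 (code x)); first by rewrite /= tnth_mktuple.
    by rewrite -code_blockE.
  case=> [[w /= wa]|[x01 ->]]; last by rewrite /code (negbTE x01).
  by rewrite -code_blockE => -[/= xw _]; rewrite -wa -xw tnth_mktuple.
apply: measurableU.
  by apply: fin_bigcup_measurable => // w _; exact: measurable_itv.
apply: measurableI; last first.
  have [->|/eqP ap] := eqVneq a point.
    by rewrite (_ : mkset _ = setT)//; apply/seteqP; split.
  by rewrite (_ : mkset _ = set0)//; apply/seteqP; split => // x /ap.
rewrite (_ : mkset _ = ~` `[0, 1[%classic); first by apply: measurableC; exact: measurable_itv.
by apply/seteqP; split=> x /= /negP.
Qed.

End Kolmogorov.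

Definition unit_lebesgue (R : realType) : set (measurableTypeR R) -> \bar R :=
  mrestr lebesgue_measure (@measurable_itv R `[0, 1[).

HB.instance Definition _ (R : realType) := Measure.on (@unit_lebesgue R).

Lemma unit_lebesgue_setT (R : realType) : @unit_lebesgue R setT = 1%E.
Proof.
by rewrite /unit_lebesgue /mrestr setTI lebesgue_measure_itv /= lte_fin ltr01 oppr0 adde0.
Qed.

HB.instance Definition _ (R : realType) :=
  Measure_isProbability.Build _ _ R (@unit_lebesgue R) (@unit_lebesgue_setT R).

Theorem kolmogorov_extension (R : realType) (Z : pointedFinType) (p : seq Z -> R) :
  p [::] = 1 -> (forall s, 0 <= p s) -> (forall s, p s = \sum_z p (rcons s z)) ->
  exists P : probability (seqspace Z) R,
    forall n (w : n.-tuple Z), block_law P w = p w.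
Proof.
move=> p1 p_ge0 pE.
pose f : {RV (@unit_lebesgue R) >-> seqspace Z} :=
  HB.pack (code p : measurableTypeR R -> seqspace Z)
    (isMeasurableFun.Build _ _ _ _ _ (measurable_code p1 p_ge0 pE)).
exists (distribution (@unit_lebesgue R) f) => n w.
rewrite /block_law /distribution /pushforward /= /unit_lebesgue /mrestr.
rewrite (code_blockE p1 p_ge0 pE) lebesgue_measure_itv /= lte_fin ltrDl.
case: ifPn => [_|]; first by rewrite /= addrAC subrr add0r.
by rewrite -leNgt => w0; apply/eqP; rewrite /= eq_le w0 p_ge0.
Qed.

(** * Finite couplings *)

Definition push {R : realType} {A B : finType} (f : A -> B) (al : A -> R) : B -> R :=
  fun b => \sum_(a | f a == b) al a.

(** Couplings are composed and extended with explicit costs, and compared with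
    the infimum [transport] only at the end, up to an arbitrary slack. *)
Definition within {R : realType} {A B : finType} (c : A -> B -> R)
    (al : A -> R) (be : B -> R) (r : R) : Prop :=
  exists2 q, couplings al be q & \sum_p c p.1 p.2 * q p <= r.

Lemma sum_pair (R : realType) (A B : finType) (F : A * B -> R) :
  \sum_p F p = \sum_a \sum_b F (a, b).
Proof. by rewrite pair_bigA; apply: eq_bigr => -[]. Qed.

Lemma sum_push_cond (R : realType) (A B : finType) (f : A -> B) (al : A -> R)
    (Q : pred B) :
  \sum_(b | Q b) push f al b = \sum_(a | Q (f a)) al a.
Proof.
rewrite [RHS](partition_big f Q) //=; apply: eq_bigr => b Qb.
by apply: eq_bigl => a; case: eqP => [->|]; rewrite ?Qb ?andbF.
Qed.

Lemma push_id (R : realType) (A : finType) (al : A -> R) : push id al = al.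
Proof. by apply/funext => a; rewrite /push /= big_pred1_eq. Qed.

Lemma push_sub (R : realType) (A B : finType) (f : A -> B) (al be : A -> R) :
  push f (fun a => al a - be a) = fun b => push f al b - push f be b.
Proof. by apply/funext => b; rewrite /push sumrB. Qed.

Section Push.
Context {R : realType} {A B : finType}.

Lemma sum_push (f : A -> B) (al : A -> R) : \sum_b push f al b = \sum_a al a.
Proof. by rewrite [RHS](partition_big f xpredT). Qed.

Lemma sum_pushM (f : A -> B) (al : A -> R) (F : B -> R) :
  \sum_b F b * push f al b = \sum_a F (f a) * al a.
Proof.
rewrite [RHS](partition_big f xpredT) //=; apply: eq_bigr => b _.
by rewrite mulr_sumr; apply: eq_bigr => a /eqP ->.
Qed.

Lemma push_ge0 (f : A -> B) (al : A -> R) b :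
  (forall a, 0 <= al a) -> 0 <= push f al b.
Proof. by move=> al0; rewrite /push sumr_ge0. Qed.

Lemma push_comp (C : finType) (f : A -> B) (g : B -> C) (al : A -> R) x :
  push g (push f al) x = push (g \o f) al x.
Proof.
rewrite /push [RHS](partition_big f (fun b => g b == x)) //=.
apply: eq_bigr => b /eqP gb; apply: eq_bigl => a.
by case: eqP => [->|]; rewrite ?gb ?eqxx ?andbF.
Qed.

End Push.

Section Couplings.
Context {R : realType} {A B : finType}.
Implicit Types (c : A -> B -> R) (al : A -> R) (be : B -> R).

Lemma coupling_le_l al be q a b : couplings al be q -> q (a, b) <= al a.
Proof.
by move=> [q0 qa _]; rewrite -qa (bigD1 b) //= lerDl sumr_ge0.
Qed.

Lemma coupling_le_r al be q a b : couplings al be q -> q (a, b) <= be b.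
Proof.
by move=> [q0 _ qb]; rewrite -qb (bigD1 a) //= lerDl sumr_ge0.
Qed.

Lemma coupling_ge0_r al be q b : couplings al be q -> 0 <= be b.
Proof. by move=> [q0 _ qb]; rewrite -qb sumr_ge0. Qed.

Lemma coupling_sum al be q : couplings al be q -> \sum_p q p = \sum_a al a.
Proof.
move=> [_ qa _]; under [RHS]eq_bigr do rewrite -qa.
by rewrite pair_bigA /=; apply: eq_bigr => -[].
Qed.

Lemma product_coupling al be : (forall a, 0 <= al a) -> (forall b, 0 <= be b) ->
  \sum_a al a = 1 -> \sum_b be b = 1 ->
  couplings al be (fun p => al p.1 * be p.2).
Proof.
move=> al0 be0 al1 be1; split=> [p|a|b] /=; first by rewrite mulr_ge0.
- by rewrite -mulr_sumr be1 mulr1.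
- by rewrite -mulr_suml al1 mul1r.
Qed.

Lemma transport_le c al be r : (forall a b, 0 <= c a b) ->
  within c al be r -> transport c al be <= r.
Proof.
move=> c0 [q qc]; apply: le_trans; apply: ge_inf; last by exists q.
exists 0 => _ [q' [q'0 _ _] <-]; apply: sumr_ge0 => p _.
by rewrite mulr_ge0.
Qed.

Lemma le_transport c al be r : (exists q, couplings al be q) ->
  (forall q, couplings al be q -> r <= \sum_p c p.1 p.2 * q p) ->
  r <= transport c al be.
Proof.
move=> [q qc] rq; apply: lb_le_inf; first by exists (\sum_p c p.1 p.2 * q p), q.
by move=> _ [q' q'c <-]; exact: rq.
Qed.

Lemma within_transport c al be e : (forall a b, 0 <= c a b) -> 0 < e ->
  (exists q, couplings al be q) -> within c al be (transport c al be + e).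
Proof.
move=> c0 e0 [q qc].
have hi : has_inf [set \sum_p c p.1 p.2 * q p | q in couplings al be].
  split; first by exists (\sum_p c p.1 p.2 * q p), q.
  exists 0 => _ [q' [q'0 _ _] <-]; apply: sumr_ge0 => p _.
  by rewrite mulr_ge0.
have [_ [q' q'c <-] lt] := inf_adherent e0 hi.
by exists q' => //; exact: ltW.
Qed.

Lemma withinW c al be r s : r <= s -> within c al be r -> within c al be s.
Proof. by move=> rs [q qc qr]; exists q => //; exact: le_trans rs. Qed.

Lemma within_bounded c al be M : (forall a b, c a b <= M) ->
  (forall a, 0 <= al a) -> (forall b, 0 <= be b) ->
  \sum_a al a = 1 -> \sum_b be b = 1 -> within c al be M.
Proof.
move=> cM al0 be0 al1 be1; have qc := product_coupling al0 be0 al1 be1.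
exists (fun p => al p.1 * be p.2) => //.
rewrite -[leRHS]mulr1 -[in leRHS]al1 -(coupling_sum qc) mulr_sumr.
by apply: ler_sum => p _; rewrite ler_wpM2r// mulr_ge0.
Qed.

End Couplings.

Lemma within_swap (R : realType) (A B : finType) (c : A -> B -> R) al be r :
  within c al be r -> within (fun b a => c a b) be al r.
Proof.
move=> [q [q0 qa qb] qr]; exists (fun p => q (p.2, p.1)); first by split.
apply: le_trans qr; rewrite -(pair_bigA _ (fun b a => c a b * q (a, b))) /=.
rewrite exchange_big /= pair_bigA /=.
by apply: ler_sum => -[].
Qed.

(** The two couplings are made conditionally independent given the middle
    point. Where [be] vanishes both couplings vanish, so the division by zero
    is harmless. *)
Lemma within_glue (R : realType) (A B C : finType) (d : A -> B -> R)
    (e : B -> C -> R) (c : A -> C -> R) al be ga r s :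
  (forall a b x, c a x <= d a b + e b x) ->
  within d al be r -> within e be ga s -> within c al ga (r + s).
Proof.
move=> cde [q1 qc1 q1r] [q2 qc2 q2s].
have be0 b : 0 <= be b by apply: coupling_ge0_r qc1.
have [[q10 q1a q1b] [q20 q2b q2g]] := (qc1, qc2).
pose q (p : A * B * C) := q1 (p.1.1, p.1.2) * q2 (p.1.2, p.2) / be p.1.2.
have q0 p : 0 <= q p by rewrite /q !mulr_ge0 ?invr_ge0.
have qC a b : \sum_x q (a, b, x) = q1 (a, b).
  rewrite /q /= -mulr_suml -mulr_sumr q2b; have [b0|b0] := eqVneq (be b) 0.
    rewrite b0 mulr0 mul0r; apply/esym/eqP; rewrite eq_le q10 andbT -[leRHS]b0.
    exact: coupling_le_r qc1.
  by rewrite mulfK.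
have qA b x : \sum_a q (a, b, x) = q2 (b, x).
  rewrite /q /= -!mulr_suml q1b; have [b0|b0] := eqVneq (be b) 0.
    rewrite b0 !mul0r; apply/esym/eqP; rewrite eq_le q20 andbT -[leRHS]b0.
    exact: coupling_le_l qc2.
  by rewrite mulrAC mulfV// mul1r.
exists (fun p => \sum_b q (p.1, b, p.2)).
  split=> [p|a|x] /=; first by rewrite sumr_ge0.
  - by rewrite exchange_big /= -q1a; apply: eq_bigr => b _; rewrite qC.
  - by rewrite exchange_big /= -q2g; apply: eq_bigr => b _; rewrite qA.
apply: (@le_trans _ _ (\sum_a \sum_b \sum_x (d a b + e b x) * q (a, b, x))).
  rewrite -(pair_bigA _ (fun a x => c a x * \sum_b q (a, b, x))) /=.
  apply: ler_sum => a _; rewrite exchange_big /=; apply: ler_sum => x _.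
  by rewrite mulr_sumr; apply: ler_sum => b _; rewrite ler_wpM2r.
under eq_bigr do under eq_bigr do
  (under eq_bigr do rewrite mulrDl; rewrite big_split /= -mulr_sumr qC).
under eq_bigr do rewrite big_split /=.
rewrite big_split /= lerD//.
  apply: le_trans q1r; rewrite (pair_bigA _ (fun a b => d a b * q1 (a, b))) /=.
  by apply: ler_sum => -[].
apply: le_trans q2s; rewrite exchange_big /=.
apply: (@le_trans _ _ (\sum_b \sum_x e b x * q2 (b, x))).
  apply: ler_sum => b _; rewrite exchange_big /=; apply: ler_sum => x _.
  by rewrite -mulr_sumr qA.
by rewrite (pair_bigA _ (fun b x => e b x * q2 (b, x))) /=; apply: ler_sum => -[].
Qed.

(** * Transport of excess mass *)

Lemma sum_delta (R : realType) (A : finType) (F : A -> R) a :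
  \sum_b F b * (b == a)%:R = F a.
Proof.
rewrite (bigD1 a) //= eqxx mulr1 big1 ?addr0// => b /negbTE ->.
by rewrite mulr0.
Qed.

Section MoveExcess.
Context {R : realType} {S : finType}.
Variable d : S -> S -> R.
Hypothesis d0 : forall s, d s s = 0.
Hypothesis dC : forall s t, d s t = d t s.
Hypothesis dT : forall s t u, d s u <= d s t + d t u.

Lemma within_refl (al : S -> R) : (forall s, 0 <= al s) -> within d al al 0.
Proof.
move=> al0; exists (fun p => al p.1 * (p.2 == p.1)%:R).
  split=> [p|a|b] /=; first by rewrite mulr_ge0.
  - by rewrite (sum_delta (fun=> al a)).
  - by rewrite -[RHS](sum_delta al b); apply: eq_bigr => a _; rewrite eq_sym.
rewrite big1// => -[a b] _ /=; case: eqP => [->|_]; first by rewrite d0 mul0r.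
by rewrite !mulr0.
Qed.

(** The part [m] of [al] stays in place, the excess is carried along [f]. *)
Lemma within_move (al m : S -> R) (f : S -> S) (e : R) :
  (forall s, 0 <= m s <= al s) -> (forall s, d s (f s) <= e) ->
  within d al (fun t => m t + push f (fun s => al s - m s) t)
    (e * \sum_s (al s - m s)).
Proof.
move=> mal fe.
exists (fun p => m p.1 * (p.2 == p.1)%:R + (al p.1 - m p.1) * (p.2 == f p.1)%:R).
  split=> [p|a|b] /=.
  - by have /andP[m0 ma] := mal p.1; rewrite addr_ge0// mulr_ge0// subr_ge0.
  - rewrite big_split /= (sum_delta (fun=> m a)) (sum_delta (fun=> al a - m a)).
    by rewrite addrC subrK.
  - rewrite big_split /=; congr (_ + _).
      by rewrite -[RHS](sum_delta m b); apply: eq_bigr => a _; rewrite eq_sym.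
    rewrite /push [RHS]big_mkcond /=; apply: eq_bigr => a _.
    by rewrite eq_sym; case: ifP; rewrite ?mulr1 ?mulr0.
rewrite -(pair_bigA _ (fun a b => d a b * (m a * (b == a)%:R +
  (al a - m a) * (b == f a)%:R))) /= mulr_sumr.
apply: ler_sum => a _; have /andP[_ ma] := mal a.
under eq_bigr do rewrite mulrDr !mulrA.
rewrite big_split /= (sum_delta (fun b => d a b * m a)).
rewrite (sum_delta (fun b => d a b * (al a - m a))) d0 mul0r add0r.
by rewrite ler_wpM2r// subr_ge0.
Qed.

Fixpoint chain_push (fs : seq ((S -> S) * R)) (sg : S -> R) : S -> R :=
  if fs is (f, _) :: fs' then chain_push fs' (push f sg) else sg.

Fixpoint chain_cost (fs : seq ((S -> S) * R)) (sg : S -> R) : R :=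
  if fs is (f, e) :: fs' then e * (\sum_s `|sg s|) + chain_cost fs' (push f sg)
  else 0.

(** Each map moves only the excess of [al] and of [be] over their common part,
    whose total mass is the l1 norm of the difference. The new difference is
    the image of the old one, so that after the last map the two marginals
    coincide. *)
Lemma within_chain (fs : seq ((S -> S) * R)) (al be : S -> R) :
  (forall s, 0 <= al s) -> (forall s, 0 <= be s) ->
  (forall i s, (i < size fs)%N -> d s ((nth (id, 0) fs i).1 s) <= (nth (id, 0) fs i).2) ->
  (forall s, chain_push fs (fun s => al s - be s) s = 0) ->
  within d al be (chain_cost fs (fun s => al s - be s)).
Proof.
elim: fs al be => [|[f e] fs IH] al be al0 be0 fse /= h0.
  have <- : al = be by apply/funext => s; apply/eqP; rewrite -subr_eq0 h0.
  exact: within_refl.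
have fe s : d s (f s) <= e by have := fse 0%N s isT.
pose m s := Num.min (al s) (be s).
have m0 s : 0 <= m s by rewrite le_min al0 be0.
have mal s : 0 <= m s <= al s by rewrite m0 /= ge_min lexx.
have mbe s : 0 <= m s <= be s by rewrite m0 /= ge_min lexx orbT.
pose al' t := m t + push f (fun s => al s - m s) t.
pose be' t := m t + push f (fun s => be s - m s) t.
have al'0 s : 0 <= al' s.
  rewrite addr_ge0// push_ge0// => t; rewrite subr_ge0.
  by have /andP[] := mal t.
have be'0 s : 0 <= be' s.
  rewrite addr_ge0// push_ge0// => t; rewrite subr_ge0.
  by have /andP[] := mbe t.
have sgE : (fun s => al' s - be' s) = push f (fun s => al s - be s).
  apply/funext => t; rewrite /al' /be' opprD addrACA subrr add0r /push -sumrB.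
  by apply: eq_bigr => s _; rewrite opprB addrA subrK.
have w1 := within_move mal fe.
have w3 := within_swap (within_move mbe fe).
have {IH}w2 : within d al' be' (chain_cost fs (push f (fun s => al s - be s))).
  rewrite -sgE; apply: IH => //; first by move=> i s; have := fse i.+1 s.
  by rewrite sgE.
have w12 := within_glue dT w1 w2.
have dT' s t u : d s u <= d s t + d u t by rewrite (dC u).
apply: withinW (within_glue dT' w12 w3).
rewrite addrAC lerD2r -mulrDr -big_split /= le_eqVlt; apply/orP; left.
apply/eqP; congr (_ * _); apply: eq_bigr => s _; rewrite /m.
have [ab|ba] := leP (al s) (be s); rewrite subrr.
  by rewrite add0r distrC ger0_norm// subr_ge0.
by rewrite addr0 ger0_norm// subr_ge0 ltW.
Qed.

End MoveExcess.

Section Perturbation.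
Context {R : realType} {A B : finType}.
Variables (c : A -> B -> R) (M : R).
Hypothesis cM : forall a b, 0 <= c a b <= M.

(** The maximal coupling: the common part stays in place, and the two excesses,
    which have the same total mass, are coupled independently. *)
Lemma within_discrete (al al' : A -> R) e :
  (forall a, 0 <= al a) -> (forall a, 0 <= al' a) ->
  \sum_a al a = 1 -> \sum_a al' a = 1 -> 0 <= M ->
  (forall S : {set A}, \sum_(a in S) al a - \sum_(a in S) al' a <= e) ->
  within (fun a b => M * (a != b)%:R) al al' (M * e).
Proof.
move=> al0 al'0 al1 al'1 M0 ale.
pose m a := Num.min (al a) (al' a); pose S := [set a | al' a < al a]%SET.
pose W := \sum_a (al a - m a).
have W' : \sum_a (al' a - m a) = W by rewrite /W !sumrB al1 al'1.
have We : W <= e.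
  apply: le_trans (ale S); rewrite -sumrB /W [leRHS]big_mkcond /=.
  apply: ler_sum => a _; rewrite inE /m.
  by case: ltP => // _; rewrite subrr.
have x0 a : 0 <= al a - m a by rewrite subr_ge0 ge_min lexx.
have x'0 a : 0 <= al' a - m a by rewrite subr_ge0 ge_min lexx orbT.
have W0 : 0 <= W by rewrite sumr_ge0.
have Wx (F : A -> R) a : (forall a, 0 <= F a) -> \sum_a F a = W -> F a * W / W = F a.
  move=> F0 FW; have [WE|WN] := eqVneq W 0; last by rewrite mulfK.
  rewrite WE mulr0 mul0r; apply/esym/eqP; rewrite eq_le F0 andbT.
  by rewrite -[leRHS]WE -FW (bigD1 a) //= lerDl sumr_ge0.
have Wl a : (al a - m a) * W / W = al a - m a := Wx _ a x0 erefl.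
have Wr a : (al' a - m a) * W / W = al' a - m a := Wx _ a x'0 W'.
exists (fun p => m p.1 * (p.2 == p.1)%:R + (al p.1 - m p.1) * (al' p.2 - m p.2) / W).
  split=> [p|a|b] /=.
  - rewrite addr_ge0 ?mulr_ge0 ?invr_ge0//.
    by rewrite /m le_min al0 al'0.
  - rewrite big_split /= (sum_delta (fun=> m a)) -mulr_suml -mulr_sumr W' Wl.
    by rewrite addrC subrK.
  - rewrite big_split /= -!mulr_suml -/W [W * _]mulrC Wr.
    rewrite -[X in X + _ = _](_ : m b = _); first by rewrite addrC subrK.
    by rewrite -[LHS](sum_delta m b); apply: eq_bigr => a _; rewrite eq_sym.
apply: (@le_trans _ _ (\sum_(p : A * A) M * ((al p.1 - m p.1) * (al' p.2 - m p.2) / W))).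
  apply: ler_sum => -[a b] _ /=; rewrite -mulrA ler_wpM2l// mulrDr eq_sym.
  case: eqP => _ /=; last by rewrite mulr0 mulr0 add0r mul1r.
  by rewrite !mul0r addr0 mulr_ge0 ?invr_ge0// mulr_ge0.
rewrite -mulr_sumr ler_wpM2l//; apply: le_trans We.
rewrite -(pair_bigA _ (fun a b => (al a - m a) * (al' b - m b) / W)) /=.
by apply: ler_sum => a _; rewrite -mulr_suml -mulr_sumr W' Wl.
Qed.

Lemma within_perturb_l (al al' : A -> R) (ga : B -> R) e r :
  (forall a, 0 <= al a) -> (forall a, 0 <= al' a) ->
  \sum_a al a = 1 -> \sum_a al' a = 1 -> 0 <= M ->
  (forall S : {set A}, \sum_(a in S) al a - \sum_(a in S) al' a <= e) ->
  within c al' ga r -> within c al ga (M * e + r).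
Proof.
move=> al0 al'0 al1 al'1 M0 ale w.
apply: within_glue (within_discrete al0 al'0 al1 al'1 M0 ale) w => a b x.
have [->|_] /= := eqVneq a b; first by rewrite mulr0 add0r.
have /andP[_ h] := cM a x; have /andP[h' _] := cM b x.
by rewrite mulr1 -[leLHS]addr0 lerD.
Qed.

End Perturbation.

Lemma within_push (R : realType) (A' A : finType) (f : A' -> A) (al : A' -> R) M :
  (forall a, 0 <= al a) ->
  within (fun a x => M * (x != f a)%:R) al (push f al) 0.
Proof.
move=> al0; exists (fun p => al p.1 * (p.2 == f p.1)%:R).
  split=> [p|a|b] /=; first by rewrite mulr_ge0.
  - by rewrite (sum_delta (fun=> al a)).
  - rewrite /push [RHS]big_mkcond /=; apply: eq_bigr => a _.
    by rewrite eq_sym; case: ifP; rewrite ?mulr1 ?mulr0.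
rewrite big1// => -[a b] _ /=; case: eqP => _ /=; first by rewrite mulr0 mul0r.
by rewrite !mulr0.
Qed.

(** A point is glued to its image at no cost; a price [M] on all other pairs
    makes the triangle inequality hold, once the cost is truncated at [M]. *)
Lemma within_lift (R : realType) (A A' B B' : finType) (f : A' -> A) (h : B' -> B)
    (c : A -> B -> R) (c' : A' -> B' -> R) (al : A' -> R) (be : B' -> R) r M :
  (forall a, 0 <= al a) -> (forall b, 0 <= be b) -> (forall a b, 0 <= c a b) ->
  (forall a b, c' a b <= M) -> 0 <= M ->
  (forall a b, c' a b <= c (f a) (h b)) ->
  within c (push f al) (push h be) r -> within c' al be r.
Proof.
move=> al0 be0 c0 c'M M0 cc' w.
have wl := within_push f M al0; have wr := within_swap (within_push h M be0).
pose e a y := c (f a) y.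
have w1 : within (fun a y => Num.min (c (f a) y) M) al (push h be) (0 + r).
  apply: within_glue wl w => a x y.
  have [->|_] := eqVneq x (f a); first by rewrite mulr0 add0r ge_min lexx.
  by rewrite mulr1 ge_min -[X in _ || (X <= _)]addr0 lerD// orbT.
rewrite -[r]add0r -[_ + _]addr0; apply: within_glue w1 wr => a y b.
have [->|_] /= := eqVneq y (h b); first by rewrite mulr0 addr0 le_min cc' c'M.
by rewrite mulr1 -[leLHS]add0r lerD// le_min c0 M0.
Qed.

(** The second coordinates are coupled conditionally on the pair of first
    coordinates. *)
Lemma within_chain_rule (R : realType) (U V X Y : finType)
    (c1 : U -> V -> R) (c2 : X -> Y -> R)
    (al : U * X -> R) (be : V * Y -> R) r1 r2 :
  let al1 := fun u => \sum_x al (u, x) in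
  let be1 := fun v => \sum_y be (v, y) in
  (forall p, 0 <= al p) -> (forall p, 0 <= be p) -> \sum_p al p = 1 ->
  (forall a b, 0 <= c2 a b) ->
  within c1 al1 be1 r1 ->
  (forall u v, 0 < al1 u -> 0 < be1 v ->
     within c2 (fun x => al (u, x) / al1 u) (fun y => be (v, y) / be1 v) r2) ->
  within (fun p p' => c1 p.1 p'.1 + c2 p.2 p'.2) al be (r1 + r2).
Proof.
move=> al1 be1 al0 be0 alE c20 [q qc qr] w.
have [q0 qa qb] := qc.
have /choice[K KP] : forall uv : U * V, exists K : X * Y -> R,
    0 < q uv -> couplings (fun x => al (uv.1, x) / al1 uv.1)
         (fun y => be (uv.2, y) / be1 uv.2) K /\ \sum_p c2 p.1 p.2 * K p <= r2.
  move=> [u v] /=; have [quv|] := ltP 0 (q (u, v)); last by exists (fun=> 0).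
  have [||K Kc Kr] := w u v; last by exists K.
    exact: lt_le_trans quv (coupling_le_l _ _ qc).
  exact: lt_le_trans quv (coupling_le_r _ _ qc).
have qE uv : q uv = 0 \/ 0 < q uv.
  by case: (ltrgt0P (q uv)) (q0 uv) => // e _; [right|left].
pose q' (p : (U * X) * (V * Y)) := q (p.1.1, p.2.1) * K (p.1.1, p.2.1) (p.1.2, p.2.2).
have q'0 p : 0 <= q' p.
  rewrite /q'; case: (qE (p.1.1, p.2.1)) => [->|q1]; first by rewrite mul0r.
  by have [[K0 _ _] _] := KP _ q1; rewrite mulr_ge0.
have row u x v : \sum_y q' ((u, x), (v, y)) = q (u, v) * (al (u, x) / al1 u).
  rewrite /q' /= -mulr_sumr; case: (qE (u, v)) => [->|q1]; first by rewrite !mul0r.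
  by have [[_ Kx _] _] := KP _ q1; rewrite Kx.
have col v y u : \sum_x q' ((u, x), (v, y)) = q (u, v) * (be (v, y) / be1 v).
  rewrite /q' /= -mulr_sumr; case: (qE (u, v)) => [->|q1]; first by rewrite !mul0r.
  by have [[_ _ Ky] _] := KP _ q1; rewrite Ky.
have normK (C D : finType) (ga : C * D -> R) x y : (forall p, 0 <= ga p) ->
    (\sum_z ga (x, z)) * (ga (x, y) / \sum_z ga (x, z)) = ga (x, y).
  move=> ga0; have [g0|g0] := eqVneq (\sum_z ga (x, z)) 0; last by rewrite mulrC divfK.
  rewrite g0 mul0r; apply/esym/eqP; rewrite eq_le ga0 andbT -[leRHS]g0.
  by rewrite (bigD1 y) //= lerDl sumr_ge0.
have q'c : couplings al be q'.
  split=> // -[u x].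
    rewrite -(pair_bigA _ (fun v y => q' ((u, x), (v, y)))) /=.
    by under eq_bigr do rewrite row; rewrite -mulr_suml qa normK.
  rewrite -(pair_bigA _ (fun v y => q' ((v, y), (u, x)))) /=.
  by under eq_bigr do rewrite col; rewrite -mulr_suml qb normK.
exists q' => //.
under eq_bigr do rewrite mulrDl.
have q'E (F : U -> V -> X -> Y -> R) :
  \sum_p F p.1.1 p.2.1 p.1.2 p.2.2 * q' p =
  \sum_u \sum_v \sum_x \sum_y F u v x y * q' ((u, x), (v, y)).
  rewrite -(pair_bigA _ (fun ux vy => F ux.1 vy.1 ux.2 vy.2 * q' (ux, vy))) /=.
  rewrite -(pair_bigA _ (fun u x => \sum_vy F u vy.1 x vy.2 * q' ((u, x), vy))) /=.
  apply: eq_bigr => u _; rewrite exchange_big /=.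
  rewrite -(pair_bigA _ (fun v y => \sum_x F u v x y * q' ((u, x), (v, y)))) /=.
  by apply: eq_bigr => v _; rewrite exchange_big.
rewrite big_split /= lerD//.
  rewrite (q'E (fun u v _ _ => c1 u v)).
  apply: (@le_trans _ _ (\sum_u \sum_v c1 u v * q (u, v))); last first.
    apply: le_trans qr; rewrite (pair_bigA _ (fun u v => c1 u v * q (u, v))) /=.
    by apply: ler_sum => -[].
  apply: ler_sum => u _; apply: ler_sum => v _.
  under eq_bigr do rewrite -mulr_sumr row.
  rewrite -mulr_sumr; case: (qE (u, v)) => [->|q1].
    by rewrite big1 ?mulr0// => x _; rewrite mul0r.
  have al10 : 0 < al1 u := lt_le_trans q1 (coupling_le_l _ _ qc).
  by rewrite -mulr_sumr -mulr_suml divff ?gt_eqF// mulr1.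
rewrite (q'E (fun _ _ x y => c2 x y)).
apply: (@le_trans _ _ (\sum_u \sum_v q (u, v) * r2)).
  apply: ler_sum => u _; apply: ler_sum => v _.
  rewrite /q' /=; case: (qE (u, v)) => [->|q1].
    by rewrite mul0r big1// => x _; rewrite big1// => y _; rewrite mul0r mulr0.
  have [_ Kr] := KP _ q1.
  rewrite (pair_bigA _ (fun x y => c2 x y * (q (u, v) * K (u, v) (x, y)))) /=.
  under eq_bigr do rewrite mulrCA.
  rewrite -mulr_sumr ler_wpM2l ?q0//; apply: le_trans Kr.
  by apply: ler_sum => -[].
rewrite pair_bigA /= -mulr_suml (eq_bigr q); last by case.
rewrite (coupling_sum qc) /al1 (pair_bigA _ (fun u x => al (u, x))) /=.
by rewrite (eq_bigr al) ?alE ?mul1r//; case.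
Qed.

(** * Finite-dimensional expectations and mixing coefficients *)

Lemma shiftn_comp (U : Type) i j (u : nat -> U) :
  shiftn j (shiftn i u) = shiftn (i + j) u.
Proof. by apply/funext => m; rewrite /shiftn addnA. Qed.

Section FiniteDimensional.
Context {R : realType} {U : pointedFinType}.
Variable gam : probability (seqspace U) R.

(** The expectation of [G] when [G] depends on the first [N] letters only. Being
    a finite sum it is linear and monotone in all functions [G], so that one
    large [N] serves for a whole computation. *)
Definition Ex (N : nat) (G : (nat -> U) -> R) : R :=
  \sum_(w : N.-tuple U) block_law gam w * G (pad w).

Definition depends (T : Type) (N : nat) (G : (nat -> U) -> T) : Prop :=
  forall u v, (forall i, (i < N)%N -> u i = v i) -> G u = G v.

Lemma block_law_ge0 n (w : n.-tuple U) : 0 <= block_law gam w.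
Proof. exact: pr_ge0. Qed.

Lemma Ex_pr N (A : set (nat -> U)) :
  determined N A -> Ex N (fun u => `[< A u >]%:R) = pr gam A.
Proof.
move=> dA; rewrite (pr_determined _ dA) [RHS]big_mkcond; apply: eq_bigr => w _.
by case: ifP => _; rewrite ?mulr1 ?mulr0.
Qed.

Lemma Ex_cst N r : Ex N (fun=> r) = r.
Proof.
transitivity (r * Ex N (fun u => `[< [set: nat -> U] u >]%:R)).
  rewrite /Ex mulr_sumr; apply: eq_bigr => w _.
  by rewrite asboolT// mulr1 mulrC.
by rewrite Ex_pr// pr_setT mulr1.
Qed.

Lemma block_law_sum n : \sum_(w : n.-tuple U) block_law gam w = 1.
Proof. by rewrite -[RHS](Ex_cst n 1); apply: eq_bigr => w _; rewrite mulr1. Qed.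

Lemma eq_Ex N G H : (forall u, G u = H u) -> Ex N G = Ex N H.
Proof. by move=> GH; apply: eq_bigr => w _; rewrite GH. Qed.

Lemma Ex_le N G H : (forall u, G u <= H u) -> Ex N G <= Ex N H.
Proof. by move=> GH; apply: ler_sum => w _; rewrite ler_wpM2l ?block_law_ge0. Qed.

Lemma Ex_sum N (I : Type) (r : seq I) (P : pred I) (G : I -> (nat -> U) -> R) :
  Ex N (fun u => \sum_(i <- r | P i) G i u) = \sum_(i <- r | P i) Ex N (G i).
Proof.
by rewrite /Ex [RHS]exchange_big /=; apply: eq_bigr => w _; rewrite mulr_sumr.
Qed.

Lemma ExZ N a G : Ex N (fun u => a * G u) = a * Ex N G.
Proof. by rewrite /Ex mulr_sumr; apply: eq_bigr => w _; rewrite mulrCA. Qed.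

Lemma ExD N G H : Ex N (fun u => G u + H u) = Ex N G + Ex N H.
Proof. by rewrite /Ex -big_split; apply: eq_bigr => w _; rewrite mulrDr. Qed.

Lemma ExB N G H : Ex N (fun u => G u - H u) = Ex N G - Ex N H.
Proof. by rewrite /Ex -sumrB; apply: eq_bigr => w _; rewrite mulrBr. Qed.

Lemma dependsE N (G : (nat -> U) -> R) u : depends N G ->
  G u = \sum_(w : N.-tuple U) G (pad w) * `[< block N u = w >]%:R.
Proof.
move=> dG; rewrite (bigD1 (block N u)) //= asboolT// mulr1 big1 ?addr0.
  by apply: dG => i ni; rewrite pad_block.
by move=> w /eqP wN; rewrite asboolF ?mulr0// => e; apply: wN.
Qed.

Lemma determined_shift m n (A : set (nat -> U)) :
  determined n A -> determined (m + n) (shiftn m @^-1` A).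
Proof. by move=> dA u v uv; apply: dA => i ni; apply: uv; rewrite ltn_add2l. Qed.

Lemma pr_shiftn m (A : set (seqspace U)) : stationary gam ->
  measurable A -> pr gam (shiftn m @^-1` A) = pr gam A.
Proof.
move=> st mA; elim: m => [//|m <-].
have E : shiftn m.+1 @^-1` A = shiftn 1 @^-1` (shiftn m @^-1` A).
  by apply/seteqP; split=> u /=; rewrite shiftn_comp.
by rewrite E /pr (st _ (measurable_shiftn m mA)).
Qed.

Lemma Ex_shift m N (G : (nat -> U) -> R) M : stationary gam ->
  depends N G -> (m + N <= M)%N -> Ex M (G \o shiftn m) = Ex N G.
Proof.
move=> st dG NM.
transitivity (Ex M (fun u => \sum_(w : N.-tuple U)
    G (pad w) * `[< block N (shiftn m u) = w >]%:R)).
  by apply: eq_Ex => u; exact: (dependsE _ dG).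
rewrite Ex_sum [RHS](_ : _ = Ex N (fun u => \sum_(w : N.-tuple U)
    G (pad w) * `[< block N u = w >]%:R)); last by apply: eq_Ex => u; exact: (dependsE _ dG).
rewrite Ex_sum; apply: eq_bigr => w _; rewrite !ExZ; congr (_ * _).
have dw : determined N [set u | block N u = w] := @determined_block _ _ [set w].
rewrite (Ex_pr (A := [set u | block N u = w]))//.
rewrite (Ex_pr (A := shiftn m @^-1` [set u | block N u = w])); last first.
  by apply: determinedW NM _; exact: determined_shift dw.
by rewrite pr_shiftn//; exact: measurable_determined dw.
Qed.

Lemma cylinder_pad l (A : set (nat -> U)) : determined l A ->
  cylinder [set w : l.-tuple U | `[< A (pad w) >]]%SET = A.
Proof.
move=> dA; apply/seteqP; split=> u; rewrite /cylinder /= inE.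
  by move=> /asboolP; apply: dA => i; exact: pad_block.
by move=> Au; apply/asboolP; apply: dA Au => i il; rewrite pad_block.
Qed.

Lemma determined_cylinder l (A : {set l.-tuple U}) : determined l (cylinder A).
Proof. exact: (@determined_block _ _ [set w | w \in A]). Qed.

Let phi_set g : set R := [set r : R | exists (l : nat) (A : {set l.-tuple U})
                          (B : set (seqspace U)),
        [/\ (1 <= l)%N, measurable B, (0 < gam (cylinder A))%E &
            r = `| fine (gam (cylinder A `&` shiftn (l + g) @^-1` B))
                     / fine (gam (cylinder A)) - fine (gam B) | ]].

Let phi_set_le1 g r : phi_set g r -> r <= 1.
Proof.
move=> [l [A [B [l1 mB A0 ->]]]].
have mA : measurable (cylinder A) := measurable_determined (@determined_cylinder _ A).
have mS := measurable_shiftn (l + g) mB.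
have pA : 0 < pr gam (cylinder A) by rewrite -lte_fin -prE.
have ab (a b : R) : 0 <= a <= 1 -> 0 <= b <= 1 -> `|a - b| <= 1.
  by move=> /andP[? ?] /andP[? ?]; rewrite ler_norml; apply/andP; split; lra.
apply: ab; last by rewrite (pr_ge0 gam B) (pr_le1 gam mB).
rewrite divr_ge0 ?pr_ge0//= ler_pdivrMr// mul1r -lee_fin.
rewrite -!prE//; last exact: measurableI.
by apply: le_measure => //; rewrite ?inE//; exact: measurableI.
Qed.

Let phi_set0 g : phi_set g 0.
Proof.
exists 1%N, [set: 1.-tuple U]%SET, setT.
have E : cylinder [set: 1.-tuple U]%SET = setT.
  by apply/seteqP; split=> // u _; rewrite /cylinder /= inE.
split=> //; first by rewrite E probability_setT lte01.
by rewrite E setTI preimage_setT probability_setT /= divr1 subrr normr0.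
Qed.

Lemma phi_gap_ge0 g : 0 <= phi_gap gam g.
Proof.
apply: (@ub_le_sup _ (phi_set g)); last exact: phi_set0.
by exists 1 => r; exact: phi_set_le1.
Qed.

Lemma phi_mixing_ge0 j : 0 <= phi_mixing gam j.
Proof. by case: j => [|g] /=; [exact: ler01|exact: phi_gap_ge0]. Qed.

Lemma phi_mixing_le1 j : phi_mixing gam j <= 1.
Proof.
case: j => [|g] //=; apply: sup_le_ub => [|r]; last exact: phi_set_le1.
by exists 0; exact: phi_set0.
Qed.

(** The multiplied-out form of the definition, which also holds for null
    conditioning events. *)
Lemma phi_mixingP l g (A : set (nat -> U)) (B : set (seqspace U)) :
  (1 <= l)%N -> determined l A -> measurable B ->
  `| pr gam (A `&` shiftn (l + g) @^-1` B) - pr gam A * pr gam B |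
    <= pr gam A * phi_mixing gam g.+1.
Proof.
move=> l1 dA mB; have mA := measurable_determined dA.
have mAB : measurable (A `&` shiftn (l + g) @^-1` B : set (seqspace U)).
  by apply: measurableI => //; exact: measurable_shiftn.
have [A0|A0] := eqVneq (pr gam A) 0.
  have -> : pr gam (A `&` shiftn (l + g) @^-1` B) = 0.
    apply/eqP; rewrite eq_le pr_ge0 andbT -[leRHS]A0 -lee_fin -!prE//.
    by apply: le_measure; rewrite ?inE//; exact: subIsetl.
  by rewrite A0 !mul0r subrr normr0.
have pA : 0 < pr gam A by rewrite lt_def A0 pr_ge0.
rewrite [leRHS]mulrC -ler_pdivrMr// -[X in _ / X <= _](gtr0_norm pA) -normf_div.
rewrite mulrBl [_ * pr gam B]mulrC mulfK//.
apply: (@ub_le_sup _ (phi_set g)); first by exists 1 => r; exact: phi_set_le1.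
exists l, [set w : l.-tuple U | `[< A (pad w) >]]%SET, B.
by rewrite (cylinder_pad dA); split=> //; rewrite prE.
Qed.

End FiniteDimensional.

(** * Generalized limits and stationary limits of laws *)

Definition bounded_seq {R : realType} (x : nat -> R) : Prop :=
  exists M, forall n, `|x n| <= M.

(** The limit along an ultrafilter that refines convergence at infinity: a
    bounded sequence clusters by compactness, and an ultrafilter converges to
    its cluster points. *)
Lemma exists_generalized_limit (R : realType) : exists L : (nat -> R) -> R,
  [/\ forall x y, bounded_seq x -> bounded_seq y ->
        L (fun n => x n + y n) = L x + L y,
      forall a x, bounded_seq x -> L (fun n => a * x n) = a * L x,
      forall x y, bounded_seq x -> bounded_seq y -> (forall n, x n <= y n) ->
        L x <= L y &
      forall x l, x @ \oo --> (l : R) -> L x = l ].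
Proof.
have [G [GU ooG]] := ultraFilterLemma eventually_filter.
have PG : ProperFilter G := @ultra_proper _ _ GU.
pose L (x : nat -> R) : R := lim (x @ G).
have cvgL x : bounded_seq x -> x @ G --> L x.
  move=> [M xM]; suff [l xl] : exists l : R, x @ G --> l by rewrite /L (cvg_lim _ xl).
  have GM : (x @ G) `[- M, M]%classic.
    apply: (@filterS _ G _ setT) => [n _|]; last exact: filterT.
    by rewrite /= in_itv /= -ler_norml.
  have [l [_ cl]] := @segment_compact R (- M) M (x @ G) _ GM.
  exists l => B Bl; have [//|GB] := in_ultra_setVsetC (x @^-1` B) GU.
  by have [y [nBy By]] := cl (~` B) B GB Bl.
exists L; split=> [x y bx bY|a x bx|x y bx bY xy|x l xl].
- by apply: cvg_lim => //; apply: cvgD; exact: cvgL.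
- by apply: cvg_lim => //; apply: cvgM; [exact: cvg_cst|exact: cvgL].
- apply: (ler_cvg_to (cvgL _ bx) (cvgL _ bY)).
  exact: nearW.
- by apply: cvg_lim => // B Bl; apply: ooG; exact: xl.
Qed.

Lemma pushforward_probability (R : realType) d (T : measurableType d)
    (U : pointedFinType) (P : probability T R) (f : T -> nat -> U) :
  measurable_fun setT (f : T -> seqspace U) ->
  exists Q : probability (seqspace U) R,
    forall A, measurable A -> Q A = P (f @^-1` A).
Proof.
move=> mf.
pose g : {RV P >-> seqspace U} :=
  HB.pack (f : T -> seqspace U) (isMeasurableFun.Build _ _ _ _ _ mf).
by exists (distribution P g).
Qed.

Section SequenceLaw.
Context {R : realType} {Z : pointedFinType}.

Lemma mkseq_block n (u : nat -> Z) : mkseq u n = block n u.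
Proof.
apply: (@eq_from_nth _ point); first by rewrite !size_tuple.
rewrite size_mkseq => i ni; rewrite nth_mkseq//.
by rewrite -[LHS](pad_block u ni).
Qed.

(** The masses of the sets of sequences with a given prefix are consistent by
    additivity over the next letter, and a finite-dimensional set is a finite
    disjoint union of such sets. *)
Lemma finitely_additive_extension (lam : set (nat -> Z) -> R) :
  lam setT = 1 -> (forall A, 0 <= lam A) ->
  (forall (I : finType) (f : (nat -> Z) -> I) A,
     lam A = \sum_i lam (A `&` f @^-1` [set i])) ->
  exists P : probability (seqspace Z) R,
    forall n A, determined n A -> pr P A = lam A.
Proof.
move=> lam1 lam0 lamD.
have lam_set0 : lam set0 = 0.
  have := lamD bool (fun=> true) set0.
  rewrite big_bool !set0I => /eqP; rewrite -subr_eq0 opprD addrA subrr sub0r.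
  by rewrite oppr_eq0 => /eqP.
pose p (s : seq Z) := lam [set u | mkseq u (size s) = s].
have [||//|P PE] := @kolmogorov_extension R Z p.
- by rewrite /p (_ : mkset _ = setT) //; apply/seteqP.
- by move=> s; exact: lam0.
- move=> s; rewrite /p (lamD Z (fun u => u (size s))); apply: eq_bigr => z _.
  congr lam; apply/seteqP; split=> u /=; rewrite size_rcons mkseqS.
    by move=> [-> ->].
  by move=> /rcons_inj[-> ->].
exists P => n A dA; rewrite (pr_determined _ dA) (lamD _ (block n) A).
rewrite big_mkcond; apply: eq_bigr => w _.
have Pw : [set u | mkseq u (size w) = w] = block n @^-1` [set w].
  rewrite size_tuple; apply/seteqP; split=> u /= uw; last by rewrite mkseq_block uw.
  by apply: val_inj; exact: etrans (esym (mkseq_block n u)) uw.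
case: asboolP => Aw.
  rewrite PE /p Pw; congr lam; apply/seteqP; split=> [u uw|u []//]; split=> //.
  by apply: dA Aw => i ni; rewrite -[w]uw pad_block.
rewrite (_ : _ `&` _ = set0) ?lam_set0//; apply/seteqP; split=> // u [Au uw].
by apply: Aw; apply: dA Au => i ni; rewrite -[w]uw pad_block.
Qed.

End SequenceLaw.

(** * Joinings as limits of block couplings *)

Section GeneralizedLimit.
Context {R : realType}.
Variable L : (nat -> R) -> R.
Hypothesis LD : forall x y, bounded_seq x -> bounded_seq y ->
  L (fun n => x n + y n) = L x + L y.
Hypothesis Lcvg : forall x l, x @ \oo --> (l : R) -> L x = l.

Lemma bounded_cst (a : R) : bounded_seq (fun=> a).
Proof. by exists `|a|. Qed.

Lemma limit_cst (a : R) : L (fun=> a) = a.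
Proof. by apply: Lcvg; exact: cvg_cst. Qed.

Lemma bounded_seqD (x y : nat -> R) :
  bounded_seq x -> bounded_seq y -> bounded_seq (fun n => x n + y n).
Proof.
move=> [M xM] [N yN]; exists (M + N) => n.
by rewrite (le_trans (ler_normD _ _))// lerD.
Qed.

Lemma bounded_seqZ a (x : nat -> R) : bounded_seq x -> bounded_seq (fun n => a * x n).
Proof. by move=> [M xM]; exists (`|a| * M) => n; rewrite normrM ler_wpM2l. Qed.

Lemma bounded_seq_sum (I : Type) (s : seq I) (x : I -> nat -> R) :
  (forall i, bounded_seq (x i)) -> bounded_seq (fun n => \sum_(i <- s) x i n).
Proof.
move=> bx; elim: s => [|i s IH].
  by under eq_fun do rewrite big_nil; exact: bounded_cst.
by under eq_fun do rewrite big_cons; exact: bounded_seqD.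
Qed.

Lemma limit_sum (I : Type) (s : seq I) (x : I -> nat -> R) :
  (forall i, bounded_seq (x i)) ->
  L (fun n => \sum_(i <- s) x i n) = \sum_(i <- s) L (x i).
Proof.
move=> bx; elim: s => [|i s IH].
  by rewrite big_nil; under eq_fun do rewrite big_nil; exact: limit_cst.
under eq_fun do rewrite big_cons.
by rewrite LD ?IH ?big_cons//; exact: bounded_seq_sum.
Qed.

Lemma cvg_dist_over_n (x : nat -> R) (l K : R) :
  (forall m, `|x m - l| <= K / m.+1%:R) -> x @ \oo --> l.
Proof.
move=> xK; apply/subr_cvg0.
have h : (fun m : nat => K * harmonic m) @ \oo --> (0 : R).
  by rewrite -[X in _ --> X](mulr0 K); apply: cvgM; [exact: cvg_cst|exact: cvg_harmonic].
apply: (@squeeze_cvgr _ _ _ _ (fun m => - (K * harmonic m)) (fun m => K * harmonic m)) => //.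
  by apply: nearW => m; rewrite -ler_norml; exact: xK.
by rewrite -oppr0; exact: cvgN.
Qed.

End GeneralizedLimit.

Section JoiningOfCouplings.
Context {R : realType} {X Y : pointedFinType}.
Variables (c : X -> Y -> R) (mu : probability (seqspace X) R)
  (nu : probability (seqspace Y) R).
Hypotheses (mu_st : stationary mu) (nu_st : stationary nu).

Lemma cost_blockE k (x : k.-tuple X) (y : k.-tuple Y) :
  cost_block c x y = \sum_(0 <= i < k) c (pad x i) (pad y i).
Proof.
rewrite big_mkord; apply: eq_bigr => i _; by rewrite /pad -!tnth_nth.
Qed.

Definition zip_pad n (p : n.-tuple X * n.-tuple Y) : nat -> (X * Y)%type :=
  fun i => (pad p.1 i, pad p.2 i).

Section Average.
Variables (n : nat) (q : n.-tuple X * n.-tuple Y -> R).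
Hypothesis qc : couplings (@block_law R X mu n) (@block_law R Y nu n) q.
Hypothesis n0 : (0 < n)%N.

Definition shifted_mass (A : set (nat -> X * Y)) (i : nat) : R :=
  \sum_p q p * `[< A (shiftn i (zip_pad p)) >]%:R.

(** The law of a coupled word read from a uniformly chosen starting point. It
    is defined on all sets of sequences, and nearly shift-invariant. *)
Definition cesaro_mass (A : set (nat -> X * Y)) : R :=
  n%:R^-1 * \sum_(0 <= i < n) shifted_mass A i.

Lemma shifted_massT i : shifted_mass setT i = 1.
Proof.
rewrite /shifted_mass -[RHS](block_law_sum mu n) -(coupling_sum qc).
by apply: eq_bigr => p _; rewrite asboolT// mulr1.
Qed.

Lemma shifted_mass01 A i : 0 <= shifted_mass A i <= 1.
Proof.
have [q0 _ _] := qc; apply/andP; split; first by apply: sumr_ge0 => p _; rewrite mulr_ge0.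
rewrite -(shifted_massT i); apply: ler_sum => p _; rewrite ler_wpM2l//.
by rewrite ler_nat [in leqRHS]asboolT// leq_b1.
Qed.

Lemma cesaro_massT : cesaro_mass setT = 1.
Proof.
rewrite /cesaro_mass; under eq_bigr do rewrite shifted_massT.
by rewrite sumr_const_nat subn0 mulVf// pnatr_eq0 -lt0n.
Qed.

Lemma cesaro_mass01 A : 0 <= cesaro_mass A <= 1.
Proof.
apply/andP; split.
  by rewrite mulr_ge0// sumr_ge0// => i _; have /andP[] := shifted_mass01 A i.
rewrite -cesaro_massT ler_wpM2l// ler_sum// => i _.
by rewrite shifted_massT; have /andP[] := shifted_mass01 A i.
Qed.

Lemma cesaro_massD (I : finType) (f : (nat -> X * Y) -> I) A :
  cesaro_mass A = \sum_i cesaro_mass (A `&` f @^-1` [set i]).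
Proof.
rewrite /cesaro_mass -mulr_sumr; congr (_ * _); rewrite [RHS]exchange_big /=.
apply: eq_bigr => j _; rewrite /shifted_mass [RHS]exchange_big /=; apply: eq_bigr => p _.
rewrite -mulr_sumr; congr (_ * _); set u := shiftn _ _.
rewrite (bigD1 (f u)) //= big1 ?addr0.
  by congr (_%:R); congr nat_of_bool; apply: asbool_equiv_eq; split=> // -[].
by move=> i /eqP iu; rewrite asboolF// => -[_ /esym].
Qed.

(** The sum telescopes and only the two boundary terms remain. *)
Lemma cesaro_mass_shift A :
  `|cesaro_mass (shiftn 1 @^-1` A) - cesaro_mass A| <= n%:R^-1.
Proof.
have E i : shifted_mass (shiftn 1 @^-1` A) i = shifted_mass A i.+1.
  apply: eq_bigr => p _; congr (_ * _%:R); congr nat_of_bool.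
  by rewrite -[in RHS]addn1 -shiftn_comp.
rewrite /cesaro_mass -mulrBr -sumrB (eq_bigr (fun i => shifted_mass A i.+1 - shifted_mass A i)).
  rewrite telescope_sumr// normrM ger0_norm// -[leRHS]mulr1 ler_wpM2l//.
  have /andP[a b] := shifted_mass01 A n; have /andP[a' b'] := shifted_mass01 A 0.
  by rewrite ler_norml; apply/andP; split; lra.
by move=> i _; rewrite E.
Qed.

Lemma near_average j (h : nat -> R) a : 0 <= a <= 1 ->
  (forall i, 0 <= h i <= 1) -> (forall i, (i + j <= n)%N -> h i = a) ->
  `|n%:R^-1 * (\sum_(0 <= i < n) h i) - a| <= j%:R / n%:R.
Proof.
move=> a01 h01 ha; have n0' : n%:R != 0 :> R by rewrite pnatr_eq0 -lt0n.
have -> : n%:R^-1 * (\sum_(0 <= i < n) h i) - a = n%:R^-1 * \sum_(0 <= i < n) (h i - a).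
  rewrite sumrB mulrBr; congr (_ - _).
  by rewrite sumr_const_nat subn0 -[a *+ n]mulr_natr mulrC mulfK.
rewrite normrM ger0_norm// mulrC ler_wpM2r//.
have ha1 i : `|h i - a| <= 1.
  move: a01 (h01 i) => /andP[? ?] /andP[? ?].
  by rewrite ler_norml; apply/andP; split; lra.
apply: (le_trans (ler_norm_sum _ _ _)).
rewrite (@big_cat_nat _ _ _ (n - j)%N) ?leq_subr//=.
rewrite big_nat big1 ?add0r; last first.
  move=> i /andP[_ ij]; rewrite ha ?subrr ?normr0//; lia.
apply: (@le_trans _ _ (\sum_(n - j <= i < n) 1)); first exact: ler_sum.
by rewrite sumr_const_nat ler_nat; lia.
Qed.

(** By stationarity the window of length [j] read at a given starting point has
    the law of a window of [mu], unless it reaches beyond the end of the word;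
    this happens for at most [j] starting points. *)
Lemma cesaro_mass_fst j (B : set (nat -> X)) : determined j B ->
  `|cesaro_mass [set z | B (fun i => (z i).1)] - pr mu B| <= j%:R / n%:R.
Proof.
move=> dB; have mB := measurable_determined dB.
apply: near_average => [|i|i ijn]; last 2 first.
- exact: shifted_mass01.
- have [_ qa _] := qc.
  rewrite -(Ex_pr mu dB) -(@Ex_shift _ _ _ i j _ n)//; last first.
    move=> u v uv; congr (_%:R); congr nat_of_bool; apply: asbool_equiv_eq.
    by split; apply: dB => k kj; rewrite uv.
  rewrite /shifted_mass sum_pair.
  apply: eq_bigr => x _.
  by rewrite -[LHS](mulr_suml _ xpredT _ `[< B (shiftn i (pad x)) >]%:R) qa.
- by rewrite pr_ge0 pr_le1.
Qed.

Lemma cesaro_mass_snd j (B : set (nat -> Y)) : determined j B ->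
  `|cesaro_mass [set z | B (fun i => (z i).2)] - pr nu B| <= j%:R / n%:R.
Proof.
move=> dB; have mB := measurable_determined dB.
apply: near_average => [|i|i ijn]; last 2 first.
- exact: shifted_mass01.
- have [_ _ qb] := qc.
  rewrite -(Ex_pr nu dB) -(@Ex_shift _ _ _ i j _ n)//; last first.
    move=> u v uv; congr (_%:R); congr nat_of_bool; apply: asbool_equiv_eq.
    by split; apply: dB => k kj; rewrite uv.
  rewrite /shifted_mass sum_pair.
  rewrite exchange_big /=.
  apply: eq_bigr => y _.
  by rewrite -[LHS](mulr_suml _ xpredT _ `[< B (shiftn i (pad y)) >]%:R) qb.
- by rewrite pr_ge0 pr_le1.
Qed.

Lemma cesaro_mass_cost :
  \sum_z c z.1 z.2 * cesaro_mass [set u | u 0%N = z] =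
  n%:R^-1 * \sum_p cost_block c p.1 p.2 * q p.
Proof.
rewrite /cesaro_mass; under eq_bigr do rewrite mulrCA.
rewrite -mulr_sumr; congr (_ * _).
under eq_bigr do rewrite mulr_sumr.
rewrite exchange_big /= [RHS](eq_bigr (fun p => \sum_(0 <= i < n)
    c (pad p.1 i) (pad p.2 i) * q p)); last first.
  by move=> p _; rewrite cost_blockE mulr_suml.
rewrite [RHS]exchange_big /=; apply: eq_bigr => i _.
rewrite /shifted_mass; under eq_bigr do rewrite mulr_sumr.
rewrite exchange_big /=; apply: eq_bigr => p _.
rewrite (bigD1 (zip_pad p i)) //= big1 ?addr0.
  by rewrite asboolT /shiftn ?addn0// mulr1.
by move=> z /eqP zp; rewrite asboolF ?mulr0// /shiftn addn0 => /esym.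
Qed.

End Average.

(** Generalized limits, as the words grow, of the averaged couplings: the
    boundary effects vanish, which gives exact invariance and exact marginals,
    while the mean cost per letter is kept. *)
Theorem joining_of_couplings (b : nat) (r : R) : (0 < b)%N ->
  (forall x y, 0 <= c x y) ->
  (forall m, within (cost_block c (k := m.+1 * b)) (block_law mu (k := m.+1 * b))
     (block_law nu (k := m.+1 * b)) ((m.+1 * b)%:R * r)) ->
  exists2 lam, joinings mu nu lam &
    \sum_(p : X * Y) c p.1 p.2 * block_law lam [tuple p] <= r.
Proof.
move=> b0 c0 w; have [L [LD LZ Lle Lcvg]] := exists_generalized_limit R.
pose Q m := cid2 (w m); pose q m := s2val (Q m).
have qc m : couplings (block_law mu (k := m.+1 * b)) (block_law nu (k := m.+1 * b)) (q m).
  exact: (s2valP (Q m)).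
have qr m : \sum_p cost_block c p.1 p.2 * q m p <= (m.+1 * b)%:R * r.
  exact: (s2valP' (Q m)).
have n0 m : (0 < m.+1 * b)%N by rewrite muln_gt0.
pose a A m := cesaro_mass (q m) A.
have a01 A m : 0 <= a A m <= 1 by exact: cesaro_mass01.
have ba A : bounded_seq (a A).
  by exists 1 => m; have /andP[? ?] := a01 A m; rewrite ger0_norm.
have nm m : (m.+1 * b)%:R^-1 <= m.+1%:R^-1 :> R.
  by rewrite lef_pV2 ?posrE ?ltr0n// ler_nat leq_pmulr.
pose lam A := L (a A).
have [|A|I f A|P PE] := @finitely_additive_extension R _ lam.
- rewrite /lam (_ : a setT = fun=> 1) ?limit_cst//; apply/funext => m.
  exact: cesaro_massT.
- rewrite -[leLHS](limit_cst Lcvg); apply: Lle => //; first exact: bounded_cst.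
  by move=> m; have /andP[] := a01 A m.
- rewrite /lam -(limit_sum LD Lcvg) => [|i]; last exact: ba.
  by congr L; apply/funext => m; exact: cesaro_massD.
have lam_shift A : lam (shiftn 1 @^-1` A) = lam A.
  apply/eqP; rewrite -subr_eq0; apply/eqP.
  have -> : lam A = - L (fun m => -1 * a A m) by rewrite LZ// mulN1r opprK.
  rewrite opprK /lam -LD//; last exact: bounded_seqZ.
  apply: Lcvg; apply: (@cvg_dist_over_n _ _ _ 1) => m.
  rewrite subr0 mulN1r div1r; apply: le_trans (nm m).
  exact: cesaro_mass_shift.
have lam_fst j B : determined j B -> lam [set z | B (fun i => (z i).1)] = pr mu B.
  move=> dB; apply: Lcvg; apply: (@cvg_dist_over_n _ _ _ j%:R) => m.
  apply: le_trans (cesaro_mass_fst (qc m) (n0 m) dB) _.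
  by rewrite ler_wpM2l.
have lam_snd j B : determined j B -> lam [set z | B (fun i => (z i).2)] = pr nu B.
  move=> dB; apply: Lcvg; apply: (@cvg_dist_over_n _ _ _ j%:R) => m.
  apply: le_trans (cesaro_mass_snd (qc m) (n0 m) dB) _.
  by rewrite ler_wpM2l.
have dblock (U : pointedFinType) k (v : k.-tuple U) :
    determined k [set u | block k u = v] := @determined_block _ _ [set v].
have P_st : stationary P.
  have [|Q' Q'E] := @pushforward_probability R _ _ _ P (shiftn 1).
    apply: measurable_to_seqspace => i z; apply: (@measurable_determined _ i.+2).
    by move=> u v uv /= <-; rewrite /shiftn uv.
  move=> A mA; rewrite -Q'E//.
  apply: eq_seq_measure => // k v; have dv := dblock _ k v.
  have mv := measurable_determined dv.
  rewrite /block_law Q'E// -/(pr P _) -/(pr P _) (PE _ _ dv).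
  by rewrite (PE _ _ (@determined_shift _ 1 _ _ dv)) lam_shift.
have P_fst (A : set (seqspace X)) : measurable A -> P [set z | A (fun i => (z i).1)] = mu A.
  have [|Q' Q'E] := @pushforward_probability R _ _ _ P (fun z i => (z i).1).
    apply: measurable_to_seqspace => i z; apply: (@measurable_determined _ i.+1).
    by move=> u v uv /= <-; rewrite uv.
  move=> mA; rewrite -Q'E//.
  apply: eq_seq_measure => // k v; have dv := dblock _ k v.
  have mv := measurable_determined dv.
  rewrite /block_law Q'E// -/(pr P _) -/(pr mu _) -(lam_fst _ _ dv); apply: PE.
  by move=> s t st /=; rewrite /preimage /= => <-; apply/block_eqP => i /st ->.
have P_snd (A : set (seqspace Y)) : measurable A -> P [set z | A (fun i => (z i).2)] = nu A.
  have [|Q' Q'E] := @pushforward_probability R _ _ _ P (fun z i => (z i).2).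
    apply: measurable_to_seqspace => i z; apply: (@measurable_determined _ i.+1).
    by move=> u v uv /= <-; rewrite uv.
  move=> mA; rewrite -Q'E//.
  apply: eq_seq_measure => // k v; have dv := dblock _ k v.
  have mv := measurable_determined dv.
  rewrite /block_law Q'E// -/(pr P _) -/(pr nu _) -(lam_snd _ _ dv); apply: PE.
  by move=> s t st /=; rewrite /preimage /= => <-; apply/block_eqP => i /st ->.
exists P => //.
have -> : \sum_(p : X * Y) c p.1 p.2 * block_law P [tuple p] =
    L (fun m => \sum_(z : X * Y) c z.1 z.2 * a [set u | u 0%N = z] m).
  rewrite (limit_sum LD Lcvg); last by move=> z; exact: bounded_seqZ.
  apply: eq_bigr => z _; rewrite LZ//; congr (_ * _).
  rewrite -[RHS]/(lam [set u | u 0%N = z]) -(PE 1%N); last by move=> u v uv /= <-; rewrite uv.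
  rewrite /block_law /pr; congr (fine (P _)); apply/seteqP; split=> u /= uz.
    by have := congr1 (fun w => tnth w ord0) uz; rewrite tnth_mktuple.
  by apply: eq_from_tnth => i; rewrite tnth_mktuple ord1 /= uz.
rewrite -[leRHS](limit_cst Lcvg); apply: Lle; last 2 first.
- exact: bounded_cst.
- move=> m; rewrite cesaro_mass_cost ler_pdivrMl ?ltr0n//; exact: qr.
- by apply: bounded_seq_sum => z; exact: bounded_seqZ.
Qed.

End JoiningOfCouplings.

(** * The bias of block transport *)

Lemma cost_block_block (R : realType) (X Y : pointedFinType) (c : X -> Y -> R) k
    (u : nat -> X) (v : nat -> Y) :
  cost_block c (block k u) (block k v) = \sum_(0 <= i < k) c (u i) (v i).
Proof. by rewrite big_mkord; apply: eq_bigr => i _; rewrite !tnth_mktuple. Qed.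

(** The letters of the gap are left out, since mixing controls the law of a later
    block given the prefix only across a gap. *)
Definition ends {U : pointedFinType} (L g k : nat) (u : nat -> U) :
    L.-tuple U * k.-tuple U :=
  (block L u, block k (shiftn (L + g) u)).

Definition ends_law {R : realType} {U : pointedFinType}
    (gam : probability (seqspace U) R) (L g k n : nat) :
    L.-tuple U * k.-tuple U -> R :=
  push (fun w : n.-tuple U => ends L g k (pad w)) (@block_law R U gam n).

Arguments ends_law {R U} gam L g k n _.

Section GappedBlocks.
Context {R : realType} {U : pointedFinType}.
Variable gam : probability (seqspace U) R.
Hypothesis st : stationary gam.

Variables L g k n : nat.
Hypothesis nE : n = (L + g + k)%N.

Lemma determined_ends (Q : pred (L.-tuple U * k.-tuple U)) :
  determined n [set u | Q (ends L g k u)].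
Proof.
move=> u v uv /=; rewrite /ends (_ : block L u = block L v).
  rewrite (_ : block k (shiftn (L + g) u) = block k (shiftn (L + g) v))//.
  by apply/block_eqP => i ik; apply: uv; rewrite nE ltn_add2l.
by apply/block_eqP => i iL; apply: uv; rewrite nE; lia.
Qed.

Lemma ends_law_sum (Q : pred (L.-tuple U * k.-tuple U)) :
  \sum_(p | Q p) ends_law gam L g k n p = pr gam [set u | Q (ends L g k u)].
Proof.
rewrite sum_push_cond (pr_determined _ (@determined_ends Q)).
by apply: eq_bigl => w; rewrite asboolb.
Qed.

Lemma ends_law_prefix (u : L.-tuple U) :
  \sum_x ends_law gam L g k n (u, x) = block_law gam u.
Proof.
transitivity (\sum_(p | p.1 == u) ends_law gam L g k n p).
  rewrite (big_mkcond (fun p => p.1 == u)) sum_pair (bigD1 u) //= eqxx.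
  rewrite [X in _ = _ + X]big1 ?addr0// => v /negbTE vu.
  by rewrite big1// => x _ /=; rewrite vu.
rewrite ends_law_sum /block_law /pr; congr (fine (gam _)).
by apply/seteqP; split=> v /= /eqP.
Qed.

(** For a nonempty prefix this is the definition of the mixing coefficient; a
    block preceded by the empty prefix has its stationary law exactly. *)
Lemma ends_law_mixing (u : L.-tuple U) (S : {set k.-tuple U}) :
  0 < block_law gam u ->
  \sum_(x in S) ends_law gam L g k n (u, x) / block_law gam u
    - \sum_(x in S) block_law gam x <= phi_mixing gam g.+1.
Proof.
move=> u0; rewrite -mulr_suml.
pose B : set (seqspace U) := [set v | block k v \in S].
have dB : determined k B by exact: (@determined_block _ _ [set w | w \in S]).
have mB := measurable_determined dB.
pose A : set (nat -> U) := [set v | block L v = u].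
have dA : determined L A by exact: (@determined_block _ _ [set u]).
have -> : \sum_(x in S) block_law gam x = pr gam B.
  by rewrite (pr_determined _ dB); apply: eq_bigl => w; rewrite asboolb block_pad.
have -> : \sum_(x in S) ends_law gam L g k n (u, x) = pr gam (A `&` shiftn (L + g) @^-1` B).
  transitivity (\sum_(p | (p.1 == u) && (p.2 \in S)) ends_law gam L g k n p).
    rewrite [RHS]big_mkcond sum_pair (bigD1 u) //= [X in _ = _ + X]big1 ?addr0; last first.
      by move=> v /negbTE vu; rewrite big1// => x _; rewrite /= vu.
    by rewrite [LHS]big_mkcond; apply: eq_bigr => x _; rewrite eqxx.
  rewrite ends_law_sum; congr (pr gam _); apply/seteqP; split=> v /=.
    by move=> /andP[/eqP].
  by move=> [vu vS]; apply/andP; split=> //; apply/eqP.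
have [L0|L0] := posnP L; last first.
  have := phi_mixingP gam g L0 dA mB; rewrite ler_norml => /andP[_].
  rewrite lerBlDr -mulrDr -[pr gam A]/(block_law gam u) => h.
  by rewrite lerBlDr ler_pdivrMr// mulrC addrC (le_trans h)// addrC.
have AT : A = setT.
  apply/seteqP; split=> // v _; rewrite /A /=.
  by apply: eq_from_tnth => -[i iL]; exfalso; move: iL; rewrite L0.
rewrite AT setTI pr_shiftn// (_ : block_law gam u = 1).
  by rewrite divr1 subrr phi_mixing_ge0.
by rewrite -[LHS]/(pr gam A) AT pr_setT.
Qed.

End GappedBlocks.

Section Bias.
Context {R : realType} {X Y : pointedFinType}.
Variables (c : X -> Y -> R) (M : R).
Hypothesis cM : forall x y, 0 <= c x y <= M.
Variables (mu : probability (seqspace X) R) (nu : probability (seqspace Y) R).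
Hypotheses (mu_st : stationary mu) (nu_st : stationary nu).

Let c0 x y : 0 <= c x y. Proof. by have /andP[] := cM x y. Qed.

Let M0 : 0 <= M.
Proof. by have /andP[] := cM point point; exact: le_trans. Qed.

Lemma cost_block_ge0 k (x : k.-tuple X) (y : k.-tuple Y) : 0 <= cost_block c x y.
Proof. by apply: sumr_ge0 => i _; exact: c0. Qed.

Lemma cost_block_le k (x : k.-tuple X) (y : k.-tuple Y) : cost_block c x y <= k%:R * M.
Proof.
rewrite /cost_block -[k in k%:R]card_ord mulr_natl -sumr_const.
by apply: ler_sum => i _; have /andP[] := cM (tnth x i) (tnth y i).
Qed.

Notation law gam n := (block_law gam (k := n)).

(** Given the two pasts, the conditional laws of the next blocks are coupled
    almost as well as the stationary ones. The gap letters are filled in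
    afterwards, at a cost of at most [M] each. *)
Lemma within_extend (L g k n : nat) r s : n = (L + g + k)%N ->
  within (cost_block c (k := L)) (law mu L) (law nu L) r ->
  within (cost_block c (k := k)) (law mu k) (law nu k) s ->
  within (cost_block c (k := n)) (law mu n) (law nu n)
    (r + (s + k%:R * M * (phi_mixing mu g.+1 + phi_mixing nu g.+1) + g%:R * M)).
Proof.
move=> nE wL wk.
pose ph := phi_mixing mu g.+1; pose ps := phi_mixing nu g.+1.
pose al := ends_law mu L g k n; pose be := ends_law nu L g k n.
have al0 p : 0 <= al p by rewrite push_ge0// => w; exact: block_law_ge0.
have be0 p : 0 <= be p by rewrite push_ge0// => w; exact: block_law_ge0.
have alE : \sum_p al p = 1 by rewrite sum_push block_law_sum.
pose c2 (x : k.-tuple X) (y : k.-tuple Y) := cost_block c x y + g%:R * M.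
have c20 x y : 0 <= c2 x y by rewrite addr_ge0 ?cost_block_ge0 ?mulr_ge0.
have w2 : within (fun p p' => cost_block c p.1 p'.1 + c2 p.2 p'.2) al be
    (r + (s + k%:R * M * (ph + ps) + g%:R * M)).
  apply: within_chain_rule => //.
    have -> : (fun u => \sum_x al (u, x)) = law mu L.
      by apply/funext => u; exact: ends_law_prefix.
    have -> // : (fun v => \sum_y be (v, y)) = law nu L.
    by apply/funext => u; exact: ends_law_prefix.
  move=> u v; rewrite (ends_law_prefix mu nE) (ends_law_prefix nu nE) => u0 v0.
  have ck (x : k.-tuple X) (y : k.-tuple Y) : 0 <= cost_block c x y <= k%:R * M.
    by apply/andP; split; [exact: cost_block_ge0|exact: cost_block_le].
  have kM0 : 0 <= k%:R * M by rewrite mulr_ge0.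
  pose alu x := al (u, x) / block_law mu u.
  pose bev y := be (v, y) / block_law nu v.
  have alu0 x : 0 <= alu x by rewrite divr_ge0// block_law_ge0.
  have bev0 y : 0 <= bev y by rewrite divr_ge0// block_law_ge0.
  have alu1 : \sum_x alu x = 1.
    by rewrite -mulr_suml (ends_law_prefix mu nE) divff// gt_eqF.
  have bev1 : \sum_x bev x = 1.
    by rewrite -mulr_suml (ends_law_prefix nu nE) divff// gt_eqF.
  have wu : within (cost_block c (k := k)) alu (law nu k) (k%:R * M * ph + s).
    apply: (within_perturb_l ck) wk => //.
    - by move=> x; exact: block_law_ge0.
    - by rewrite block_law_sum.
    - by move=> S; exact: (ends_law_mixing mu_st nE).
  have wuv : within (cost_block c (k := k)) alu bev
      (k%:R * M * ps + (k%:R * M * ph + s)).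
    apply: (@within_swap _ _ _ (fun y x => cost_block c x y)).
    apply: (@within_perturb_l _ _ _ _ (k%:R * M) _ _ (law nu k)) (within_swap wu) => //.
    - by move=> x; exact: block_law_ge0.
    - by rewrite block_law_sum.
    - by move=> S; exact: (ends_law_mixing nu_st nE).
  have [q qc qr] := wuv; exists q => //.
  under eq_bigr do rewrite mulrDl.
  rewrite big_split /= -mulr_sumr (coupling_sum qc) alu1 mulr1 lerD2r.
  by apply: le_trans qr _; rewrite mulrDr; lra.
apply: (within_lift (M := n%:R * M)) w2 => //.
- by move=> x; exact: block_law_ge0.
- by move=> x; exact: block_law_ge0.
- by move=> p p'; rewrite addr_ge0// cost_block_ge0.
- by move=> x y; exact: cost_block_le.
- by rewrite mulr_ge0.
move=> x y; rewrite /ends /= /c2 !cost_block_block cost_blockE.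
move: (pad x) (pad y) => px py; rewrite nE.
rewrite (@big_cat_nat _ _ _ (L + g)%N) ?leq_addr//= (@big_cat_nat _ _ _ L) ?leq_addr//=.
rewrite -!addrA lerD2l addrC; apply: lerD.
  rewrite -[X in \sum_(X <= _ < _) _]add0n big_addn addKn.
  by apply: ler_sum => i _; rewrite /shiftn addnC.
rewrite mulr_natl -[X in _ *+ X](_ : (L + g - L)%N = g); last by lia.
rewrite -sumr_const_nat; apply: ler_sum => i _.
by have /andP[] := cM (px i) (py i).
Qed.

Lemma within_blocks (g k m : nat) s :
  within (cost_block c (k := k)) (law mu k) (law nu k) s ->
  within (cost_block c (k := m * (g + k))) (law mu (m * (g + k)))
    (law nu (m * (g + k)))
    (m%:R * (s + k%:R * M * (phi_mixing mu g.+1 + phi_mixing nu g.+1) + g%:R * M)).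
Proof.
move=> wk; elim: m => [|m IH].
  rewrite mul0r; apply: within_bounded => [x y|x|y||].
  - by rewrite /cost_block big_ord0.
  - exact: block_law_ge0.
  - exact: block_law_ge0.
  - by rewrite block_law_sum.
  - by rewrite block_law_sum.
rewrite -natr1 mulrDl mul1r; apply: within_extend IH wk.
by rewrite mulSn addnC addnA.
Qed.

Lemma product_block_coupling k : exists q, couplings (law mu k) (law nu k) q.
Proof.
exists (fun p => block_law mu p.1 * block_law nu p.2); apply: product_coupling.
- by move=> x; exact: block_law_ge0.
- by move=> x; exact: block_law_ge0.
- by rewrite block_law_sum.
- by rewrite block_law_sum.
Qed.

Lemma exists_joining (g k : nat) (e : R) : (0 < k)%N -> 0 < e ->
  exists2 lam, joinings mu nu lam &
    \sum_(p : X * Y) c p.1 p.2 * block_law lam [tuple p] <=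
    (transport (cost_block c (k := k)) (law mu k) (law nu k) + e
     + k%:R * M * (phi_mixing mu g.+1 + phi_mixing nu g.+1) + g%:R * M) / (g + k)%:R.
Proof.
move=> k0 e0; apply: (@joining_of_couplings _ _ _ _ _ _ _ _ (g + k)%N) => //.
  by rewrite addn_gt0 k0 orbT.
move=> m; rewrite natrM -mulrA [X in _ * X]mulrC divfK; last first.
  by rewrite pnatr_eq0 -lt0n addn_gt0 k0 orbT.
apply: within_blocks; apply: within_transport => //; first exact: cost_block_ge0.
exact: product_block_coupling.
Qed.

(** The joint block law of the joining couples the two block laws, and by
    stationarity each of its [k] coordinates has the same mean cost. *)
Lemma transport_le_joining (k : nat) lam : joinings mu nu lam ->
  transport (cost_block c (k := k)) (law mu k) (law nu k) <=
  k%:R * \sum_(p : X * Y) c p.1 p.2 * block_law lam [tuple p].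
Proof.
move=> [lam_st lam_fst lam_snd].
pose f (w : k.-tuple (X * Y)%type) :=
  (block k (fun i => (pad w i).1), block k (fun i => (pad w i).2)).
have cE : \sum_p cost_block c p.1 p.2 * push f (law lam k) p =
    k%:R * \sum_(p : X * Y) c p.1 p.2 * block_law lam [tuple p].
  rewrite (sum_pushM f _ (fun p => cost_block c p.1 p.2)).
  transitivity (Ex lam k (fun u => \sum_(0 <= i < k) c (u i).1 (u i).2)).
    by apply: eq_bigr => w _; rewrite /f cost_block_block mulrC.
  rewrite Ex_sum big_nat (eq_bigr (fun=> \sum_(p : X * Y) c p.1 p.2 * block_law lam [tuple p])).
    by rewrite -big_nat sumr_const_nat subn0 mulr_natl.
  move=> i ik.
  have d1 : depends 1 (fun u : nat -> X * Y => c (u 0%N).1 (u 0%N).2).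
    by move=> u v uv; rewrite uv.
  have -> : (fun u : nat -> X * Y => c (u i).1 (u i).2) =
      (fun u : nat -> X * Y => c (u 0%N).1 (u 0%N).2) \o shiftn i.
    by apply/funext => u /=; rewrite /shiftn addn0.
  rewrite (Ex_shift lam_st d1); last by rewrite addn1.
  rewrite /Ex (reindex (fun p => [tuple p])).
    by apply: eq_bigr => p _; rewrite mulrC.
  exists (fun w => tnth w ord0) => [p _|w _]; first by rewrite (tnth_nth p).
  by apply: eq_from_tnth => j; rewrite (ord1 j) [LHS](tnth_nth (tnth w ord0)).
rewrite -cE; apply: transport_le => [x y|]; first exact: cost_block_ge0.
exists (push f (law lam k)) => //.
split=> [p|x|y].
- by apply: push_ge0 => w; exact: block_law_ge0.
- transitivity (\sum_(p | p.1 == x) push f (law lam k) p).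
    rewrite [RHS]big_mkcond sum_pair (bigD1 x) //= [X in _ = _ + X]big1 ?addr0; last first.
      by move=> v /negbTE vu; rewrite big1// => z _; rewrite /= vu.
    by apply: eq_bigr => y _; rewrite eqxx.
  rewrite sum_push_cond.
  have dx : determined k [set u | block k u = x] := @determined_block _ _ [set x].
  rewrite /block_law -lam_fst; last exact: measurable_determined dx.
  rewrite -/(pr lam _) (@pr_determined _ _ _ k); last first.
    by move=> u v uv /= <-; apply/block_eqP => i ik; rewrite uv.
  by apply: eq_bigl => w /=; apply/eqP/asboolP.
- transitivity (\sum_(p | p.2 == y) push f (law lam k) p).
    rewrite [RHS]big_mkcond sum_pair exchange_big /= (bigD1 y) //=.
    rewrite [X in _ = _ + X]big1 ?addr0; last first.
      by move=> v /negbTE vu; rewrite big1// => z _; rewrite /= vu.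
    by apply: eq_bigr => x _; rewrite eqxx.
  rewrite sum_push_cond.
  have dy : determined k [set u | block k u = y] := @determined_block _ _ [set y].
  rewrite /block_law -lam_snd; last exact: measurable_determined dy.
  rewrite -/(pr lam _) (@pr_determined _ _ _ k); last first.
    by move=> u v uv /= <-; apply/block_eqP => i ik; rewrite uv.
  by apply: eq_bigl => w /=; apply/eqP/asboolP.
Qed.

Theorem joining_cost_bias (g k : nat) : (0 < k)%N ->
  `| k%:R^-1 * transport (cost_block c (k := k)) (law mu k) (law nu k)
     - joining_cost c mu nu |
  <= M * (k%:R * (phi_mixing mu g.+1 + phi_mixing nu g.+1) / (k + g)%:R
          + 3 * g%:R / k%:R).
Proof.
move=> k0; set T := transport _ _ _; set ph := _ + phi_mixing nu _.
have kR : 0 < k%:R :> R by rewrite ltr0n.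
have gR : 0 <= g%:R :> R by [].
have T0 : 0 <= T.
  apply: le_transport; first exact: product_block_coupling.
  move=> q [q0 _ _]; apply: sumr_ge0 => p _; rewrite mulr_ge0//.
  exact: cost_block_ge0.
have ph0 : 0 <= ph by rewrite addr_ge0// phi_mixing_ge0.
have lower : k%:R^-1 * T <= joining_cost c mu nu.
  apply: lb_le_inf.
    have [lam jl _] := exists_joining g k0 ltr01.
    by exists (\sum_(p : X * Y) c p.1 p.2 * block_law lam [tuple p]), lam.
  move=> _ [lam jl <-]; rewrite ler_pdivrMl//; exact: transport_le_joining.
have upper : joining_cost c mu nu <= (T + k%:R * M * ph + g%:R * M) / (g + k)%:R.
  apply/ler_addgt0Pr => e e0.
  have gk : 0 < (g + k)%:R :> R by rewrite ltr0n addn_gt0 k0 orbT.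
  have [lam jl lamr] := exists_joining g k0 (mulr_gt0 e0 gk).
  have -> : (T + k%:R * M * ph + g%:R * M) / (g + k)%:R + e =
     (T + e * (g + k)%:R + k%:R * M * ph + g%:R * M) / (g + k)%:R.
    by rewrite -[in LHS](mulfK (lt0r_neq0 gk) e) -mulrDl; congr (_ / _); ring.
  apply: le_trans lamr; apply: ge_inf; last by exists lam.
  exists 0 => _ [P' _ <-]; apply: sumr_ge0 => p _.
  by rewrite mulr_ge0// block_law_ge0.
rewrite distrC ger0_norm ?subr_ge0// lerBlDr (le_trans upper)//.
rewrite natrD (natrD _ k g) [g%:R + _]addrC.
set K := k%:R : R; set G := g%:R : R.
rewrite -/K -/G in kR gR *.
have KG : 0 < K + G by rewrite ltr_wpDr.
have KG' : (K + G)^-1 <= K^-1 by rewrite lef_pV2 ?posrE// lerDl.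
have h1 : T / (K + G) <= K^-1 * T by rewrite mulrC ler_wpM2r.
have h2 : G * M / (K + G) <= G * M / K by rewrite ler_wpM2l// mulr_ge0.
have h3 : 0 <= G * M / K by rewrite !mulr_ge0// invr_ge0 ltW.
have -> : M * (K * ph / (K + G) + 3 * G / K) =
    K * M * ph / (K + G) + 3 * (G * M / K) by ring.
rewrite 2!mulrDl.
by lra.
Qed.

End Bias.

(** * Small balls under mixing *)

Section SmallBall.
Context {R : realType} {U : pointedFinType}.
Variable gam : probability (seqspace U) R.
Hypothesis st : stationary gam.
Variable d : U -> U -> R.
Variables (g : nat) (rho : R).

Hypothesis class_rho : forall a,
  pr gam [set u | d a (u 0%N) = 0] + phi_mixing gam g.+1 <= rho.

Let tau : R := (1 + rho) / 2.

(** The weight that counts mismatches exponentially, for a Chernoff bound. *)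
Definition mismatch (a b : U) : R := if d a b == 0 then 1 else 2^-1.

Lemma mismatch_gt0 a b : 0 < mismatch a b.
Proof. by rewrite /mismatch; case: ifP. Qed.

(** Conditioning on the first [l] letters fixes [G] and the target [y]; the
    letter across the gap then matches with probability at most [rho]. *)
Lemma Ex_mismatch_step l N (G : (nat -> U) -> R) (y : (nat -> U) -> U) :
  (1 <= l)%N -> (l + g < N)%N -> depends l G -> depends l y -> (forall u, 0 <= G u) ->
  Ex gam N (fun u => G u * mismatch (y u) (u (l + g)%N)) <= tau * Ex gam N G.
Proof.
move=> l1 lN dG dy G0.
pose B a : set (seqspace U) := [set u | d a (u 0%N) = 0].
have dB a : determined 1 (B a) by move=> u v uv; rewrite /B /= uv.
pose A (w : l.-tuple U) : set (nat -> U) := [set u | block l u = w].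
have dA w : determined l (A w) := @determined_block _ _ [set w].
have dAB w a : determined N (A w `&` shiftn (l + g) @^-1` B a).
  apply: determinedI; first by apply: determinedW (dA w); lia.
  by apply: determinedW (determined_shift (dB a)); rewrite addn1.
have GE u : G u = \sum_(w : l.-tuple U) G (pad w) * `[< A w u >]%:R := dependsE u dG.
have EA w : Ex gam N (fun u => `[< A w u >]%:R) = pr gam (A w).
  by rewrite Ex_pr//; apply: determinedW (dA w); lia.
have ExG : Ex gam N G = \sum_(w : l.-tuple U) G (pad w) * pr gam (A w).
  transitivity (Ex gam N (fun u => \sum_(w : l.-tuple U) G (pad w) * `[< A w u >]%:R)).
    exact: eq_Ex.
  by rewrite Ex_sum; apply: eq_bigr => w _; rewrite ExZ EA.
have -> : Ex gam N (fun u => G u * mismatch (y u) (u (l + g)%N)) =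
    2^-1 * Ex gam N G + 2^-1 * \sum_(w : l.-tuple U)
      G (pad w) * pr gam (A w `&` shiftn (l + g) @^-1` B (y (pad w))).
  transitivity (Ex gam N (fun u => 2^-1 * G u + 2^-1 * \sum_(w : l.-tuple U)
      G (pad w) * `[< (A w `&` shiftn (l + g) @^-1` B (y (pad w))) u >]%:R)).
    apply: eq_Ex => u.
    have -> : \sum_(w : l.-tuple U)
        G (pad w) * `[< (A w `&` shiftn (l + g) @^-1` B (y (pad w))) u >]%:R =
        G u * (d (y u) (u (l + g)%N) == 0)%:R.
      rewrite (bigD1 (block l u)) //= big1 ?addr0; last first.
        by move=> w /eqP wu; rewrite asboolF ?mulr0// => -[uw _]; apply: wu.
      have e : forall i, (i < l)%N -> pad (block l u) i = u i.
        by move=> i il; rewrite pad_block.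
      rewrite (dG _ _ e) (dy _ _ e); congr (_ * _%:R); congr nat_of_bool.
      apply/asboolP/eqP => [[_]|h]; first by rewrite /B /= /shiftn addn0.
      by split; rewrite // /B /= /shiftn addn0.
    by rewrite /mismatch; case: eqP => _ /=; lra.
  rewrite ExD !ExZ Ex_sum; congr (_ + _ * _); apply: eq_bigr => w _.
  by rewrite ExZ Ex_pr.
have : \sum_(w : l.-tuple U)
      G (pad w) * pr gam (A w `&` shiftn (l + g) @^-1` B (y (pad w))) <= rho * Ex gam N G.
  rewrite ExG mulr_sumr; apply: ler_sum => w _; rewrite mulrCA ler_wpM2l//.
  have mB := measurable_determined (dB (y (pad w))).
  have := phi_mixingP gam g l1 (dA w) mB; rewrite ler_norml => /andP[_].
  rewrite lerBlDr => /le_trans; apply; rewrite -mulrDr mulrC ler_wpM2r ?pr_ge0//.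
  by rewrite addrC; exact: class_rho.
rewrite /tau; set x := Ex gam N G; set z := \sum_(_ | _) _ => zx.
by rewrite mulrAC mulrDl mul1r; lra.
Qed.

(** Targets [y i] are compared with letters [g.+1] apart; given the past of the
    i-th comparison a match has conditional probability at most [rho]. *)
Lemma Ex_mismatch_prod l N K (y : nat -> (nat -> U) -> U) :
  0 <= tau -> (1 <= l)%N -> (l + K * g.+1 <= N)%N ->
  (forall i, depends (l + i * g.+1) (y i)) ->
  Ex gam N (fun u => \prod_(i < K) mismatch (y i u) (u (l + i * g.+1 + g)%N))
  <= tau ^+ K.
Proof.
move=> tau0 l1 + dy; elim: K => [|K IH] lN.
  by rewrite expr0 -[leRHS](Ex_cst gam N 1); apply: Ex_le => u; rewrite big_ord0.
under [X in Ex _ _ X]eq_fun do rewrite big_ord_recr /=.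
apply: le_trans (Ex_mismatch_step _ _ _ (dy K) _) _.
- by lia.
- by move: lN; rewrite mulSn; lia.
- move=> u v uv; apply: eq_bigr => i _; have iK := ltn_ord i.
  have iKs : (i * g.+1 + g.+1 <= K * g.+1)%N by rewrite -mulSnr leq_mul2r iK orbT.
  rewrite (dy i u v); last by move=> j ij; apply: uv; lia.
  by rewrite uv//; lia.
- by move=> u; apply: prodr_ge0 => i _; exact: ltW (mismatch_gt0 _ _).
- by rewrite exprS ler_wpM2l// IH//; move: lN; rewrite mulSn; lia.
Qed.

Variables (Q : nat) (dmin : R).
Hypotheses (tauQ : tau ^+ Q <= 4^-1) (Q0 : (0 < Q)%N) (rho0 : 0 <= rho).
Hypotheses (dmin0 : 0 < dmin) (d0 : forall a b, 0 <= d a b)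
  (dminP : forall a b, d a b != 0 -> dmin <= d a b).

Let w := (g.+1 * Q)%N.

Lemma sum_subsample (F : nat -> R) s K k : (0 < s)%N -> (s * K <= k)%N ->
  (forall j, 0 <= F j) -> \sum_(i < K) F (s * i)%N <= \sum_(0 <= j < k) F j.
Proof.
move=> s0 + F0; elim: K k => [|K IH] k sK.
  by rewrite big_ord0 sumr_ge0.
rewrite big_ord_recr /= (@big_cat_nat _ _ _ (s * K)%N)//=; last first.
  by apply: leq_trans sK; rewrite leq_mul2l leqnSn orbT.
apply: lerD; first exact: IH.
have sKk : (s * K < k)%N by apply: leq_trans sK; rewrite mulnS; lia.
by rewrite big_ltn// lerDl sumr_ge0.
Qed.

(** If the blocks are close, at most [k %/ w] of the [Q * (k %/ w)] sampled
    letters mismatch, since each mismatch costs at least [dmin]. The product of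
    the weights is then at least 2^-(k %/ w), while its mean is at most
    4^-(k %/ w), and Markov's inequality applies. The target [v] may be a fixed
    word, or the sequence itself when the block is compared with its shift. *)
Theorem small_ball k l N (v : (nat -> U) -> nat -> U) :
  (g.+1 <= l)%N -> (l + k <= N)%N ->
  (forall j, depends (l - g + j) (v^~ j)) ->
  Ex gam N (fun u => `[< k%:R^-1 * cost_block d (block k (v u)) (block k (shiftn l u))
                         <= dmin / w%:R >]%:R)
  <= 2^-1 ^+ (k %/ w).
Proof.
move=> gl lkN dv; set h := (k %/ w)%N.
have w0 : (0 < w)%N by rewrite muln_gt0.
have hk : (w * h <= k)%N by rewrite mulnC leq_trunc_div.
have tau0 : 0 <= tau by rewrite /tau divr_ge0// addr_ge0.
pose y i u := v u (g.+1 * i)%N.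
pose Pi u := \prod_(i < Q * h) mismatch (y i u) (u (l - g + i * g.+1 + g)%N).
have EPi : Ex gam N Pi <= (4^-1) ^+ h.
  apply: le_trans (@Ex_mismatch_prod (l - g) N (Q * h) y tau0 _ _ _) _.
  - by lia.
  - by move: hk; rewrite /w; lia.
  - by move=> i; rewrite mulnC; exact: dv.
  - by rewrite exprM lerXn2r// ?nnegrE ?exprn_ge0// invr_ge0.
apply: (@le_trans _ _ (Ex gam N (fun u => 2 ^+ h * Pi u))); last first.
  rewrite ExZ; apply: (@le_trans _ _ (2 ^+ h * 4^-1 ^+ h)).
    by rewrite ler_wpM2l// exprn_ge0.
  by rewrite -exprMn (_ : 2 * 4^-1 = 2^-1 :> R)//; lra.
apply: Ex_le => u; case: asboolP => [hd|_]; last first.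
  by rewrite mulr_ge0 ?exprn_ge0//; apply: prodr_ge0 => i _; exact: ltW (mismatch_gt0 _ _).
pose Z := (\sum_(i < Q * h) (d (y i u) (u (l - g + i * g.+1 + g)%N) != 0%R))%N.
have PiE : Pi u = 2^-1 ^+ Z.
  rewrite /Z -prodrXr; apply: eq_bigr => i _; rewrite /mismatch.
  by case: eqP.
have Zh : (Z <= h)%N.
  rewrite /h leq_divRL//; have [k0|k0] := posnP k.
    have h0 : (Q * h)%N = 0%N by rewrite /h k0 div0n muln0.
    by rewrite /Z h0 big_ord0.
  rewrite -(ler_nat R) natrM; have kR : 0 < k%:R :> R by rewrite ltr0n.
  have := hd; rewrite ler_pdivrMl// cost_block_block => hd'.
  have Zd : Z%:R * dmin <= \sum_(0 <= j < k) d (v u j) (shiftn l u j).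
    apply: le_trans (sum_subsample (F := fun j => d (v u j) (shiftn l u j))
      (s := g.+1) (K := Q * h) _ _ _) => //; last by move: hk; rewrite /w; lia.
    rewrite /Z natr_sum mulr_suml; apply: ler_sum => i _.
    rewrite /y (_ : (l - g + i * g.+1 + g)%N = (l + g.+1 * i)%N); last by nia.
    by rewrite /shiftn; case: eqP => [->|/eqP] /=; rewrite ?mul0r// mul1r => /dminP.
  have := le_trans Zd hd'; rewrite [leRHS]mulrCA [leLHS]mulrC ler_pM2l//.
  by rewrite ler_pdivlMr// ltr0n.
rewrite PiE; apply: (@le_trans _ _ (2 ^+ h * 2^-1 ^+ h)).
  by rewrite -exprMn divff// expr1n.
rewrite ler_wpM2l ?exprn_ge0//.
by apply: ler_wiXn2l => //; lra.
Qed.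

End SmallBall.

(** * Variance of block frequencies *)

Section EmpiricalVariance.
Context {R : realType} {U : pointedFinType} {T : finType}.
Variable gam : probability (seqspace U) R.
Hypothesis st : stationary gam.
Variables (k n : nat) (q : k.-tuple U -> T).
Hypothesis kn : (k <= n)%N.

Let m := (n - k).+1.
Let qi i (u : nat -> U) := q (block k (shiftn i u)).
Let law : T -> R := push q (block_law gam (k := k)).

Lemma push_empirical u a :
  push q (@empirical R U k n u) a = m%:R^-1 * \sum_(0 <= i < m) (qi i u == a)%:R.
Proof.
rewrite /push /empirical addn1 -mulr_sumr exchange_big /=; congr (_ * _).
apply: eq_bigr => i _; rewrite big_mkcond /=.
rewrite -[RHS](sum_delta (fun w => (q w == a)%:R) (block k (shiftn i u))).
by apply: eq_bigr => w _; case: eqP; rewrite ?mul1r ?mul0r.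
Qed.

Lemma determined_cell a : determined k [set u | q (block k u) = a].
Proof. exact: (@determined_block _ _ [set w | q w = a]). Qed.

Lemma pr_cell a : pr gam [set u | q (block k u) = a] = law a.
Proof.
rewrite (pr_determined _ (@determined_cell a)) /law /push; apply: eq_bigl => w.
by rewrite /= block_pad; apply/asboolP/eqP.
Qed.

Lemma Ex_cell i N a : (i + k <= N)%N -> Ex gam N (fun u => (qi i u == a)%:R) = law a.
Proof.
move=> iN; rewrite -pr_cell -(Ex_pr _ (@determined_cell a)).
rewrite -(@Ex_shift _ _ _ i k _ N st)//; last first.
  by move=> u v uv /=; rewrite (_ : block k u = block k v)//; apply/block_eqP.
by apply: eq_Ex => u /=; congr (_%:R); congr nat_of_bool; apply/eqP/asboolP.
Qed.

Lemma law_sum : \sum_a law a = 1.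
Proof. by rewrite sum_push block_law_sum. Qed.

(** For independent blocks this would be [\sum_a law a ^+ 2]; the difference is
    the sum over cells of the covariance of their indicators at lag [l]. *)
Definition return_prob (l : nat) : R :=
  Ex gam (l + k) (fun u => (q (block k u) == qi l u)%:R).

Lemma Ex_return i l N : (i + l + k <= N)%N ->
  Ex gam N (fun u => (qi i u == qi (i + l) u)%:R) = return_prob l.
Proof.
move=> iN; rewrite /return_prob -(@Ex_shift _ _ _ i (l + k) _ N st); last by rewrite addnA.
  by apply: eq_Ex => u /=; rewrite /qi shiftn_comp.
move=> u v uv; rewrite /qi (_ : block k u = block k v); last first.
  by apply/block_eqP => j jk; apply: uv; lia.
rewrite (_ : block k (shiftn l u) = block k (shiftn l v))//.
by apply/block_eqP => j jk; apply: uv; rewrite ltn_add2l.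
Qed.

Lemma cell_covariance i l : (i + l < m)%N ->
  Ex gam n (fun u => \sum_a ((qi i u == a)%:R - law a) * ((qi (i + l) u == a)%:R - law a))
  = return_prob l - \sum_a law a ^+ 2.
Proof.
move=> ilm; have iln : (i + l + k <= n)%N by move: ilm; rewrite /m; lia.
rewrite -(Ex_return iln) Ex_sum.
transitivity (\sum_a (Ex gam n (fun u => (qi i u == a)%:R * (qi (i + l) u == a)%:R)
    - law a ^+ 2)).
  apply: eq_bigr => a _.
  transitivity (Ex gam n (fun u => ((qi i u == a)%:R * (qi (i + l) u == a)%:R
     - law a * (qi i u == a)%:R) - (law a * (qi (i + l) u == a)%:R - law a ^+ 2))).
    by apply: eq_Ex => u; ring.
  rewrite !ExB !ExZ !Ex_cell ?Ex_cst//; last by lia.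
  by ring.
rewrite sumrB -Ex_sum; congr (_ - _); apply: eq_Ex => u.
rewrite (bigD1 (qi i u)) //= big1 ?addr0; last first.
  by move=> a /negbTE; rewrite eq_sym => ->; rewrite mul0r.
by rewrite eqxx mul1r eq_sym.
Qed.

(** Expanding the square leaves covariances that depend on the lag only. *)
Lemma empirical_variance (b : nat -> R) :
  (forall l, 0 <= b l) ->
  (forall l, return_prob l - \sum_a law a ^+ 2 <= b l) ->
  Ex gam n (fun u => \sum_a (push q (@empirical R U k n u) a - law a) ^+ 2)
  <= 2 * m%:R^-2 * \sum_(0 <= i < m) \sum_(0 <= l < i.+1) b l.
Proof.
move=> b0 hb; have mR : m%:R != 0 :> R by rewrite pnatr_eq0.
pose D u a i : R := (qi i u == a)%:R - law a.
have devE u a : push q (@empirical R U k n u) a - law a =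
    m%:R^-1 * \sum_(0 <= i < m) D u a i.
  rewrite push_empirical /D sumrB mulrBr; congr (_ - _).
  by rewrite sumr_const_nat subn0 -[law a *+ m]mulr_natr mulrC mulfK.
have -> : Ex gam n (fun u => \sum_a (push q (@empirical R U k n u) a - law a) ^+ 2) =
    m%:R^-2 * \sum_(0 <= i < m) \sum_(0 <= j < m) Ex gam n (fun u => \sum_a D u a i * D u a j).
  transitivity (Ex gam n (fun u => m%:R^-2 * \sum_(0 <= i < m) \sum_(0 <= j < m)
      \sum_a D u a i * D u a j)).
    apply: eq_Ex => u; rewrite (eq_bigr (fun a => m%:R^-2 *
       \sum_(0 <= i < m) \sum_(0 <= j < m) D u a i * D u a j)); last first.
      move=> a _; rewrite devE exprMn exprVn; congr (_ * _).
      by rewrite expr2 mulr_suml; apply: eq_bigr => i _; rewrite mulr_sumr.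
    rewrite -mulr_sumr; congr (_ * _); rewrite exchange_big /=.
    by apply: eq_bigr => i _; rewrite exchange_big.
  rewrite ExZ Ex_sum; congr (_ * _); apply: eq_bigr => i _.
  by rewrite Ex_sum.
have covb i l : (i + l < m)%N -> Ex gam n (fun u => \sum_a D u a i * D u a (i + l)%N) <= b l.
  by move=> ilm; rewrite cell_covariance.
rewrite [2 * _]mulrC -mulrA ler_wpM2l ?invr_ge0 ?exprn_ge0//.
apply: (@le_trans _ _ (\sum_(0 <= i < m)
   (\sum_(0 <= l < i.+1) b l + \sum_(0 <= l < m - i) b l))).
  rewrite !big_nat; apply: ler_sum => i /andP[_ im].
  rewrite (@big_cat_nat _ _ _ i) ?(ltnW im)//=; apply: lerD.
    rewrite big_nat_rev /= add0n.
    apply: (@le_trans _ _ (\sum_(0 <= j < i) b j.+1)); last first.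
      by rewrite (big_nat_recl _ _ _ (leq0n _)) /= lerDr.
    rewrite !big_nat; apply: ler_sum => j /andP[_ ji].
    under eq_Ex do under eq_bigr do rewrite mulrC.
    rewrite -{2}(_ : (i - j.+1 + j.+1)%N = i); last by rewrite subnK.
    by apply: covb; lia.
  rewrite -[X in \sum_(X <= _ < _) _]add0n big_addn.
  rewrite !big_nat; apply: ler_sum => l /andP[_ lm].
  by rewrite addnC; apply: covb; lia.
rewrite big_split /= mulr_natl mulr2n lerD2l.
rewrite big_nat_rev /= add0n big_nat [leRHS]big_nat; apply: ler_sum => i /andP[_ im].
by rewrite (_ : (m - (m - i.+1))%N = i.+1)//; lia.
Qed.

Lemma return_le1 l : return_prob l - \sum_a law a ^+ 2 <= 1.
Proof.
rewrite lerBlDr -[leLHS]addr0 lerD ?sumr_ge0//; last by move=> a _; exact: sqr_ge0.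
rewrite -[leRHS](Ex_cst gam (l + k) 1); apply: Ex_le => u.
by rewrite (_ : 1 = 1%:R)// ler_nat leq_b1.
Qed.

Lemma return_mixing l : (0 < k)%N -> (k <= l)%N ->
  return_prob l - \sum_a law a ^+ 2 <= phi_mixing gam (l - k).+1.
Proof.
move=> k0 kl.
have lE : (k + (l - k))%N = l by rewrite subnKC.
pose A a : set (seqspace U) := [set u | q (block k u) = a].
have dA a : determined k (A a) := @determined_cell a.
have mA a := measurable_determined (dA a).
have -> : return_prob l = \sum_a pr gam (A a `&` shiftn l @^-1` A a).
  rewrite /return_prob (eq_bigr (fun a => Ex gam (l + k)
      (fun u => `[< (A a `&` shiftn l @^-1` A a) u >]%:R))); last first.
    move=> a _; rewrite Ex_pr//; apply: determinedI; last exact: determined_shift.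
    by apply: determinedW (dA a); rewrite leq_addl.
  rewrite -Ex_sum; apply: eq_Ex => u; rewrite (bigD1 (qi l u)) //= big1 ?addr0.
    congr (_%:R); congr nat_of_bool; apply/eqP/asboolP => [qE|[qE _]//].
    by split.
  by move=> a /eqP aq; rewrite asboolF// => -[_ /= qE]; apply: aq.
rewrite -sumrB -[leRHS]mul1r -law_sum mulr_suml; apply: ler_sum => a _.
have := phi_mixingP gam (l - k) k0 (dA a) (mA a).
by rewrite lE pr_cell ler_norml => /andP[_]; rewrite expr2.
Qed.

End EmpiricalVariance.

Section CumulatedMixing.
Context {R : realType} {U : pointedFinType}.
Variable gam : probability (seqspace U) R.

Let sphi l : R := Num.sqrt (phi_mixing gam l).

Lemma phi_le_sqrt l : phi_mixing gam l <= sphi l.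
Proof.
have p0 := phi_mixing_ge0 gam l; have p1 := phi_mixing_le1 gam l.
rewrite -[leLHS]sqr_sqrtr// expr2 ler_piMr ?sqrtr_ge0// -sqrtr1.
by rewrite ler_wsqrtr.
Qed.

Lemma sqrt_phi_sum_ge1 r : (0 < r)%N -> 1 <= \sum_(0 <= l < r) sphi l.
Proof.
by move=> r0; rewrite big_ltn// /sphi /= sqrtr1 lerDl sumr_ge0.
Qed.

(** Cumulated sums give the weights of the mixing sum: the lag [l] occurs in
    those indexed by [l] to [n]. *)
Lemma sum_cumulated n (F : nat -> R) :
  \sum_(0 <= i < n.+1) \sum_(0 <= l < i.+1) F l =
  \sum_(0 <= l < n.+1) (n - l + 1)%:R * F l.
Proof.
elim: n => [|n IH]; first by rewrite !big_nat1 subn0 mul1r.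
rewrite big_nat_recr //= IH [in RHS]big_nat_recr //= [X in _ + X]big_nat_recr //=.
rewrite subnn add0n mul1r addrA; congr (_ + _); rewrite -big_split /=.
rewrite !big_nat; apply: eq_bigr => l /andP[_ ln].
by rewrite (_ : (n.+1 - l + 1)%N = (n - l + 1).+1) -?natr1 ?mulrDl ?mul1r//; lia.
Qed.

(** The bound on the covariances at lag [l]: trivial for the first [s] lags,
    the small-ball bound while the blocks overlap, mixing afterwards. *)
Definition lag_bound (s w k l : nat) : R :=
  if (l < s)%N then 1 else if (l < k)%N then 2^-1 ^+ (k %/ w)
  else phi_mixing gam (l - k).+1.

Lemma lag_bound_ge0 s w k l : 0 <= lag_bound s w k l.
Proof.
rewrite /lag_bound; case: ifP => // _; case: ifP => _; last exact: phi_mixing_ge0.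
by rewrite exprn_ge0.
Qed.

(** The number of overlapping lags is absorbed by the exponentially small
    covariance at each of them. *)
Lemma block_length_le k w : (0 < w)%N -> k%:R * 2^-1 ^+ (k %/ w) <= w%:R :> R.
Proof.
move=> w0; rewrite exprVn ler_pdivrMr ?exprn_gt0// -natrX -natrM ler_nat.
apply: (@leq_trans (w * (k %/ w).+1)); first by rewrite mulnC ltnW// ltn_ceil.
by rewrite leq_mul2l ltn_expl ?orbT.
Qed.

Lemma sum_lag_bound s w k r : (0 < k)%N -> (0 < w)%N -> (0 < r)%N -> (s <= w)%N ->
  \sum_(0 <= l < r) lag_bound s w k l <= (2 * w + 1)%:R * \sum_(0 <= l < r) sphi l.
Proof.
move=> k0 w0 r0 sw.
have S1 := sqrt_phi_sum_ge1 r0; set S := \sum_(0 <= l < r) sphi l in S1 *.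
pose f1 l : R := (l < s)%N%:R; pose f2 l : R := (l < k)%N%:R * 2^-1 ^+ (k %/ w).
pose f3 l : R := (k <= l)%N%:R * phi_mixing gam (l - k).+1.
have cnt t : \sum_(0 <= l < r) (l < t)%N%:R <= t%:R :> R.
  rewrite -natr_sum ler_nat -big_mkcond /= sum1_count.
  rewrite -size_filter; apply: (@leq_trans (size (iota 0 t))); last by rewrite size_iota.
  apply: uniq_leq_size; first by rewrite filter_uniq// iota_uniq.
  by move=> l; rewrite mem_filter mem_iota => /andP[-> _].
have S0 : 0 <= S by apply: le_trans S1.
apply: (@le_trans _ _ (\sum_(0 <= l < r) (f1 l + (f2 l + f3 l)))).
  apply: ler_sum => l _; rewrite /lag_bound /f1 /f2 /f3.
  have p0 := phi_mixing_ge0 gam (l - k).+1.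
  have h0 : 0 <= 2^-1 ^+ (k %/ w) :> R by rewrite exprn_ge0.
  move: (phi_mixing _ _) p0 (2^-1 ^+ _) h0 => p p0 h h0.
  by case: (ltnP l s) => _; case: (ltnP l k) => _ /=; rewrite ?mul1r ?mul0r; lra.
rewrite !big_split /=; apply: (@le_trans _ _ (w%:R * S + (w%:R * S + S))); last first.
  by rewrite natrD natrM; lra.
apply: lerD; [|apply: lerD].
- apply: le_trans (cnt s) _; rewrite -[leLHS]mulr1; apply: ler_pM => //.
  by rewrite ler_nat.
- rewrite /f2 -mulr_suml; apply: (@le_trans _ _ w%:R); last by rewrite ler_peMr.
  by apply: le_trans (block_length_le k w0); rewrite ler_wpM2r ?exprn_ge0.
- rewrite /f3; have [rk|kr] := leqP r k.
    rewrite big_nat big1 ?S0// => l /andP[_ lr].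
    by rewrite leqNgt (leq_trans lr rk) mul0r.
  rewrite (@big_cat_nat _ _ _ k) ?(ltnW kr)//= big_nat big1 ?add0r; last first.
    by move=> l /andP[_ lk]; rewrite leqNgt lk mul0r.
  rewrite -[X in \sum_(X <= _ < _) _]add0n big_addn.
  apply: (@le_trans _ _ (\sum_(0 <= l < r - k) sphi l.+1)).
    apply: ler_sum => l _; rewrite leq_addl mul1r addnK. exact: (phi_le_sqrt l.+1).
  rewrite /S [leRHS](@big_cat_nat _ _ _ (r - k).+1) ?ltn_subrL ?k0 ?r0//=.
  rewrite (big_nat_recl _ _ _ (leq0n _)) /=.
  rewrite -addrA addrCA lerDl addr_ge0 ?sumr_ge0// => [|i _]; exact: sqrtr_ge0.
Qed.

End CumulatedMixing.

(** * Covering numbers and the entropy integral *)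

Section CoveringNumber.
Context {R : realType} {T : finType}.
Variable d : T -> T -> R.

Definition covers (A : {set T}) (e : R) : bool :=
  [forall u, exists a in A, d u a <= e].

Lemma covering_number_le A e : covers A e -> (covering_number d e <= #|A|)%N.
Proof.
move=> cA; rewrite /covering_number.
elim: (index_enum _) (mem_index_enum A) => // B r IH.
rewrite inE big_cons => /predU1P[<-|/IH Ar]; first by rewrite ifT// geq_minl.
by case: ifP => _ //; rewrite geq_min Ar orbT.
Qed.

(** Without any covering, for instance at a negative radius, the minimum takes
    its default value. *)
Lemma covering_number_cases e : covering_number d e = #|T| \/
  exists2 A : {set T}, covers A e & #|A| = covering_number d e.
Proof.
rewrite /covering_number; elim/big_rec : _ => [|A x cA [->|[B cB <-]]]; first by left.
  by rewrite /minn; case: ifP => _; [right; exists A|left].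
by rewrite /minn; case: ifP => _; [right; exists A|right; exists B].
Qed.

Lemma covering_number_card e : (covering_number d e <= #|T|)%N.
Proof. by case: (covering_number_cases e) => [->//|[A _ <-]]; exact: max_card. Qed.

Lemma exists_net e : (forall u, d u u = 0) -> 0 <= e ->
  exists2 A : {set T}, covers A e & #|A| = covering_number d e.
Proof.
move=> d0 e0; case: (covering_number_cases e) => // eT.
exists [set: T]%SET; last by rewrite cardsT eT.
by apply/forallP => u; apply/existsP; exists u; rewrite inE d0.
Qed.

Lemma covering_number_anti e e' : e <= e' ->
  (covering_number d e' <= covering_number d e)%N.
Proof.
move=> ee'; case: (covering_number_cases e) => [->|[A cA <-]].
  exact: covering_number_card.
apply: covering_number_le; apply/forallP => u.
have /forallP/(_ u)/existsP[a /andP[aA ua]] := cA.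
by apply/existsP; exists a; rewrite aA (le_trans ua).
Qed.

Lemma covering_number_gt0 e : (0 < #|T|)%N -> (0 < covering_number d e)%N.
Proof.
move=> T0; case: (covering_number_cases e) => [->//|[A cA <-]].
have /card_gt0P[u _] := T0.
have /forallP/(_ u)/existsP[a /andP[aA _]] := cA.
by apply/card_gt0P; exists a.
Qed.

End CoveringNumber.

Section EntropyIntegral.
Context {R : realType}.
Variables (F : R -> R) (K b : R).
Hypothesis F_anti : forall x y, x <= y -> F y <= F x.
Hypothesis F0K : forall x, 0 <= F x <= K.

Local Notation mu := (@lebesgue_measure R).

Definition tail_integral (a : R) : R := (\int[mu]_(x in `[a, b]) F x)%R.

Lemma lebesgue_itv_fin a c : (mu `[a, c]%classic < +oo)%E.
Proof.
by rewrite lebesgue_measure_itv /=; case: ifP => _; rewrite ?ltry// -EFinB ltry.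
Qed.

Lemma integrable_anti a c : mu.-integrable `[a, c]%classic (EFin \o F).
Proof.
apply: measurable_bounded_integrable => //.
- exact: lebesgue_itv_fin.
- apply: measurable_realfun.nonincreasing_measurable => // x y; exact: F_anti.
- exists K; split; first exact: num_real.
  move=> x Kx y _ /=; have /andP[y0 yK] := F0K y.
  by rewrite ger0_norm// (le_trans yK)// ltW.
Qed.

Lemma tail_integral_ge0 a : 0 <= tail_integral a.
Proof. by apply: Rintegral_ge0 => x _; have /andP[] := F0K x. Qed.

Lemma tail_integral_step a e : a <= e -> e <= b ->
  (e - a) * F e + tail_integral e <= tail_integral a.
Proof.
move=> ae eb.
have h : tail_integral a = (\int[mu]_(x in `[a, e]) F x)%R + (\int[mu]_(x in `]e, b]) F x)%R.
  rewrite -(@Rintegral_itvB _ F (BLeft a) (BRight b) e) ?bnd_simp//; last exact: integrable_anti.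
  by rewrite addrC subrK.
rewrite h; apply: lerD.
  have -> : (e - a) * F e = (\int[mu]_(x in `[a, e]) (cst (F e) x))%R.
    have E : fine (mu `[a, e]%classic) = e - a.
      rewrite lebesgue_measure_itv /= lte_fin.
      case: ltP => // ea; have /eqP -> : e == a by rewrite eq_le ae ea.
      by rewrite subrr.
    by rewrite [RHS]Rintegral_cst// mulrC; congr (_ * _).
  apply: le_Rintegral => //.
  - apply: measurable_bounded_integrable => //.
      exact: lebesgue_itv_fin.
    exists `|F e|; split; first exact: num_real.
    by move=> x ? y _; exact: ltW.
  - exact: integrable_anti.
  - by move=> x; rewrite /= in_itv /= => /andP[_ xe]; exact: F_anti.
rewrite /tail_integral Rintegral_itv_obnd_cbnd//.
apply: (@integrableS _ _ _ mu `[e, b]%classic) => //; last exact: integrable_anti.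
by move=> x /=; rewrite !in_itv /= => /andP[/ltW -> ->].
Qed.

(** On the dyadic interval between [e / 2] and [e] the integrand is at least
    its value at [e]. *)
Lemma tail_integral_dyadic e0 J t : 0 < e0 -> e0 <= b -> t <= e0 / 2 ^+ J / 2 ->
  \sum_(0 <= j < J.+1) (e0 / 2 ^+ j / 2) * F (e0 / 2 ^+ j) <= tail_integral t.
Proof.
move=> e00 e0b; elim: J t => [|J IH] t te.
  rewrite big_nat1 expr0 divr1 in te *.
  apply: le_trans (tail_integral_step (e := e0) _ _) => //; last by lra.
  have /andP[F0 _] := F0K e0; have := tail_integral_ge0 e0.
  suff : e0 / 2 * F e0 <= (e0 - t) * F e0 by lra.
  by rewrite ler_wpM2r//; lra.
rewrite big_nat_recr //=; set e := e0 / 2 ^+ J.+1 in te *.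
have e_gt0 : 0 < e by rewrite divr_gt0// exprn_gt0.
have eE : e = e0 / 2 ^+ J / 2 by rewrite /e exprS; field.
have eb : e <= b.
  apply: le_trans e0b; rewrite /e ler_pdivrMr ?exprn_gt0// ler_peMr ?(ltW e00)//.
  by rewrite exprn_ege1//; lra.
have te' : t <= e by lra.
apply: le_trans (tail_integral_step te' eb).
have := IH e; rewrite eE lexx -eE => /(_ isT).
have /andP[F0 _] := F0K e.
have : e / 2 * F e <= (e - t) * F e by rewrite ler_wpM2r//; lra.
by lra.
Qed.

End EntropyIntegral.

(** * Chaining *)

Section EmpiricalLaw.
Context {R : realType} {U : finType}.
Variables (k n : nat) (u : nat -> U).

Lemma empirical_ge0 w : 0 <= @empirical R U k n u w.
Proof. by rewrite mulr_ge0 ?invr_ge0// sumr_ge0. Qed.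

Lemma empirical_sum : \sum_w @empirical R U k n u w = 1.
Proof.
rewrite /empirical -mulr_sumr exchange_big /= (eq_bigr (fun=> 1)).
  by rewrite sumr_const_nat subn0 addn1 mulVf// pnatr_eq0.
move=> i _; rewrite -[RHS](sum_delta (fun=> 1) (block k (shiftn i u))).
by apply: eq_bigr => w _; rewrite mul1r.
Qed.

End EmpiricalLaw.

Section BlockMetric.
Context {R : realType} {U : finType}.
Variables (d : U -> U -> R) (M : R) (k : nat).
Hypotheses (d_refl : forall a, d a a = 0) (dC : forall a b, d a b = d b a)
  (dT : forall a b c, d a c <= d a b + d b c) (dM : forall a b, 0 <= d a b <= M).

Definition block_metric (x x' : k.-tuple U) : R := k%:R^-1 * cost_block d x x'.

Lemma block_metric_refl x : block_metric x x = 0.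
Proof.
rewrite /block_metric /cost_block big1 ?mulr0// => i _; exact: d_refl.
Qed.

Lemma block_metricC x y : block_metric x y = block_metric y x.
Proof.
by rewrite /block_metric; congr (_ * _); apply: eq_bigr => i _; rewrite dC.
Qed.

Lemma block_metricT x y z : block_metric x z <= block_metric x y + block_metric y z.
Proof.
rewrite -mulrDr ler_wpM2l ?invr_ge0// -big_split /=.
by apply: ler_sum => i _.
Qed.

Lemma block_metric_ge0 x y : 0 <= block_metric x y.
Proof.
rewrite mulr_ge0 ?invr_ge0// sumr_ge0// => i _.
by have /andP[] := dM (tnth x i) (tnth y i).
Qed.

Lemma block_metric_le x y : (0 < k)%N -> block_metric x y <= M.
Proof.
move=> k0; rewrite /block_metric ler_pdivrMl ?ltr0n//.
rewrite /cost_block -[k in k%:R]card_ord mulr_natl -sumr_const.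
by apply: ler_sum => i _; have /andP[] := dM (tnth x i) (tnth y i).
Qed.

End BlockMetric.

Section Chaining.
Context {R : realType} {U : pointedFinType}.
Variable gam : probability (seqspace U) R.

(** Cauchy-Schwarz over the net and over the probability space at once, through
    |x| <= (x^2 a / r + r / a) / 2 with the optimal weight. *)
Lemma Ex_l1 N (S : finType) (A : {set S}) (sg : (nat -> U) -> S -> R) V :
  0 < V -> (0 < #|A|)%N -> (forall u a, a \notin A -> sg u a = 0) ->
  Ex gam N (fun u => \sum_a sg u a ^+ 2) <= V ->
  Ex gam N (fun u => \sum_a `|sg u a|) <= Num.sqrt (#|A|%:R * V).
Proof.
move=> V0 A0 sgA EV; have aR : 0 < #|A|%:R :> R by rewrite ltr0n.
set r := Num.sqrt _; have r0 : 0 < r by rewrite sqrtr_gt0 mulr_gt0.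
have r2 : r ^+ 2 = #|A|%:R * V by rewrite sqr_sqrtr// mulr_ge0// ltW.
set a := #|A|%:R in aR r2.
(* the difference of the two sides is a square *)
have amgm x : `|x| <= (a / r / 2) * x ^+ 2 + r / a / 2.
  rewrite -real_normK ?num_real//; set y := `|x|.
  have -> : (a / r / 2) * y ^+ 2 + r / a / 2 = y + (a * y - r) ^+ 2 / (2 * a * r).
    by field; rewrite !gt_eqF.
  by rewrite lerDl divr_ge0 ?sqr_ge0// !mulr_ge0// ltW.
apply: (@le_trans _ _ (Ex gam N (fun u => (a / r / 2) * (\sum_s sg u s ^+ 2) + r / 2))).
  apply: Ex_le => u.
  rewrite (bigID (fun s => s \in A)) /= [X in _ + X]big1 ?addr0; last first.
    by move=> s sA; rewrite sgA// normr0.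
  apply: (@le_trans _ _ (\sum_(s in A) ((a / r / 2) * sg u s ^+ 2 + r / a / 2))).
    by apply: ler_sum => s _; exact: amgm.
  rewrite big_split /= -mulr_sumr sumr_const; apply: lerD.
    rewrite ler_wpM2l ?divr_ge0 ?(ltW aR) ?(ltW r0)//.
    rewrite [leRHS](bigID (fun s => s \in A)) /= lerDl sumr_ge0// => s _.
    exact: sqr_ge0.
  rewrite -[leLHS]mulr_natr -/a.
  by have -> : r / a / 2 * a = r / 2 by field; rewrite gt_eqF.
rewrite ExD ExZ Ex_cst.
have : (a / r / 2) * Ex gam N (fun u => \sum_s sg u s ^+ 2) <= (a / r / 2) * V.
  by rewrite ler_wpM2l// !divr_ge0// ltW.
have -> : (a / r / 2) * V = r / 2.
  have -> : V = r ^+ 2 / a by rewrite r2 mulrAC mulfV ?mul1r// gt_eqF.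
  by field; rewrite !gt_eqF.
by lra.
Qed.

Variables (k n : nat) (D : k.-tuple U -> k.-tuple U -> R) (M V e0 : R).
Hypotheses (D_refl : forall x, D x x = 0) (DC : forall x y, D x y = D y x)
  (DT : forall x y z, D x z <= D x y + D y z) (DM : forall x y, D x y <= M).
Hypotheses (V0 : 0 < V) (e00 : 0 < e0) (M0 : 0 <= M).

Notation T := (k.-tuple U).
Notation law := (block_law gam (k := k)).
Notation emp u := (@empirical R U k n u).

Definition deviation (q : T -> T) (u : nat -> U) (a : T) : R :=
  push q (emp u) a - push q law a.

Hypothesis V_bound : forall q : T -> T,
  (forall w w', q w = q w' -> D w w' <= 4 * e0) ->
  Ex gam n (fun u => \sum_a deviation q u a ^+ 2) <= V.

Let e j : R := e0 / 2 ^+ j.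

Variables (A : nat -> {set T}) (pi : nat -> T -> T) (x0 : T).
Hypotheses (piA : forall j w, pi j w \in A j) (pie : forall j w, D w (pi j w) <= e j).

Let e_gt0 j : 0 < e j. Proof. by rewrite divr_gt0// exprn_gt0. Qed.

Let e_le j : e j <= e0.
Proof. by rewrite ler_pdivrMr ?exprn_gt0// ler_peMr ?(ltW e00)// exprn_ege1//; lra. Qed.

Let eS j : e j = 2 * e j.+1.
Proof. by rewrite /e exprS; field. Qed.

(** Mass is moved to finer nets first; what remains unmatched on the coarsest
    net travels at most [M]. *)
Fixpoint chain_list (j : nat) : seq ((T -> T) * R) :=
  (pi j, e j) :: if j is i.+1 then chain_list i else [:: (fun=> x0, M)].

Lemma chain_list_dist j i s : (i < size (chain_list j))%N ->
  D s ((nth (id, 0) (chain_list j) i).1 s) <= (nth (id, 0) (chain_list j) i).2.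
Proof.
elim: j i => [|j IH] [|i] //=; try by move=> _; exact: pie.
  by case: i => // _; exact: DM.
by rewrite ltnS; exact: IH.
Qed.

Lemma chain_list_push j (sg : T -> R) s : \sum_a sg a = 0 ->
  chain_push (chain_list j) sg s = 0.
Proof.
elim: j sg => [|j IH] sg sg0 /=; last by apply: IH; rewrite sum_push.
rewrite [LHS]/push; have [xs|xs] := eqVneq x0 s; last by rewrite big_pred0.
by rewrite sum_push.
Qed.

Definition chain_total (j : nat) : R :=
  M * Num.sqrt (#|A 0%N|%:R * V) +
  \sum_(0 <= i < j) e i * Num.sqrt (#|A i.+1|%:R * V).

Lemma push_deviation (f q : T -> T) u :
  push f (deviation q u) = deviation (f \o q) u.
Proof.
rewrite /deviation push_sub; apply/funext => a.
by rewrite !push_comp.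
Qed.

Lemma deviation_outside j (q : T -> T) u a : a \notin A j ->
  deviation (pi j \o q) u a = 0.
Proof.
move=> aA; rewrite /deviation /push !big_pred0 ?subrr// => w;
  by apply/eqP => wa; move: aA; rewrite -wa piA.
Qed.

Lemma Ex_deviation j (q : T -> T) : (forall w, D w (q w) <= e j) ->
  Ex gam n (fun u => \sum_a `|deviation (pi j \o q) u a|) <=
  Num.sqrt (#|A j|%:R * V).
Proof.
move=> qe; apply: Ex_l1 => //.
- by apply/card_gt0P; exists (pi j x0).
- by move=> u a; exact: deviation_outside.
apply: V_bound => w w' /= qw.
have h v : D v (pi j (q v)) <= 2 * e0.
  apply: le_trans (DT v (q v) _) _.
  by have := qe v; have := pie j (q v); have := e_le j; lra.
apply: le_trans (DT w (pi j (q w)) w') _.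
by rewrite [X in _ + X]DC {2}qw; have := h w; have := h w'; lra.
Qed.

(** The projections made before reaching scale [j] have moved a point by at most
    the sum of the finer scales, which is [e j]; this keeps the cells small
    enough for the variance bound at every level. *)
Lemma Ex_chain_cost j (q : T -> T) : (forall w, D w (q w) <= e j) ->
  Ex gam n (fun u => chain_cost (chain_list j) (deviation q u)) <=
  e j * Ex gam n (fun u => \sum_a `|deviation q u a|) + chain_total j.
Proof.
elim: j q => [|j IH] q qe.
  rewrite /chain_total big_geq// addr0 /=.
  under [X in Ex _ _ X]eq_fun do rewrite push_deviation addr0.
  by rewrite ExD !ExZ lerD2l ler_wpM2l//; exact: Ex_deviation.
rewrite /=; under [X in Ex _ _ X]eq_fun do rewrite push_deviation.
rewrite ExD ExZ lerD2l.
have q'e w : D w ((pi j.+1 \o q) w) <= e j.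
  rewrite /= (le_trans (DT w (q w) _))// eS.
  by have := qe w; have := pie j.+1 (q w); lra.
apply: le_trans (IH _ q'e) _.
rewrite /chain_total [in leRHS]big_nat_recr //= [leRHS]addrA [leLHS]addrC lerD2l.
by rewrite ler_wpM2l ?(ltW (e_gt0 j))//; exact: Ex_deviation.
Qed.

Lemma Ex_transport_chain J :
  Ex gam n (fun u => transport D (emp u) law) <= 2 * e J + chain_total J.
Proof.
have D0 x y : 0 <= D x y.
  by have := DT x y x; rewrite D_refl [D y x]DC; lra.
have law0 w : 0 <= law w by exact: block_law_ge0.
apply: (@le_trans _ _ (Ex gam n (fun u => chain_cost (chain_list J) (deviation id u)))).
  apply: Ex_le => u; apply: transport_le => //.
  have -> : deviation id u = fun s => emp u s - law s.
    by apply/funext => s; rewrite /deviation !push_id.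
  apply: within_chain => //.
  - by move=> s; exact: empirical_ge0.
  - by move=> i s; exact: chain_list_dist.
  - by move=> s; apply: chain_list_push; rewrite sumrB empirical_sum block_law_sum subrr.
apply: le_trans (Ex_chain_cost _) _; first by move=> w; rewrite D_refl ltW.
rewrite lerD2r mulrC ler_wpM2r ?(ltW (e_gt0 J))//.
rewrite -[leRHS](Ex_cst gam n); apply: Ex_le => u.
apply: (@le_trans _ _ (\sum_a (emp u a + law a))).
  apply: ler_sum => a _; rewrite /deviation !push_id.
  apply: le_trans (ler_normB _ _) _.
  by rewrite !ger0_norm// empirical_ge0.
by rewrite big_split /= empirical_sum block_law_sum.
Qed.

Lemma chain_total_le J :
  chain_total J <= Num.sqrt V * (4 + 2 * M / e0) *
    \sum_(0 <= j < J.+1) (e j / 2) * Num.sqrt #|A j|%:R.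
Proof.
have s0 j : 0 <= Num.sqrt #|A j|%:R :> R by exact: sqrtr_ge0.
have v0 : 0 <= Num.sqrt V by exact: sqrtr_ge0.
have sE j : Num.sqrt (#|A j|%:R * V) = Num.sqrt V * Num.sqrt #|A j|%:R.
  by rewrite sqrtrM// mulrC.
have c4 : 0 <= 2 * M / e0 by rewrite divr_ge0 ?mulr_ge0// ltW.
elim: J => [|J IH].
  rewrite /chain_total big_geq// addr0 big_nat1 sE /e expr0 divr1.
  rewrite mulrCA [leRHS](_ : _ = Num.sqrt V * ((4 + 2 * M / e0) * (e0 / 2) *
    Num.sqrt #|A 0%N|%:R)); last by ring.
  rewrite ler_wpM2l// ler_wpM2r//.
  have -> : (4 + 2 * M / e0) * (e0 / 2) = 2 * e0 + M by field; rewrite gt_eqF.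
  by rewrite lerDr mulr_ge0// ltW.
rewrite /chain_total big_nat_recr //= addrA big_nat_recr //= mulrDr lerD//.
rewrite sE mulrCA [leRHS](_ : _ = Num.sqrt V * ((4 + 2 * M / e0) * (e J.+1 / 2) *
  Num.sqrt #|A J.+1|%:R)); last by ring.
rewrite ler_wpM2l// ler_wpM2r//.
rewrite eS (_ : 2 * e J.+1 = 4 * (e J.+1 / 2)); last by field.
by apply: ler_wpM2r; [rewrite divr_ge0// ltW|rewrite lerDl].
Qed.

End Chaining.

(** * Convergence of the empirical block law *)

Lemma dyadic_scale (R : realType) (e t : R) : 0 < t -> 2 * t <= e ->
  exists J, 2 * t <= e / 2 ^+ J < 4 * t.
Proof.
move=> t0 te; have e0 : 0 < e by lra.
have ex : exists j, e / 2 ^+ j < 2 * t.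
  have et0 : 0 <= e / (2 * t) by rewrite divr_ge0 ?ltW// mulr_gt0.
  exists (Num.truncn (e / (2 * t))).+1; rewrite ltr_pdivrMr ?exprn_gt0//.
  rewrite mulrC -ltr_pdivrMr ?mulr_gt0//.
  apply: lt_le_trans (truncnS_gt _) _.
  by rewrite -natrX ler_nat ltnW// ltn_expl.
case: (ex_minnP ex) => -[|j] ej jmin; first by move: ej; rewrite expr0 divr1; lra.
exists j; apply/andP; split.
  by rewrite leNgt; apply/negP => /jmin; rewrite ltnn.
have : e / 2 ^+ j = 2 * (e / 2 ^+ j.+1) by rewrite exprS; field.
by move=> ->; lra.
Qed.

Section OneSource.
Context {R : realType} {U : pointedFinType}.
Variable gam : probability (seqspace U) R.
Hypothesis st : stationary gam.
Variables (d : U -> U -> R) (M : R).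
Hypotheses (d_refl : forall a, d a a = 0) (dC : forall a b, d a b = d b a)
  (dT : forall a b c, d a c <= d a b + d b c) (dM : forall a b, 0 <= d a b <= M).

Notation law k := (block_law gam (k := k)).
Notation dk k := (block_metric d (k := k)).

Definition mixing_sum (n : nat) : R :=
  (n ^ 2)%:R^-1 * \sum_(0 <= l < n.+1) (n - l + 1)%:R * Num.sqrt (phi_mixing gam l).

Definition sqrt_covering (k : nat) (e : R) : R :=
  Num.sqrt (covering_number (dk k) e)%:R.

Definition expected_transport k n : R :=
  Ex gam n (fun u => transport (dk k) (empirical k n u) (law k)).

Lemma entropy_termE t k n : entropy_term (phi_mixing gam) d M t k n =
  Num.sqrt (mixing_sum n) * tail_integral (sqrt_covering k) (M / 4) t.
Proof. by []. Qed.

Lemma sqrt_covering_anti k x y : x <= y -> sqrt_covering k y <= sqrt_covering k x.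
Proof. by move=> xy; rewrite ler_wsqrtr// ler_nat covering_number_anti. Qed.

Lemma sqrt_covering_bound k x : 0 <= sqrt_covering k x <= Num.sqrt #|{:k.-tuple U}|%:R.
Proof. by rewrite sqrtr_ge0 ler_wsqrtr// ler_nat covering_number_card. Qed.

Lemma sqrt_covering_ge1 k x : 1 <= sqrt_covering k x.
Proof.
rewrite -sqrtr1 ler_wsqrtr// (_ : 1 = 1%:R)// ler_nat covering_number_gt0//.
by apply/card_gt0P; exists [tuple of nseq k point].
Qed.

Lemma tail_covering_ge0 k b t : 0 <= tail_integral (sqrt_covering k) b t.
Proof. exact: tail_integral_ge0 (sqrt_covering_bound k) _. Qed.

Lemma entropy_term_ge0 t k n : 0 <= entropy_term (phi_mixing gam) d M t k n.
Proof. by rewrite entropy_termE mulr_ge0 ?sqrtr_ge0// tail_covering_ge0. Qed.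

Lemma expected_transport_le k n : (0 < k)%N -> expected_transport k n <= M.
Proof.
move=> k0; rewrite -[leRHS](Ex_cst gam n); apply: Ex_le => u.
apply: transport_le => [x y|]; first exact: block_metric_ge0 dM _ _.
apply: within_bounded => [x y|w|w||].
- exact: block_metric_le dM _ _ k0.
- exact: empirical_ge0.
- exact: block_law_ge0.
- exact: empirical_sum.
- exact: block_law_sum.
Qed.

Lemma mixing_sum_ge n : (0 < n)%N -> n%:R^-1 <= mixing_sum n.
Proof.
move=> n0; rewrite /mixing_sum natrX ler_pdivlMl ?exprn_gt0 ?ltr0n//.
rewrite expr2 -mulrA mulfV ?mulr1 ?pnatr_eq0 -?lt0n//.
rewrite big_ltn// subn0 /= sqrtr1 mulr1 natrD -addrA lerDl addr_ge0//.
by rewrite sumr_ge0// => l _; rewrite mulr_ge0// sqrtr_ge0.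
Qed.

Lemma mixing_sum_ge_half n eta : (0 < n)%N ->
  (forall j, eta <= phi_mixing gam j) -> Num.sqrt eta / 2 <= mixing_sum n.
Proof.
move=> n0 heta; rewrite /mixing_sum natrX ler_pdivlMl ?exprn_gt0 ?ltr0n//.
apply: (@le_trans _ _ (\sum_(0 <= l < n.+1) (n - l + 1)%:R * Num.sqrt eta)); last first.
  by apply: ler_sum => l _; rewrite ler_wpM2l// ler_wsqrtr.
rewrite -sum_cumulated mulrCA.
rewrite (eq_bigr (fun i => Num.sqrt eta * i.+1%:R)); last first.
  by move=> i _; rewrite sumr_const_nat subn0 mulr_natr.
rewrite -mulr_sumr ler_wpM2l ?sqrtr_ge0//.
rewrite ler_pdivrMr// [leRHS]mulrC.
elim: n n0 => // n IH _; rewrite big_nat_recr //=.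
have [->|n0] := posnP n; first by rewrite big_nat1 expr1n; lra.
have := IH n0; rewrite -(natr1 n.+1) -(natr1 n) => h.
have : 0 <= n%:R :> R by [].
by rewrite sqrrD expr1n mulr1 mulrDr; lra.
Qed.

(** The mixing sum is then bounded below, so that [t] plus the entropy term is at
    least a multiple of [M]. *)
Lemma slow_mixing_case eta : 0 < eta -> (forall j, eta <= phi_mixing gam j) ->
  exists2 C, 0 <= C & forall n k t, (1 <= k <= n)%N -> 0 < t <= M / 4 ->
    expected_transport k n <= C * (t + entropy_term (phi_mixing gam) d M t k n).
Proof.
move=> eta0 heta; pose ka := Num.sqrt (Num.sqrt eta / 2).
have s0 : 0 < Num.sqrt eta by rewrite sqrtr_gt0.
have ka0 : 0 < ka by rewrite sqrtr_gt0 divr_gt0.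
have ka1 : ka <= 1.
  rewrite -sqrtr1 ler_wsqrtr//.
  have : Num.sqrt eta <= 1.
    by rewrite -sqrtr1 ler_wsqrtr// (le_trans (heta 0%N))// phi_mixing_le1.
  by lra.
exists (4 / ka) => [|n k t /andP[k1 kn] /andP[t0 tM]]; first by rewrite divr_ge0// ltW.
apply: le_trans (expected_transport_le n k1) _.
have n0 : (0 < n)%N := leq_trans k1 kn.
have h1 : ka <= Num.sqrt (mixing_sum n) by rewrite ler_wsqrtr// mixing_sum_ge_half.
have h2 : M / 4 - t <= tail_integral (sqrt_covering k) (M / 4) t.
  apply: le_trans (tail_integral_step (@sqrt_covering_anti k) (sqrt_covering_bound k) tM (lexx _)).
  rewrite -[leLHS]addr0 lerD ?tail_covering_ge0//.
  by rewrite ler_peMr ?sqrt_covering_ge1// subr_ge0.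
have h3 : ka * (M / 4 - t) <= entropy_term (phi_mixing gam) d M t k n.
  by rewrite entropy_termE ler_pM// ?subr_ge0// ltW.
have h4 : ka * (M / 4) <= t + entropy_term (phi_mixing gam) d M t k n.
  have : ka * t <= t by rewrite ler_piMl// ltW.
  by lra.
rewrite [leLHS](_ : M = 4 / ka * (ka * (M / 4))); last by field; rewrite gt_eqF.
by rewrite ler_wpM2l// divr_ge0// ltW.
Qed.

(** Almost surely all letters are at distance zero from [a], so that even the
    independent coupling is free. *)
Lemma degenerate_case a : pr gam [set u | d a (u 0%N) = 0] = 1 ->
  forall n k, (k <= n)%N -> expected_transport k n <= 0.
Proof.
move=> a1 n k kn.
have lawN w : law k w != 0 -> forall i, d a (tnth w i) = 0.
  move=> w0 i; apply/eqP; apply: contraNT w0 => wi.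
  rewrite eq_le block_law_ge0 andbT.
  have dw : determined k [set u | block k u = w] := @determined_block _ _ [set w].
  have -> : law k w = Ex gam k (fun u => `[< block k u = w >]%:R).
    by rewrite -[LHS]/(pr gam [set u | block k u = w]) -(Ex_pr gam dw).
  have dc : determined 1 [set u : nat -> U | d a (u 0%N) = 0].
    by move=> u v uv /=; rewrite uv.
  have dep : depends 1 (fun u : nat -> U => `[< d a (u 0%N) = 0 >]%:R : R).
    by move=> u v uv; rewrite uv.
  have E : Ex gam k (fun u => `[< d a (u i) = 0 >]%:R) = 1.
    rewrite -[RHS]a1 -(Ex_pr gam dc) -(@Ex_shift _ _ _ i 1 _ k st dep).
      by apply: eq_Ex => u /=; rewrite /shiftn addn0.
    by rewrite addn1.
  apply: (@le_trans _ _ (Ex gam k (fun u => 1 - `[< d a (u i) = 0 >]%:R))); last first.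
    by rewrite ExB Ex_cst E subrr.
  apply: Ex_le => u; case: asboolP => [uw|_]; case: asboolP => //= h; rewrite ?subrr ?subr0//.
  by move: wi; rewrite -uw tnth_mktuple h eqxx.
apply: (@le_trans _ _ (Ex gam n (fun u => \sum_p dk k p.1 p.2 *
    (empirical k n u p.1 * law k p.2)))).
  apply: Ex_le => u; apply: transport_le => [x y|]; first exact: block_metric_ge0 dM _ _.
  exists (fun p => empirical k n u p.1 * law k p.2) => //.
  apply: product_coupling => [w|w||].
  - exact: empirical_ge0.
  - exact: block_law_ge0.
  - exact: empirical_sum.
  - exact: block_law_sum.
rewrite Ex_sum big1// => -[w w'] _ /=.
have Ee : Ex gam n (fun u => empirical k n u w) = law k w.
  transitivity (Ex gam n (fun u => (n - k).+1%:R^-1 *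
      \sum_(0 <= i < (n - k).+1) (block k (shiftn i u) == w)%:R)).
    by apply: eq_Ex => u; rewrite -(@push_empirical R U _ k n id) push_id.
  rewrite ExZ Ex_sum big_nat (eq_bigr (fun=> law k w)).
    by rewrite -big_nat sumr_const_nat subn0 -[law k w *+ _]mulr_natr mulrC mulfK//.
  move=> i /andP[_ im]; have ikn : (i + k <= n)%N by lia.
  by rewrite -[RHS](congr1 (fun f => f w) (push_id (law k))) -(Ex_cell st id w ikn).
transitivity (dk k w w' * law k w' * Ex gam n (fun u => empirical k n u w)).
  by rewrite -ExZ; apply: eq_Ex => u; ring.
rewrite Ee.
have [->|w0] := eqVneq (law k w) 0; first by rewrite mulr0.
have [->|w'0] := eqVneq (law k w') 0; first by rewrite mulr0 mul0r.
suff -> : dk k w w' = 0 by rewrite !mul0r.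
rewrite /block_metric /cost_block big1 ?mulr0// => i _.
apply/eqP; rewrite eq_le; have /andP[-> _] := dM (tnth w i) (tnth w' i).
rewrite andbT; apply: le_trans (dT _ a _) _.
by rewrite [d _ a]dC (lawN w)// (lawN w')// addr0.
Qed.

Section Mixing.
Variables (g Q : nat) (rho dmin : R).
Hypotheses (class_rho : forall a,
  pr gam [set u | d a (u 0%N) = 0] + phi_mixing gam g.+1 <= rho) (rho0 : 0 <= rho)
  (tauQ : ((1 + rho) / 2) ^+ Q <= 4^-1) (Q0 : (0 < Q)%N)
  (dmin0 : 0 < dmin) (dminP : forall a b, d a b != 0 -> dmin <= d a b).

Let w := (g.+1 * Q)%N.

Let w0 : (0 < w)%N. Proof. by rewrite muln_gt0. Qed.

Let dge0 a b : 0 <= d a b. Proof. by have /andP[] := dM a b. Qed.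

(** Balls have exponentially small mass, so exponentially many are needed. *)
Lemma covering_number_exponential k e : 0 <= e <= dmin / w%:R ->
  2 ^+ (k %/ w) <= (covering_number (dk k) e)%:R :> R.
Proof.
move=> /andP[e0 ew].
have [A cA <-] := @exists_net R _ (dk k) e (block_metric_refl d_refl) e0.
have : 1 <= #|A|%:R * 2^-1 ^+ (k %/ w) :> R; last first.
  by rewrite exprVn ler_pdivlMr ?exprn_gt0// mul1r.
rewrite -[leLHS](Ex_cst gam (g.+1 + k)).
apply: (@le_trans _ _ (Ex gam (g.+1 + k) (fun u => \sum_(a in A)
   `[< dk k (block k (pad a)) (block k (shiftn g.+1 u)) <= dmin / w%:R >]%:R))).
  apply: Ex_le => u.
  have /forallP/(_ (block k (shiftn g.+1 u)))/existsP[a /andP[aA ua]] := cA.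
  rewrite (bigD1 a) //= asboolT; first by rewrite lerDl sumr_ge0.
  rewrite block_pad; apply: le_trans ew.
  by rewrite (block_metricC dC).
rewrite Ex_sum mulr_natl -sumr_const; apply: ler_sum => a _.
exact: (@small_ball _ _ _ d g rho class_rho Q dmin tauQ Q0 rho0 dmin0 dge0 dminP k g.+1 _ (fun=> pad a)).
Qed.

(** Coinciding cells at lag [l] mean that the block is close to its own shift,
    to which the small-ball bound applies while the two still overlap. When at
    least half of the n letters start a window, the squared normalizations
    differ by a factor of at most 4. *)
Lemma variance_bound k n e0 (q : k.-tuple U -> k.-tuple U) : (0 < k)%N -> (k <= n)%N ->
  (n <= 2 * (n - k).+1)%N -> 4 * e0 <= dmin / w%:R ->
  (forall x y, q x = q y -> dk k x y <= 4 * e0) ->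
  Ex gam n (fun u => \sum_a (push q (empirical k n u) a - push q (law k) a) ^+ 2)
  <= 8 * (2 * w + 1)%:R * mixing_sum n.
Proof.
move=> k0 kn nm e0w qe; have n0 := leq_trans k0 kn.
have law2 : 0 <= \sum_a push q (law k) a ^+ 2 by apply: sumr_ge0 => a _; exact: sqr_ge0.
apply: le_trans (empirical_variance st kn (lag_bound_ge0 gam g.+1 w k) _) _.
  move=> l; rewrite /lag_bound; case: (ltnP l g.+1) => [_|gl].
    exact: return_le1.
  case: (ltnP l k) => [lk|kl]; last exact: return_mixing.
  apply: (@le_trans _ _ (return_prob gam q l)); first by rewrite lerBlDr lerDl.
  apply: le_trans (@small_ball _ _ _ d g rho class_rho Q dmin tauQ Q0 rho0 dmin0 dge0
    dminP k l (l + k) id _ _ _) => //; last first.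
    by move=> j u v uv; apply: uv; lia.
  apply: Ex_le => u; case: eqP => // qq; rewrite asboolT//.
  exact: le_trans (qe _ _ qq) e0w.
set m := (n - k).+1 in nm *; set S := \sum_(0 <= i < m) _.
have mn : (m <= n.+1)%N by rewrite /m ltnS leq_subr.
have SP : S <= (2 * w + 1)%:R * ((n ^ 2)%:R * mixing_sum n).
  rewrite /mixing_sum mulVKf; last by rewrite pnatr_eq0 expn_eq0 negb_and -lt0n n0.
  rewrite -sum_cumulated (@big_cat_nat _ _ _ m _ _ _ _ _ mn) //= mulrDr.
  rewrite -[leLHS]addr0 lerD//; last first.
    by rewrite mulr_ge0// sumr_ge0// => i _; rewrite sumr_ge0// => l _; exact: sqrtr_ge0.
  rewrite mulr_sumr; apply: ler_sum => i _; apply: sum_lag_bound => //.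
  by rewrite /w leq_pmulr.
have mR : 0 < m%:R :> R by rewrite ltr0n.
apply: (@le_trans _ _ (2 * m%:R^-2 * ((2 * w + 1)%:R * ((n ^ 2)%:R * mixing_sum n)))).
  by rewrite ler_wpM2l// mulr_ge0// invr_ge0 exprn_ge0.
have ms0 : 0 <= mixing_sum n.
  by apply: le_trans (mixing_sum_ge n0); rewrite invr_ge0.
have nm2 : (n ^ 2)%:R * m%:R^-2 <= 4 :> R.
  rewrite ler_pdivrMr ?exprn_gt0// natrX (_ : 4 * m%:R ^+ 2 = (2 * m%:R) ^+ 2); last by ring.
  by rewrite lerXn2r ?nnegrE ?mulr_ge0// -natrM ler_nat.
rewrite [leLHS](_ : _ = 2 * (2 * w + 1)%:R * mixing_sum n *
  ((n ^ 2)%:R * m%:R^-2)); last by ring.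
rewrite [leRHS](_ : _ = 2 * (2 * w + 1)%:R * mixing_sum n * 4); last by ring.
by apply: ler_wpM2l nm2; apply: mulr_ge0 => //; apply: mulr_ge0.
Qed.

(** Three regimes: [t] above the scale [e0], where the trivial bound [M] is of
    the order of [t]; more than half of the word in one block, where the
    covering number at scale [e0] compensates for the small mixing sum; and
    otherwise chaining from [e0] down to the order of [t]. *)
Lemma fast_mixing_case : 0 < M ->
  exists2 C, 0 <= C & forall n k t, (1 <= k <= n)%N -> 0 < t <= M / 4 ->
    expected_transport k n <= C * (t + entropy_term (phi_mixing gam) d M t k n).
Proof.
move=> M0; pose e0 := Num.min (dmin / w%:R / 4) (M / 4).
(* cells of diameter [4 * e0] are within the radius of the small-ball bound *)
have wR : 0 < w%:R :> R by rewrite ltr0n.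
have e00 : 0 < e0 by rewrite lt_min !divr_gt0.
have e0w : 4 * e0 <= dmin / w%:R.
  by rewrite mulrC -ler_pdivlMr// ge_min lexx.
have e0M : e0 <= M / 4 by rewrite ge_min lexx orbT.
(* one constant for each of the three regimes *)
pose c1 := 2 * M / e0; pose c2 := M * (2 * Num.sqrt (2 * w%:R)) / e0.
pose sv := Num.sqrt (8 * (2 * w + 1)%:R) : R.
pose c3 := sv * (4 + 2 * M / e0).
have c10 : 0 <= c1 by rewrite divr_ge0 ?mulr_ge0// ltW.
have c20 : 0 <= c2 by rewrite divr_ge0 ?mulr_ge0 ?sqrtr_ge0// ltW.
have c30 : 0 <= c3 by rewrite mulr_ge0 ?sqrtr_ge0// addr_ge0.
exists (c1 + c2 + (8 + c3)) => [|n k t /andP[k1 kn] /andP[t0 tM]].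
  by rewrite !addr_ge0.
have n0 := leq_trans k1 kn.
have en0 := entropy_term_ge0 t k n; set en := entropy_term _ _ _ _ _ _ in en0 *.
have big c : 0 <= c -> c <= c1 + c2 + (8 + c3) ->
    forall x, 0 <= x <= t + en -> c * x <= (c1 + c2 + (8 + c3)) * (t + en).
  by move=> c0 cC x /andP[x0 xt]; apply: ler_pM.
have [te|te] := leP (e0 / 2) t.
  apply: le_trans (expected_transport_le n k1) _.
  apply: (@le_trans _ _ (c1 * t)); last by apply: big; lra.
  rewrite /c1 mulrAC ler_pdivlMr// (_ : 2 * M * t = M * (2 * t)); last by ring.
  by rewrite ler_wpM2l ?(ltW M0)//; lra.
have int_e0 : e0 / 2 * sqrt_covering k e0 <= tail_integral (sqrt_covering k) (M / 4) t.
  have := @tail_integral_dyadic R (sqrt_covering k) _ (M / 4) (@sqrt_covering_anti k)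
    (sqrt_covering_bound k) e0 0 t e00 e0M.
  by rewrite expr0 divr1 big_nat1 expr0 divr1; apply; exact: ltW.
have e0w' : 0 <= e0 <= dmin / w%:R by rewrite ltW//=; lra.
have [nm|nm] := leqP n (2 * (n - k).+1); last first.
  apply: le_trans (expected_transport_le n k1) _.
  apply: (@le_trans _ _ (c2 * en)); last by apply: big; lra.
  have cov : k%:R / w%:R <= (covering_number (dk k) e0)%:R :> R.
    apply: le_trans (covering_number_exponential k e0w').
    have := @block_length_le R k w w0; rewrite exprVn ler_pdivrMr ?exprn_gt0// => h.
    by rewrite ler_pdivrMr// mulrC.
  have nk : n%:R <= 2 * k%:R :> R.
    by rewrite -natrM ler_nat; clear -nm kn; lia.
  have enl : (Num.sqrt (2 * w%:R))^-1 * (e0 / 2) <= en.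
    have : Num.sqrt (n%:R^-1 * (k%:R / w%:R)) * (e0 / 2) <= en.
      rewrite /en entropy_termE sqrtrM ?invr_ge0// -mulrA.
      apply: ler_pM; rewrite ?mulr_ge0 ?sqrtr_ge0 ?divr_ge0 ?(ltW e00)//.
        by rewrite ler_wsqrtr// mixing_sum_ge.
      apply: le_trans int_e0; rewrite mulrC ler_wpM2l ?divr_ge0 ?(ltW e00)//.
      by rewrite ler_wsqrtr.
    apply: le_trans; rewrite ler_wpM2r ?divr_ge0 ?(ltW e00)//.
    rewrite -sqrtrV ?mulr_ge0//; rewrite ler_wsqrtr//.
    rewrite invfM mulrA ler_wpM2r ?invr_ge0 ?(ltW wR)//.
    by rewrite mulrC ler_pdivlMr ?ltr0n//; lra.
  have sw0 : 0 < Num.sqrt (2 * w%:R) :> R by rewrite sqrtr_gt0 mulr_gt0.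
  rewrite [leLHS](_ : M = c2 * ((Num.sqrt (2 * w%:R))^-1 * (e0 / 2))); last first.
    by rewrite /c2; field; rewrite !gt_eqF.
  by rewrite ler_wpM2l.
have [|J /andP[tJ Jt]] := @dyadic_scale R e0 t t0; first by lra.
pose e j : R := e0 / 2 ^+ j.
have eg j : 0 <= e j by rewrite divr_ge0 ?exprn_ge0 ?(ltW e00).
have /choice[A AP] : forall j, exists A : {set k.-tuple U},
    covers (dk k) A (e j) /\ #|A| = covering_number (dk k) (e j).
  by move=> j; have [A ? ?] := @exists_net R _ (dk k) _ (block_metric_refl d_refl) (eg j); exists A.
have /choice[pi0 piP] : forall jx : nat * k.-tuple U, exists a,
    a \in A jx.1 /\ dk k jx.2 a <= e jx.1.
  move=> [j x]; have [/forallP/(_ x)/existsP[a /andP[aA xa]] _] := AP j.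
  by exists a.
pose V := 8 * (2 * w + 1)%:R * mixing_sum n.
have ms0 : 0 < mixing_sum n.
  by apply: lt_le_trans (mixing_sum_ge n0); rewrite invr_gt0 ltr0n.
have w1R : 0 < (2 * w + 1)%:R :> R by rewrite ltr0n addn1.
have V0 : 0 < V by apply: mulr_gt0 ms0; apply: mulr_gt0 w1R.
have sV : Num.sqrt V = sv * Num.sqrt (mixing_sum n) by rewrite /V sqrtrM// mulr_ge0// ltW.
have chain := @Ex_transport_chain R U gam k n (dk k) M V e0
  (block_metric_refl d_refl) (block_metricC dC) (block_metricT dT)
  (fun x y => block_metric_le dM x y k1) V0 e00 (ltW M0)
  (fun q qe => variance_bound k1 kn nm e0w qe) A (fun j x => pi0 (j, x))
  [tuple of nseq k point] (fun j x => (piP (j, x)).1) (fun j x => (piP (j, x)).2) J.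
apply: le_trans chain _.
have tot := @chain_total_le R U k M V e0 e00 (ltW M0) A J.
have dy := @tail_integral_dyadic R (sqrt_covering k) _ (M / 4) (@sqrt_covering_anti k)
    (sqrt_covering_bound k) e0 J t e00 e0M.
have tot' : chain_total M V e0 A J <= c3 * en.
  apply: le_trans tot _.
  rewrite /c3 /en entropy_termE sV.
  rewrite [leRHS](_ : _ = sv * Num.sqrt (mixing_sum n) * (4 + 2 * M / e0) *
    tail_integral (sqrt_covering k) (M / 4) t); last by ring.
  rewrite ler_wpM2l ?mulr_ge0 ?sqrtr_ge0 ?addr_ge0//.
  apply: le_trans (dy _); last by lra.
  rewrite le_eqVlt; apply/orP; left; apply/eqP; apply: eq_bigr => j _.
  by rewrite /sqrt_covering; have [_ <-] := AP j.
have h1 : 0 <= c3 * t by rewrite mulr_ge0// ltW.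
have h2 : 0 <= (c1 + c2) * (t + en) by rewrite mulr_ge0 ?addr_ge0// ltW.
rewrite mulrDl; apply: (@le_trans _ _ (8 * t + c3 * en)); first by lra.
by rewrite !mulrDl !mulrDr in h2 *; lra.
Qed.

End Mixing.

(** Letters are classified up to distance zero. If no class has probability one,
    let [p] be the largest probability of a class: either all mixing
    coefficients are at least (1 - p) / 2, or one of them is smaller, and then
    a match has conditional probability at most (1 + p) / 2. *)
Theorem expected_transport_bound :
  exists2 C, 0 <= C & forall n k t, (1 <= k <= n)%N -> 0 < t <= M / 4 ->
    expected_transport k n <= C * (t + entropy_term (phi_mixing gam) d M t k n).
Proof.
have [M0|M0] := leP M 0.
  by exists 0 => // n k t _ /andP[t0 tM]; exfalso; lra.
pose cl a := pr gam [set u | d a (u 0%N) = 0].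
have mcl a : measurable ([set u | d a (u 0%N) = 0] : set (seqspace U)).
  by apply: (@measurable_determined _ 1) => u v uv /=; rewrite uv.
have cl1 a : cl a <= 1 by exact: pr_le1.
have [[a a1]|na] := pselect (exists a, cl a = 1).
  exists 0 => // n k t /andP[_ kn] _; rewrite mul0r; exact: degenerate_case a1 _ _ kn.
pose p := \big[Num.max/0]_a cl a.
have clp a : cl a <= p by rewrite /p (bigD1 a) //= le_max lexx.
have p0 : 0 <= p by apply: le_trans (clp point); exact: pr_ge0.
have p1 : p < 1.
  rewrite /p; elim/big_ind : _ => [|x y x1 y1|a _]; first exact: ltr01.
    by rewrite gt_max x1.
  by rewrite lt_neqAle cl1 andbT; apply/eqP => e; apply: na; exists a.
pose eta := (1 - p) / 2.
have eta0 : 0 < eta by rewrite divr_gt0// subr_gt0.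
have [hslow|/existsNP[j /negP]] := pselect (forall j, eta <= phi_mixing gam j).
  exact: slow_mixing_case eta0 hslow.
rewrite -ltNge; case: j => [|g] hg.
  by exfalso; move: hg; rewrite /= /eta; lra.
pose rho := (1 + p) / 2.
have class_rho a : cl a + phi_mixing gam g.+1 <= rho.
  by have := clp a; move: hg; rewrite /rho /eta; lra.
have rho0 : 0 <= rho by rewrite divr_ge0// addr_ge0.
(* sampling enough letters per block beats the factor 2 of each mismatch *)
have [Q [Q0 tauQ]] : exists Q, (0 < Q)%N /\ ((1 + rho) / 2) ^+ Q <= 4^-1.
  have tau0 : 0 <= (1 + rho) / 2 by rewrite divr_ge0// addr_ge0.
  have tau1 : `|(1 + rho) / 2| < 1 by rewrite ger0_norm// /rho; lra.
  have q0 : 0 < 4^-1 :> R by rewrite invr_gt0.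
  have [N _ HN] := cvgr_le _ (cvg_expr tau1) _ q0.
  by exists N.+1; split=> //; apply: HN => /=.
pose dmin := \big[Num.min/1]_(ab : U * U | d ab.1 ab.2 != 0) d ab.1 ab.2.
have dmin0 : 0 < dmin.
  rewrite /dmin; elim/big_ind : _ => [|x y x1 y1|[a b] /= ab]; first exact: ltr01.
    by rewrite lt_min x1.
  by rewrite lt_def ab; have /andP[] := dM a b.
have dminP a b : d a b != 0 -> dmin <= d a b.
  by move=> ab; rewrite /dmin (bigD1 (a, b)) //= ge_min lexx.
exact: fast_mixing_case class_rho rho0 tauQ Q0 dmin0 dminP M0.
Qed.

End OneSource.

(** * Convergence of the estimator *)

Section TransportStability.
Context {R : realType}.

Lemma within_scale (A B : finType) (c : A -> B -> R) al be r a : 0 <= a ->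
  within c al be r -> within (fun x y => a * c x y) al be (a * r).
Proof.
move=> a0 [q qc qr]; exists q => //.
rewrite (eq_bigr (fun p => a * (c p.1 p.2 * q p))); last by move=> p _; rewrite mulrA.
by rewrite -mulr_sumr ler_wpM2l.
Qed.

Lemma transportC (A : finType) (d : A -> A -> R) al be :
  (forall x y, d x y = d y x) -> transport d al be = transport d be al.
Proof.
move=> dC; rewrite /transport; congr inf.
have sw (a b : A -> R) : [set \sum_p d p.1 p.2 * q p | q in couplings a b] `<=`
    [set \sum_p d p.1 p.2 * q p | q in couplings b a].
  move=> _ [q [q0 qa qb] <-]; exists (fun p => q (p.2, p.1)); first by split.
  rewrite !sum_pair exchange_big /=; apply: eq_bigr => x _; apply: eq_bigr => y _.
  by rewrite dC.
by apply/seteqP; split; exact: sw.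
Qed.

Variables (X Y : finType) (c : X -> Y -> R) (k : nat).
Variables (dX : X -> X -> R) (dY : Y -> Y -> R).
Hypotheses (c0 : forall x y, 0 <= c x y) (k0 : (0 < k)%N)
  (dX0 : forall x x', 0 <= dX x x') (dY0 : forall y y', 0 <= dY y y')
  (dYC : forall y y', dY y y' = dY y' y)
  (cX : forall x x' y, c x y <= dX x x' + c x' y)
  (cY : forall x y y', c x y <= c x y' + dY y' y).

Notation DX := (block_metric dX (k := k)).
Notation DY := (block_metric dY (k := k)).
Notation ck := (cost_block c (k := k)).

(** The couplings of [al] with [al'] and of [be'] with [be] are glued to both
    sides of a coupling of [al'] and [be']. *)
Lemma transport_stable al al' be be' :
  (forall x, 0 <= al x) -> (forall x, 0 <= al' x) ->
  (forall y, 0 <= be y) -> (forall y, 0 <= be' y) ->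
  \sum_x al x = 1 -> \sum_x al' x = 1 -> \sum_y be y = 1 -> \sum_y be' y = 1 ->
  k%:R^-1 * transport ck al be <=
  k%:R^-1 * transport ck al' be' + transport DX al al' + transport DY be be'.
Proof.
move=> al0 al'0 be0 be'0 al1 al'1 be1 be'1.
have kR : 0 < k%:R :> R by rewrite ltr0n.
have ck0 x y : 0 <= ck x y by exact: sumr_ge0.
have Dge0 (T : finType) (d : T -> T -> R) : (forall x y, 0 <= d x y) ->
    forall x y : k.-tuple T, 0 <= block_metric d x y.
  by move=> dge0 x y; rewrite mulr_ge0 ?invr_ge0// sumr_ge0.
have DE (T : finType) (d : T -> T -> R) (x y : k.-tuple T) :
    k%:R * block_metric d x y = cost_block d x y.
  by rewrite mulVKf// gt_eqF.
have ex (S T : finType) (a : S -> R) (b : T -> R) :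
    (forall x, 0 <= a x) -> (forall x, 0 <= b x) ->
    \sum_x a x = 1 -> \sum_x b x = 1 -> exists q, couplings a b q.
  by move=> *; exists (fun p => a p.1 * b p.2); exact: product_coupling.
apply/ler_addgt0Pr => e e0.
(* one third of the slack for each of the three infima *)
pose e' := e / 3; have e'0 : 0 < e' by rewrite divr_gt0.
have w1 := within_scale (ler0n R k)
  (within_transport (Dge0 _ _ dX0) e'0 (ex _ _ _ _ al0 al'0 al1 al'1)).
have w2 := within_transport ck0 (mulr_gt0 kR e'0) (ex _ _ _ _ al'0 be'0 al'1 be'1).
have w3 := within_swap (within_scale (ler0n R k)
  (within_transport (Dge0 _ _ dY0) e'0 (ex _ _ _ _ be0 be'0 be1 be'1))).
have glX x x' y : ck x y <= k%:R * DX x x' + ck x' y.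
  by rewrite DE /cost_block -big_split /=; apply: ler_sum => i _.
have glY x y' y : ck x y <= ck x y' + k%:R * DY y y'.
  by rewrite DE /cost_block -big_split /=; apply: ler_sum => i _; rewrite dYC.
have w123 := within_glue glY (within_glue glX w1 w2) w3.
rewrite ler_pdivrMl//; apply: le_trans (transport_le ck0 w123) _.
rewrite le_eqVlt; apply/orP; left; apply/eqP.
have -> : e = 3 * e' by rewrite /e'; field.
by field; rewrite gt_eqF.
Qed.

End TransportStability.

Section AdaptedCosts.
Context {R : realType} {X Y : finType}.
Variable c : X -> Y -> R.
Hypothesis c0 : forall x y, 0 <= c x y.

Lemma cost_norm_ge x y : c x y <= cost_norm c.
Proof. by rewrite /cost_norm (bigD1 (x, y)) //= le_max lexx. Qed.

Lemma cost_norm_ge0 : 0 <= cost_norm c.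
Proof.
by rewrite /cost_norm; elim/big_ind : _ => // a b a0 b0; rewrite le_max a0.
Qed.

Lemma adapted_l_ge x x' y : `|c x y - c x' y| <= adapted_l c x x'.
Proof. by rewrite /adapted_l (bigD1 y) //= le_max lexx. Qed.

Lemma adapted_l_le x x' m : 0 <= m -> (forall y, `|c x y - c x' y| <= m) ->
  adapted_l c x x' <= m.
Proof.
move=> m0 hm; rewrite /adapted_l; elim/big_ind : _ => // a b am bm.
by rewrite ge_max am.
Qed.

Lemma adapted_l_bound x x' : 0 <= adapted_l c x x' <= cost_norm c.
Proof.
apply/andP; split.
  by rewrite /adapted_l; elim/big_ind : _ => // a b a0 b0; rewrite le_max a0.
apply: adapted_l_le; first exact: cost_norm_ge0.
move=> y; have := cost_norm_ge x y; have := cost_norm_ge x' y.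
by have := c0 x y; have := c0 x' y; rewrite ler_norml; lra.
Qed.

Lemma adapted_l_refl x : adapted_l c x x = 0.
Proof.
apply/eqP; rewrite eq_le; have /andP[-> _] := adapted_l_bound x x.
by rewrite andbT; apply: adapted_l_le => // y; rewrite subrr normr0.
Qed.

Lemma adapted_lC x x' : adapted_l c x x' = adapted_l c x' x.
Proof. by apply: eq_bigr => y _; rewrite distrC. Qed.

Lemma adapted_lT x x' x'' : adapted_l c x x'' <= adapted_l c x x' + adapted_l c x' x''.
Proof.
apply: adapted_l_le => [|y].
  by have /andP[? _] := adapted_l_bound x x'; have /andP[? _] := adapted_l_bound x' x'';
    rewrite addr_ge0.
apply: le_trans (ler_distD (c x' y) _ _) _.
by rewrite lerD// adapted_l_ge.
Qed.

Lemma cost_adapted_l x x' y : c x y <= adapted_l c x x' + c x' y.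
Proof.
by have := adapted_l_ge x x' y; rewrite ler_norml => /andP[_]; rewrite lerBlDr.
Qed.

End AdaptedCosts.

Lemma cost_norm_swap (R : realType) (X Y : finType) (c : X -> Y -> R) :
  (forall x y, 0 <= c x y) -> cost_norm (fun y x => c x y) = cost_norm c.
Proof.
move=> c0; apply/eqP; rewrite eq_le; apply/andP; split.
  rewrite {1}/cost_norm; elim/big_ind : _ => [|a b am bm|[y x] _ /=].
  - exact: cost_norm_ge0.
  - by rewrite ge_max am.
  - exact: cost_norm_ge.
rewrite {1}/cost_norm; elim/big_ind : _ => [|a b am bm|[x y] _ /=].
- exact: cost_norm_ge0.
- by rewrite ge_max am.
- exact: (cost_norm_ge (fun y x => c x y)).
Qed.

Lemma empirical_pad (R : realType) (U : pointedFinType) k n (u : nat -> U) :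
  (k <= n)%N -> @empirical R U k n u = empirical k n (pad (block n u)).
Proof.
move=> kn; apply/funext => w; rewrite /empirical; congr (_ * _).
rewrite !big_nat; apply: eq_bigr => i /andP[_ im].
congr (_%:R); congr nat_of_bool; congr (_ == _); apply/block_eqP => j jk.
by rewrite /shiftn pad_block//; lia.
Qed.

Lemma integral_finite_valued (R : realType) d (T : measurableType d)
    (P : probability T R) (I : finType) (f : T -> I) (F : I -> R) :
  (forall i, measurable (f @^-1` [set i])) -> (forall i, 0 <= F i) ->
  (\int[P]_w (F (f w))%:E = (\sum_i F i * pr P (f @^-1` [set i]))%:E)%E.
Proof.
move=> mf F0.
transitivity (\int[P]_w \sum_(i : I) (F i * \1_(f @^-1` [set i]) w)%:E)%E.
  apply: eq_integral => w _; rewrite sumEFin (bigD1 (f w)) //= big1 ?addr0.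
    by rewrite indicE mem_set// mulr1.
  by move=> i /eqP fi; rewrite indicE memNset ?mulr0// => /esym.
rewrite ge0_integral_sum//; last 2 first.
- move=> i; apply/measurable_EFinP; apply: measurable_funM; first exact: measurable_cst.
  exact: (measurable_indic (mf i)).
- by move=> i w _; rewrite lee_fin mulr_ge0.
rewrite -sumEFin; apply: eq_bigr => i _.
under eq_integral do rewrite EFinM.
rewrite ge0_integralZl//; last 2 first.
- by apply/measurable_EFinP; exact: (measurable_indic (mf i)).
- by rewrite lee_fin.
by rewrite integral_indic// setIT EFinM; congr (_ * _)%E; exact: prE.
Qed.

Theorem theorem5 (R : realType) (X Y : pointedFinType) (c : X -> Y -> R)
    (hc : forall x y, 0 <= c x y)
    (mu : probability (seqspace X) R) (nu : probability (seqspace Y) R)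
    (mu_st : stationary mu) (nu_st : stationary nu)
    (mu_erg : ergodic mu) (nu_erg : ergodic nu) :
  exists C : R,
    forall (d : measure_display) (Omega : measurableType d)
      (P : probability Omega R)
      (xs : {RV P >-> seqspace X}) (ys : {RV P >-> seqspace Y}),
    (forall A : set (seqspace X), measurable A -> distribution P xs A = mu A) ->
    (forall B : set (seqspace Y), measurable B -> distribution P ys B = nu B) ->
    forall (n k g : nat) (t : R),
      (1 <= n)%N -> (1 <= k <= n)%N -> 0 < t <= cost_norm c / 4 ->
      ('E_P[fun w => (`| S_hat c k n (xs w) (ys w) - joining_cost c mu nu |)%R] <=
        (cost_norm c *
           (k%:R * (phi_mixing mu g.+1 + phi_mixing nu g.+1) / (k + g)%:R
            + 3 * g%:R / k%:R)
         + C * (t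
                + entropy_term (phi_mixing mu) (adapted_l c) (cost_norm c) t k n
                + entropy_term (phi_mixing nu) (adapted_r c) (cost_norm c) t k n))
        %:E)%E.
Proof.
have hc' y x : 0 <= c x y by [].
have [CX CX0 HX] := expected_transport_bound mu_st (adapted_l_refl hc) (adapted_lC c)
  (adapted_lT hc) (adapted_l_bound hc).
have rM y y' : 0 <= adapted_r c y y' <= cost_norm c.
  by rewrite -(cost_norm_swap hc); exact: (adapted_l_bound hc').
have [CY CY0 HY] := @expected_transport_bound R Y nu nu_st (adapted_r c) (cost_norm c)
  (adapted_l_refl hc') (adapted_lC (fun y x => c x y)) (adapted_lT hc') rM.
exists (CX + CY) => d Omega P xs ys Dx Dy n k g t n1 /andP[k1 kn] ht.
have kkn : (1 <= k <= n)%N by rewrite k1.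
set B := cost_norm c * _; set u := entropy_term _ (adapted_l c) _ _ _ _.
set v := entropy_term _ (adapted_r c) _ _ _ _.
pose S := joining_cost c mu nu.
pose WX z := transport (block_metric (adapted_l c) (k := k)) (empirical k n z)
  (block_law mu (k := k)).
pose WY z := transport (block_metric (adapted_r c) (k := k)) (empirical k n z)
  (block_law nu (k := k)).
have cM x y : 0 <= c x y <= cost_norm c by rewrite hc cost_norm_ge.
have mu1 : \sum_w block_law mu (k := k) w = 1 := block_law_sum mu k.
have nu1 : \sum_w block_law nu (k := k) w = 1 := block_law_sum nu k.
have key a b : `|S_hat c k n a b - S| <= B + (WX a + WY b).
  have bias := joining_cost_bias cM mu_st nu_st g k1.
  rewrite -/S -/B in bias; set T := _ * transport _ _ _ in bias.
  have lX x x' : 0 <= adapted_l c x x' by have /andP[] := adapted_l_bound hc x x'.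
  have lY y y' : 0 <= adapted_r c y y' by have /andP[] := rM y y'.
  have lYC y y' : adapted_r c y y' = adapted_r c y' y :=
    adapted_lC (fun y x => c x y) y y'.
  have cY x y y' : c x y <= c x y' + adapted_r c y' y.
    by rewrite lYC addrC; exact: (cost_adapted_l (fun y x => c x y)).
  have stab al al' be be' := @transport_stable R X Y c k (adapted_l c) (adapted_r c)
    hc k1 lX lY lYC (cost_adapted_l c) cY al al' be be'.
  have h1 : S_hat c k n a b <= T + WX a + WY b.
    apply: stab => //; first [by move=> w; exact: empirical_ge0
      | by move=> w; exact: block_law_ge0 | exact: empirical_sum].
  have h2 : T <= S_hat c k n a b + WX a + WY b.
    have WXC : WX a = transport (block_metric (adapted_l c) (k := k))
        (block_law mu (k := k)) (empirical k n a).
      by apply: transportC => x y; apply: block_metricC; exact: adapted_lC.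
    have WYC : WY b = transport (block_metric (adapted_r c) (k := k))
        (block_law nu (k := k)) (empirical k n b).
      by apply: transportC => x y; apply: block_metricC; exact: lYC.
    rewrite WXC WYC.
    apply: stab => //; first [by move=> w; exact: empirical_ge0
      | by move=> w; exact: block_law_ge0 | exact: empirical_sum].
  apply: le_trans (ler_distD T _ _) _; rewrite addrC lerD//.
  by rewrite ler_norml; clear -h1 h2; lra.
have mx a : measurable (xs @^-1` [set z | block n z = a]).
  rewrite -[X in measurable X]setTI; apply: (measurable_funPT xs) => //.
  exact: (@measurable_block _ n [set a]).
have my b : measurable (ys @^-1` [set z | block n z = b]).
  rewrite -[X in measurable X]setTI; apply: (measurable_funPT ys) => //.
  exact: (@measurable_block _ n [set b]).
(* the error depends on the first [n] letters only: its mean is a finite sum *)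
pose f w := (block n (xs w), block n (ys w)).
have fE i : f @^-1` [set i] =
    xs @^-1` [set z | block n z = i.1] `&` ys @^-1` [set z | block n z = i.2].
  case: i => a b; apply/seteqP; split=> w /=; first by move=> [-> ->].
  by move=> [<- <-].
have mf i : measurable (f @^-1` [set i]) by rewrite fE; exact: measurableI.
have Px a : \sum_b pr P (f @^-1` [set (a, b)]) = block_law mu a.
  rewrite -[RHS]/(pr mu _) /pr -Dx; last exact: (@measurable_block _ n [set a]).
  rewrite -[RHS]/(pr P (xs @^-1` [set z | block n z = a])).
  rewrite (pr_total P (f := fun w => block n (ys w)) (mx a) my).
  by apply: eq_bigr => b _; rewrite fE.
have Py b : \sum_a pr P (f @^-1` [set (a, b)]) = block_law nu b.
  rewrite -[RHS]/(pr nu _) /pr -Dy; last exact: (@measurable_block _ n [set b]).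
  rewrite -[RHS]/(pr P (ys @^-1` [set z | block n z = b])).
  rewrite (pr_total P (f := fun w => block n (xs w)) (my b) mx).
  by apply: eq_bigr => a _; rewrite fE setIC.
rewrite unlock.
pose F (i : n.-tuple X * n.-tuple Y) := `|S_hat c k n (pad i.1) (pad i.2) - S|.
rewrite (_ : (\int[P]_w _)%E = (\int[P]_w (F (f w))%:E)%E); last first.
  apply: eq_integral => w _; congr (_%:E); rewrite /F /f /S_hat /=.
  by rewrite (empirical_pad R (xs w) kn) (empirical_pad R (ys w) kn).
rewrite integral_finite_valued//; last by move=> i; exact: normr_ge0.
rewrite lee_fin.
apply: (@le_trans _ _ (\sum_i (B + (WX (pad i.1) + WY (pad i.2))) * pr P (f @^-1` [set i]))).
  by apply: ler_sum => i _; rewrite ler_wpM2r ?pr_ge0//; exact: key.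
have EX : \sum_i WX (pad i.1) * pr P (f @^-1` [set i]) = expected_transport mu (adapted_l c) k n.
  by rewrite sum_pair; apply: eq_bigr => a _ /=; rewrite -mulr_sumr Px mulrC.
have EY : \sum_i WY (pad i.2) * pr P (f @^-1` [set i]) = expected_transport nu (adapted_r c) k n.
  by rewrite sum_pair exchange_big; apply: eq_bigr => b _ /=; rewrite -mulr_sumr Py mulrC.
have E1 : \sum_i pr P (f @^-1` [set i]) = 1.
  rewrite sum_pair (eq_bigr (fun a => block_law mu a)); last by move=> a _; exact: Px.
  exact: block_law_sum.
rewrite (eq_bigr (fun i => B * pr P (f @^-1` [set i]) + (WX (pad i.1) * pr P (f @^-1` [set i])
  + WY (pad i.2) * pr P (f @^-1` [set i])))); last by move=> i _; rewrite !mulrDl.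
rewrite big_split big_split /= -mulr_sumr E1 mulr1 EX EY lerD2l.
have {}HX := HX n k t kkn ht; have {}HY := HY n k t kkn ht.
apply: le_trans (lerD HX HY) _; rewrite -/u -/v.
have u0 : 0 <= u := entropy_term_ge0 _ _ _ _ _ _.
have v0 : 0 <= v := entropy_term_ge0 _ _ _ _ _ _.
have h1 : 0 <= CX * v by exact: mulr_ge0.
have h2 : 0 <= CY * u by exact: mulr_ge0.
by rewrite !mulrDl !mulrDr; clear -h1 h2; lra.
Qed.
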